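(* The cut locus $\mathrm{Cut}_1$ of the sub-Riemannian space $(SU(1,1)\times\mathbb R,d_1)$ corresponding to $\mathrm{Id}$ is the set $\mathrm{Cut}_1=\mathrm{Cut}_1^{\rm loc}\cup\mathrm{Cut}_1^{\rm glob}$, where $$\mathrm{Cut}_1^{\rm loc}=\{(A,B,v)\in SU(1,1)\times\mathbb R\mid A\ne e^{-iv/2},\ B=0,\ v\in\mathbb R\},$$ $$\mathrm{Cut}_1^{\rm glob}=\{(A,B,v)\in SU(1,1)\times\mathbb R\mid B\neq0,\ \pi-v/2\in\mathrm{Arg}(A),\ v\in\mathbb R\},$$ and $\mathrm{Arg}(A)$ is the set of all values of the argument of the complex number $A$.
   Context: $SU(1,1)\times\mathbb R$ is the group of matrices $(A,B,v):=\begin{pmatrix}A&B&0\\ \overline B&\overline A&0\\0&0&e^v\end{pmatrix}$ with $A,B\in\mathbb C$, $|A|^2-|B|^2=1$, $v\in\mathbb R$; its Lie algebra has basis $E_1=\frac12(e_{12}+e_{21})$, $E_2=\frac i2(e_{12}-e_{21})$, $E_3=\frac i2(e_{11}-e_{22})$, $E_4=e_{33}$ ($e_{ij}$ are $3\times3$ matrix units). $d_1$ is the left-invariant sub-Riemannian metric defined by the left-invariant distribution with value $\mathrm{span}(E_1,E_4-E_3,E_2)$ at the unit $\mathrm{Id}$ and the inner product with orthonormal basis $E_1,E_4-E_3,E_2$. A shortest arc is a curve whose length equals the distance between its endpoints. The cut locus (for $\mathrm{Id}$) is the set of endpoints $g$ of all shortest arcs starting at $\mathrm{Id}$ and noncontinuable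 beyond $g$ (i.e. not extendable beyond $g$ to a longer shortest arc). *)

(* Defs.v *)
From Stdlib Require Import Reals Lra Lia.
From Coquelicot Require Import Coquelicot.
Open Scope R_scope.

Definition M3 : Type := @matrix C 3 3.

(* Coquelicot numbers matrix entries from 0. *)
Definition entry (M : M3) (i j : nat) : C := coeff_mat (RtoC 0) M i j.

Definition SU11R_elt (A B : C) (v : R) : M3 :=
  mk_matrix 3 3 (fun i j =>
    match i, j with
    | 0%nat, 0%nat => A
    | 0%nat, 1%nat => B
    | 1%nat, 0%nat => Cconj B
    | 1%nat, 1%nat => Cconj A
    | 2%nat, 2%nat => RtoC (exp v)
    | _, _ => RtoC 0
    end).

Definition SU11 (A B : C) : Prop := Cmod A ^ 2 - Cmod B ^ 2 = 1.

Definition in_SU11R (M : M3) : Prop :=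
  exists (A B : C) (v : R), SU11 A B /\ M = SU11R_elt A B v.

Definition mat_scal (c : C) (M : M3) : M3 :=
  mk_matrix 3 3 (fun i j => (c * entry M i j)%C).
Definition mat_plus (M N : M3) : M3 :=
  @plus (@matrix_AbelianGroup C_AbelianGroup 3 3) M N.
Definition mat_minus (M N : M3) : M3 :=
  @minus (@matrix_AbelianGroup C_AbelianGroup 3 3) M N.
Definition mat_mult (M N : M3) : M3 := @Mmult C_Ring 3 3 3 M N.
Definition mat_Id : M3 := @Mone C_Ring 3.

(* Matrix units e_{ij}, with the customary indices 1, 2, 3. *)
Definition munit (i j : nat) : M3 :=
  mk_matrix 3 3 (fun k l =>
    if andb (Nat.eqb (S k) i) (Nat.eqb (S l) j) then RtoC 1 else RtoC 0).

Definition E1 : M3 := mat_scal (RtoC (1 / 2)) (mat_plus (munit 1 2) (munit 2 1)).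
Definition E2 : M3 := mat_scal (Ci / RtoC 2)%C (mat_minus (munit 1 2) (munit 2 1)).
Definition E3 : M3 := mat_scal (Ci / RtoC 2)%C (mat_minus (munit 1 1) (munit 2 2)).
Definition E4 : M3 := munit 3 3.

Definition lin_comb (x : R * R * R) : M3 :=
  let '(x1, x2, x3) := x in
  mat_plus (mat_plus (mat_scal (RtoC x1) E1)
                     (mat_scal (RtoC x2) (mat_minus E4 E3)))
           (mat_scal (RtoC x3) E2).

(* The frame E1, E4 - E3, E2 is orthonormal. *)
Definition frame_norm (x : R * R * R) : R :=
  let '(x1, x2, x3) := x in sqrt (x1 ^ 2 + x2 ^ 2 + x3 ^ 2).

(* A continuous curve in the group, for the topology of entrywise convergence. *)
Definition curve_in_SU11R (gamma : R -> M3) (a b : R) : Prop :=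
  a <= b /\
  (forall t, a <= t <= b -> in_SU11R (gamma t)) /\
  (forall i j, (i < 3)%nat -> (j < 3)%nat ->
     continuous_on (fun t => a <= t <= b)
       (fun t => entry (gamma t) i j : C_UniformSpace)).

(* gamma is piecewise C^1 on [a, b] and, except at finitely many points,
   gamma'(t) = gamma(t) (u1 E1 + u2 (E4 - E3) + u3 E2), i.e. gamma'(t) lies in
   the left-invariant distribution and has frame coordinates u(t).  On each
   open piece u agrees with a control w that is continuous on all of R, which
   says that u extends continuously to the closed piece, i.e. that gamma is C^1
   up to the endpoints of the piece. *)
Definition horizontal_curve (gamma : R -> M3) (u : R -> R * R * R) (a b : R)
    : Prop :=
  curve_in_SU11R gamma a b /\
  exists (n : nat) (p : nat -> R),
    p 0%nat = a /\ p n = b /\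
    forall k, (k < n)%nat ->
      p k < p (S k) /\
      exists w : R -> R * R * R,
        (forall t, continuous w t) /\
        forall t, p k < t < p (S k) ->
          u t = w t /\
          forall i j, (i < 3)%nat -> (j < 3)%nat ->
            @is_derive R_AbsRing C_R_NormedModule
              (fun s => entry (gamma s) i j) t
              (entry (mat_mult (gamma t) (lin_comb (u t))) i j).

(* By the Chow-Rashevskii theorem any two group elements are joined by a
   horizontal curve, so the infimum is finite and [real] loses nothing. *)
Definition d1 (g h : M3) : R :=
  real (Glb_Rbar (fun l =>
    exists (gamma : R -> M3) (u : R -> R * R * R) (a b : R),
      horizontal_curve gamma u a b /\ gamma a = g /\ gamma b = h /\
      l = RInt (fun t => frame_norm (u t)) a b)).

(* Length of a curve in the metric space (SU(1,1) x R, d1). *)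
Definition curve_length (gamma : R -> M3) (a b : R) : Rbar :=
  Lub_Rbar (fun l =>
    exists (n : nat) (p : nat -> R),
      p 0%nat = a /\ p (S n) = b /\
      (forall k, (k <= n)%nat -> p k <= p (S k)) /\
      l = sum_f_R0 (fun k => d1 (gamma (p k)) (gamma (p (S k)))) n).

Definition shortest_arc (gamma : R -> M3) (a b : R) : Prop :=
  curve_in_SU11R gamma a b /\
  curve_length gamma a b = Finite (d1 (gamma a) (gamma b)).

(* The strict inequality between lengths excludes prolonging a shortest arc by
   merely staying at its endpoint. *)
Definition continuable (gamma : R -> M3) (a b : R) : Prop :=
  exists (eta : R -> M3) (c : R),
    b < c /\
    (forall t, a <= t <= b -> eta t = gamma t) /\
    shortest_arc eta a c /\
    Rbar_lt (curve_length gamma a b) (curve_length eta a c).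

Definition cut_locus (g0 g : M3) : Prop :=
  exists (gamma : R -> M3) (a b : R),
    shortest_arc gamma a b /\ gamma a = g0 /\ gamma b = g /\
    ~ continuable gamma a b.

Definition Cexp_i (theta : R) : C := (cos theta, sin theta).

Definition Arg (A : C) (theta : R) : Prop :=
  A <> RtoC 0 /\ A = (RtoC (Cmod A) * Cexp_i theta)%C.

Definition Cut1_loc (g : M3) : Prop :=
  exists (A B : C) (v : R),
    SU11 A B /\ g = SU11R_elt A B v /\
    A <> Cexp_i (- v / 2) /\ B = RtoC 0.

Definition Cut1_glob (g : M3) : Prop :=
  exists (A B : C) (v : R),
    SU11 A B /\ g = SU11R_elt A B v /\
    B <> RtoC 0 /\ Arg A (PI - v / 2).

(* Main.v *)
From Stdlib Require Import Reals Lra Lia List Compare_dec.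
From Coquelicot Require Import Coquelicot.
Require Import Defs.

(** With [C = A e^(iv/2)] and [D = B e^(-iv/2)] the metric becomes the product
    of the sub-Riemannian metric of SU(1,1) spanned by [E1, E2] and of the line
    of [v].  So [d1 Id g ^ 2 = T^2 + v^2], where [T] is the distance from the
    unit to [(C, D)] in SU(1,1) ([d1_Id]), and everything depends on [|B|] and
    on the argument of [C].

    SU(1,1) is a circle bundle over the hyperbolic plane.  Along a horizontal
    path from the unit, [|B| = sinh (r/2)] gives the distance [r] from the
    origin of the plane, the continuous argument [phi] of [C] measures the area
    that is swept, and the problem becomes that of Dido: reach a given radius
    with a given [phi] by a shortest path ([redpath], [reduction]).  The
    candidates are the curves of constant curvature [k]: equidistants,
    horocycles, and circles run through at most once.  They are optimal
    ([geodesic_minimal]) because [2 k phi] plus or minus a function of the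
    radius is 1-Lipschitz along every path in the region where it is defined
    ([calibration]).  For [k <= 1] this region is everything.  A circle is
    first closed up: the competing path followed by the rest of the circle is
    calibrated, outward and back, with the momentum whose turning radius is the
    largest radius reached, and a reversed Cauchy inequality compares the
    resulting bound with the full circle ([loop_bound]).  Explicit one-parameter
    families show that the candidates attain all values ([geo_exists]).  Hence
    [T] is a function of [|B|] and [phi], nondecreasing in [phi], and only the
    arguments of [C] in [[-PI, PI]] matter.

    Off the axis [B = 0], a geodesic with [|phi| < PI] at its end stays
    minimizing a little longer, and the distance from the unit grows linearly
    along it.  Every shortest arc to that point can then be prolonged by it
    ([continuable_intro]); so can the arcs to the points with [C = 1], [B = 0],
    which form a metric line.

    At the remaining points [g] a prolonged shortest arc would contain points [h]
    near [g] with [d1 Id h = d1 Id g + d1 g h].  This is impossible.  Where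
    [B <> 0] and [C < 0] a step towards larger [|phi|] gains nothing, because the
    mirror image of the geodesic takes over, and a radial step is strictly
    suboptimal, because no geodesic with [phi > 0] arrives radially
    ([strict_radial]).  On the axis all rotated copies of a circle end at [g];
    a step of length [s] changes [phi] by at most [s^2] ([redpath_axis_phi]), and
    near the axis arcs are no longer than loops of the same [phi], so that the
    distance grows by less than [s] ([strict_axis]). *)

(** * Monotonicity of piecewise smooth functions *)

Lemma is_derive_cont (f : R -> R) (x l : R) : is_derive f x l -> continuous f x.
Proof. intros H; apply (ex_derive_continuous f); now exists l. Qed.

(* The equalities left by the derivative lemmas live in a normed module, where [field] does not see them. *)
Ltac real_eq := match goal with |- ?u = ?v => change (@eq R u v) end.

Lemma is_derive_eq (f : R -> R) t d d' : is_derive f t d -> d = d' -> is_derive f t d'.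
Proof. now intros H <-. Qed.

Lemma ball_R (x e y : R) : ball x e y <-> Rabs (y - x) < e.
Proof. reflexivity. Qed.

Lemma continuous_near (f : R -> R) (x : R) : continuous f x ->
  forall e, 0 < e -> exists d, 0 < d /\ forall y, Rabs (y - x) < d -> Rabs (f y - f x) < e.
Proof.
  intros Hf e He. destruct (proj1 (filterlim_locally _ _) Hf (mkposreal e He)) as [d Hd].
  exists d. split; [apply cond_pos|]. intros y Hy. now apply (Hd y), ball_R.
Qed.

Lemma locally_near (x d : R) (P : R -> Prop) : 0 < d -> (forall y, Rabs (y - x) < d -> P y) -> locally x P.
Proof. intros Hd H. exists (mkposreal d Hd). intros y Hy. now apply H, ball_R. Qed.

Ltac cont :=
  cbv beta;
  try match goal with |- filterlim ?f (locally ?x) _ => change (continuous f x) end;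
  repeat first
  [ assumption | apply continuous_const | apply continuous_id
  | match goal with
    | |- continuous (fun t => @?f t + @?g t) ?x => refine (continuous_plus f g x _ _)
    | |- continuous (fun t => @?f t - @?g t) ?x => refine (continuous_minus f g x _ _)
    | |- continuous (fun t => @?f t * @?g t) ?x => refine (continuous_mult f g x _ _)
    | |- continuous (fun t => @?f t / @?g t) ?x => refine (continuous_mult f (fun t => / g t) x _ _)
    | |- continuous (fun t => - @?f t) ?x => refine (continuous_opp f x _)
    | |- continuous (fun t => / @?f t) ?x => refine (continuous_Rinv_comp f x _ _)
    | |- continuous (fun t => sqrt (@?f t)) ?x => refine (continuous_sqrt_comp f x _)
    | |- continuous (fun t => Rabs (@?f t)) ?x => refine (continuous_comp f Rabs x _ (continuous_Rabs _))
    | |- continuous (fun t => cos (@?f t)) ?x =>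
        refine (continuous_comp f cos x _ (is_derive_cont _ _ _ (is_derive_cos _)))
    | |- continuous (fun t => sin (@?f t)) ?x =>
        refine (continuous_comp f sin x _ (is_derive_cont _ _ _ (is_derive_sin _)))
    | |- continuous (fun t => atan (@?f t)) ?x =>
        refine (continuous_comp f atan x _ (is_derive_cont _ _ _ (is_derive_atan _)))
    | |- continuous (fun t => @?f t ^ ?n) ?x =>
        refine (continuous_comp f (fun y => y ^ n) x _ _);
        [|apply (ex_derive_continuous (fun y => y ^ n)); auto_derive; exact I]
    end ].

(** The list holds the corners of a piecewise smooth function; they are removed
    one by one, splitting the interval. *)
Lemma nonincreasing_off_list (l : list R) :
  forall (f : R -> R) (a b : R), a <= b ->
  (forall t, a <= t <= b -> continuous f t) ->
  (forall t, a < t < b -> ~ In t l -> exists d, is_derive f t d /\ d <= 0) ->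
  f b <= f a.
Proof.
  induction l as [|x l IH]; intros f a b Hab Hc Hd.
  - destruct (Req_dec a b) as [->|Hne]; [lra|].
    destruct (MVT_gen f a b (fun t => Rmin 0 (Derive f t))) as [c [Hc1 Hc2]].
    + rewrite Rmin_left, Rmax_right by lra. intros t Ht.
      destruct (Hd t Ht (fun H => H)) as [d [Hd1 Hd2]].
      rewrite (is_derive_unique _ _ _ Hd1), Rmin_right by lra. exact Hd1.
    + rewrite Rmin_left, Rmax_right by lra. intros t Ht.
      apply continuity_pt_filterlim, Hc, Ht.
    + assert (Rmin 0 (Derive f c) <= 0) by apply Rmin_l. nra.
  - destruct (Rlt_dec a x) as [Hax|Hax]; [destruct (Rlt_dec x b) as [Hxb|Hxb]|].
    + apply Rle_trans with (f x).
      * apply IH; [lra| intros; apply Hc; lra|].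
        intros t Ht Hn. apply Hd; [lra|]. intros [He|He]; [lra|easy].
      * apply IH; [lra| intros; apply Hc; lra|].
        intros t Ht Hn. apply Hd; [lra|]. intros [He|He]; [lra|easy].
    + apply IH; [lra|exact Hc|]. intros t Ht Hn. apply Hd; [lra|].
      intros [He|He]; [lra|easy].
    + apply IH; [lra|exact Hc|]. intros t Ht Hn. apply Hd; [lra|].
      intros [He|He]; [lra|easy].
Qed.

Lemma constant_off_list (l : list R) (f : R -> R) (a b : R) : a <= b ->
  (forall t, a <= t <= b -> continuous f t) ->
  (forall t, a < t < b -> ~ In t l -> is_derive f t 0) ->
  f b = f a.
Proof.
  intros Hab Hc Hd. apply Rle_antisym.
  - apply (nonincreasing_off_list l f a b Hab Hc).
    intros t Ht Hn; exists 0; split; [now apply Hd|lra].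
  - apply Ropp_le_cancel.
    apply (nonincreasing_off_list l (fun t => - f t) a b Hab).
    + intros t Ht; apply (continuous_opp f), Hc, Ht.
    + intros t Ht Hn; exists (-0); split; [|lra].
      apply (is_derive_opp f), Hd; auto.
Qed.

Lemma le_limit_right (G : R -> R) (c : R) :
  continuous G 0 -> (forall e, 0 < e -> G e <= c) -> G 0 <= c.
Proof.
  intros HG Hle. apply Rnot_lt_le; intros Hlt.
  destruct (continuous_near G 0 HG (G 0 - c) ltac:(lra)) as [d [Hd0 Hd]].
  assert (H := Hd (d / 2)). rewrite Rabs_pos_eq in H by lra. specialize (H ltac:(lra)).
  apply Rabs_def2 in H. specialize (Hle (d / 2) ltac:(lra)). lra.
Qed.

(** * Calibration *)

(** A [redpath] records what matters for lengths of a curve in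
    SU(1,1): [N = |B|^2], a continuous argument [phi] of
    [A e^(iv/2)] and the arclength [s] of the projection that forgets [v].
    In polar coordinates of the hyperbolic plane, [N = sinh^2 (r/2)], and the
    constraint on the derivatives says
    [(dr)^2 + (2 coth (r/2) dphi)^2 <= (ds)^2]. *)
Definition redpath (a b : R) (l : list R) (N phi s : R -> R) : Prop :=
  a <= b /\
  (forall t, a <= t <= b ->
     0 <= N t /\ continuous N t /\ continuous phi t /\ continuous s t) /\
  forall t, a < t < b -> ~ In t l ->
    exists x y sigma : R,
      is_derive N t x /\ is_derive phi t (y / (2 * (1 + N t))) /\
      is_derive s t sigma /\ 0 <= sigma /\
      x ^ 2 + y ^ 2 <= N t * (1 + N t) * sigma ^ 2.

Lemma redpath_sub a b l N phi s a' b' :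
  redpath a b l N phi s -> a <= a' -> a' <= b' -> b' <= b ->
  redpath a' b' l N phi s.
Proof.
  intros [H1 [H2 H3]] Ha Hab Hb; split; [easy|split].
  - intros t Ht; apply H2; lra.
  - intros t Ht; apply H3; lra.
Qed.

Lemma redpath_reflect a b l N phi s :
  redpath a b l N phi s -> redpath a b l N (fun t => - phi t) s.
Proof.
  intros [H1 [H2 H3]]; split; [easy|split].
  - intros t Ht; destruct (H2 t Ht) as [Ha [Hb [Hc Hd]]].
    repeat split; try easy. cont.
  - intros t Ht Hn; destruct (H3 t Ht Hn) as [x [y [sg [Hx [Hy [Hs [Hp Hi]]]]]]].
    exists x, (- y), sg. split; [easy|]. split; [|split; [easy|split; [easy|nra]]].
    replace (- y / (2 * (1 + N t))) with (opp (y / (2 * (1 + N t))))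
      by (unfold opp; simpl; unfold Rdiv; ring).
    exact (is_derive_opp phi t _ Hy).
Qed.

(** The derivative of the radial part of the calibration of momentum
    [2 k]; [sqrt] vanishes on negative numbers, so the function stays constant
    beyond the largest radius that a geodesic of this momentum reaches. *)
Definition dradial (k x : R) : R := 2 * sqrt (1 + (1 - k ^ 2) * x ^ 2) / (1 + x ^ 2).

Definition radial (k b : R) : R := RInt (dradial k) 0 b.

Lemma dradial_cont k x : continuous (dradial k) x.
Proof.
  unfold dradial. cont. nra.
Qed.

Lemma radial_derive k x : is_derive (radial k) x (dradial k x).
Proof.
  apply is_derive_RInt with (a := 0); [|apply dradial_cont].
  apply filter_forall; intros y. apply (RInt_correct (V := R_CompleteNormedModule)).
  apply (ex_RInt_continuous (V := R_CompleteNormedModule)); intros z _; apply dradial_cont.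
Qed.

Lemma radial_cont k x : continuous (radial k) x.
Proof. eapply is_derive_cont, radial_derive. Qed.

Lemma radial_0 k : radial k 0 = 0.
Proof. unfold radial. apply (RInt_point (V := R_CompleteNormedModule)). Qed.

Lemma cauchy_2 (a b x y r R0 : R) :
  0 <= r -> 0 <= R0 -> x ^ 2 + y ^ 2 <= r ^ 2 -> a ^ 2 + b ^ 2 <= R0 ^ 2 ->
  a * x + b * y <= R0 * r.
Proof.
  intros Hr HR H1 H2.
  assert (Hm : 0 <= R0 * r) by (apply Rmult_le_pos; lra).
  apply Rnot_lt_le; intros Hlt.
  assert ((R0 * r) ^ 2 < (a * x + b * y) ^ 2) by nra.
  assert ((a * x + b * y) ^ 2 <= (a ^ 2 + b ^ 2) * (x ^ 2 + y ^ 2)).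
  { assert (0 <= (a * y - b * x) ^ 2) by apply pow2_ge_0. nra. }
  assert ((a ^ 2 + b ^ 2) * (x ^ 2 + y ^ 2) <= R0 ^ 2 * r ^ 2).
  { apply Rmult_le_compat; nra. }
  nra.
Qed.

(** The eikonal inequality behind the calibration.  The radius is evaluated at
    [N + eps] to avoid the singularity of [sqrt N] at [N = 0]; moving the
    radial part outward only decreases its derivative. *)
Lemma eikonal_bound k N eps : 0 <= N -> 0 < eps -> k ^ 2 * N <= 1 + N ->
  N * (1 + N) * ((k / (1 + N)) ^ 2 + (dradial k (sqrt (N + eps)) / (2 * sqrt (N + eps))) ^ 2) <= 1.
Proof.
  intros HN He Hk.
  unfold dradial. set (M := N + eps).
  assert (HM : sqrt M ^ 2 = M) by (apply pow2_sqrt; unfold M; lra).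
  assert (HMp : 0 < sqrt M) by (apply sqrt_lt_R0; unfold M; lra).
  rewrite HM. set (q := 1 + (1 - k ^ 2) * M).
  replace ((2 * sqrt q / (1 + M) / (2 * sqrt M)) ^ 2) with (sqrt q ^ 2 / (M * (1 + M) ^ 2)).
  2:{ rewrite <- HM at 1. field. split; unfold M in *; lra. }
  assert (HMN : N < M) by (unfold M; lra).
  replace (N * (1 + N) * ((k / (1 + N)) ^ 2 + sqrt q ^ 2 / (M * (1 + M) ^ 2)))
    with (k ^ 2 * N / (1 + N) + N * (1 + N) * sqrt q ^ 2 / (M * (1 + M) ^ 2)) by (field; lra).
  destruct (Rle_dec 0 q) as [Hq|Hq].
  - rewrite pow2_sqrt by easy.
    assert (H1 : k ^ 2 * N / (1 + N) <= k ^ 2 * M / (1 + M)).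
    { apply Rminus_le. replace (k ^ 2 * N / (1 + N) - k ^ 2 * M / (1 + M))
        with (- (k ^ 2 * (M - N) / ((1 + N) * (1 + M)))) by (field; lra).
      assert (0 <= k ^ 2 * (M - N) / ((1 + N) * (1 + M))); [|lra].
      apply Rdiv_le_0_compat; nra. }
    assert (H2 : N * (1 + N) * q / (M * (1 + M) ^ 2) <= q / (1 + M)).
    { apply Rminus_le. replace (N * (1 + N) * q / (M * (1 + M) ^ 2) - q / (1 + M))
        with (- (q * (M * (1 + M) - N * (1 + N)) / (M * (1 + M) ^ 2))) by (field; lra).
      assert (0 <= q * (M * (1 + M) - N * (1 + N)) / (M * (1 + M) ^ 2)); [|lra].
      apply Rdiv_le_0_compat; [|nra]. apply Rmult_le_pos; nra. }
    assert (H3 : k ^ 2 * M / (1 + M) + q / (1 + M) = 1) by (unfold q; field; lra).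
    lra.
  - rewrite sqrt_neg_0 by lra.
    replace (k ^ 2 * N / (1 + N) + N * (1 + N) * 0 ^ 2 / (M * (1 + M) ^ 2))
      with (k ^ 2 * N / (1 + N)) by (field; lra).
    apply Rle_div_l; lra.
Qed.

(** Calibration: for every momentum [2 k] the function
    [2 k phi + e radial k (sqrt N)], with [e = 1] or [e = -1], is
    1-Lipschitz along paths that stay in the region where it is defined. *)
Lemma calibration a b l N phi s k e :
  redpath a b l N phi s -> (forall t, a <= t <= b -> k ^ 2 * N t <= 1 + N t) ->
  e ^ 2 = 1 ->
  2 * k * (phi b - phi a) + e * (radial k (sqrt (N b)) - radial k (sqrt (N a))) <= s b - s a.
Proof.
  intros [Hab [Hc Hd]] Hk He.
  set (G := fun eps => 2 * k * (phi b - phi a)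
     + e * (radial k (sqrt (N b + eps)) - radial k (sqrt (N a + eps)))).
  assert (HG : G 0 <= s b - s a).
  { apply le_limit_right.
    - assert (Hcr : forall x, continuous (fun eps => radial k (sqrt (x + eps))) 0).
      { intros x. apply (continuous_comp (fun eps => sqrt (x + eps)) (radial k)); [cont|apply radial_cont]. }
      unfold G. cont; apply Hcr.
    - intros eps Heps. unfold G.
      set (F := fun t => 2 * k * phi t + e * radial k (sqrt (N t + eps)) - s t).
      enough (F b <= F a) by (unfold F in *; lra).
      apply (nonincreasing_off_list l); [easy| |].
      + intros t Ht. destruct (Hc t Ht) as [HN [C1 [C2 C3]]]. unfold F. cont.
        apply (continuous_comp (fun t => sqrt (N t + eps)) (radial k)); [cont|apply radial_cont].
      + intros t Ht Hn.
        destruct (Hd t Ht Hn) as [x [y [sg [Hx [Hy [Hs [Hsg Hi]]]]]]].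
        assert (Ht' : a <= t <= b) by lra.
        destruct (Hc t Ht') as [HN _]. specialize (Hk t Ht').
        assert (Hpos : 0 < N t + eps) by lra.
        assert (Hsq : 0 < sqrt (N t + eps)) by now apply sqrt_lt_R0.
        set (w := dradial k (sqrt (N t + eps)) / (2 * sqrt (N t + eps))).
        exists (k / (1 + N t) * y + e * w * x - sg). split.
        * unfold F.
          replace (k / (1 + N t) * y + e * w * x - sg)
            with (minus (plus (2 * k * (y / (2 * (1 + N t))))
                 (e * (x / (2 * sqrt (N t + eps)) * dradial k (sqrt (N t + eps))))) sg).
          2:{ unfold minus, plus, opp; simpl; unfold w; field; split; lra. }
          apply (is_derive_minus (fun t => 2 * k * phi t + e * radial k (sqrt (N t + eps)))); [|easy].
          apply (is_derive_plus (fun t => 2 * k * phi t)).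
          -- now apply (is_derive_scal phi t (2 * k)).
          -- apply (is_derive_scal (fun t => radial k (sqrt (N t + eps))) t e).
             apply (is_derive_comp (radial k) (fun t => sqrt (N t + eps))).
             ++ apply radial_derive.
             ++ apply (is_derive_comp sqrt (fun t => N t + eps) t (/ (2 * sqrt (N t + eps))) x).
                ** apply is_derive_Reals, derivable_pt_lim_sqrt; lra.
                ** replace x with (plus x 0) by (unfold plus; simpl; ring).
                   apply (is_derive_plus N); [easy|apply @is_derive_const].
        * assert (Hw := eikonal_bound k (N t) eps HN Heps Hk). fold w in Hw.
          set (P := N t * (1 + N t)) in *.
          assert (HP : 0 <= P) by (unfold P; nra).
          enough (k / (1 + N t) * y + e * w * x <= 1 * sg) by lra.
          destruct (Req_dec P 0) as [HP0|HP0].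
          { rewrite HP0 in Hi. assert (x = 0 /\ y = 0) as [-> ->] by nra. lra. }
          assert (HsP : 0 < sqrt P) by (apply sqrt_lt_R0; lra).
          assert (HsP2 : sqrt P ^ 2 = P) by (apply pow2_sqrt; lra).
          replace (1 * sg) with ((/ sqrt P) * (sqrt P * sg)) by (field; lra).
          apply cauchy_2.
          -- apply Rmult_le_pos; lra.
          -- left; apply Rinv_0_lt_compat; lra.
          -- rewrite Rpow_mult_distr, HsP2. lra.
          -- rewrite pow_inv, HsP2, Rpow_mult_distr, He.
             apply Rmult_le_reg_l with P; [lra|]. rewrite Rinv_r by lra. lra. }
  unfold G in HG. now rewrite !Rplus_0_r in HG.
Qed.

(** * Geodesics from the unit *)

(** The solutions of [c' = - w s], [s' = c] with [c 0 = 1], [s 0 = 0]. *)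
Definition gsin (w t : R) : R :=
  if Rlt_dec w 0 then sinh (sqrt (- w) * t) / sqrt (- w)
  else if Rlt_dec 0 w then sin (sqrt w * t) / sqrt w else t.

Definition gcos (w t : R) : R :=
  if Rlt_dec w 0 then cosh (sqrt (- w) * t)
  else if Rlt_dec 0 w then cos (sqrt w * t) else 1.

Ltac rewrite_Derive H :=
  match type of H with
  | is_derive ?f ?x ?l =>
      let E := fresh in
      assert (E : Derive (fun y => f y) x = l) by (apply is_derive_unique; exact H);
      cbv beta in E; rewrite ?E; clear E
  end.

Lemma is_derive_sinh' x : is_derive sinh x (cosh x).
Proof. apply is_derive_Reals, derivable_pt_lim_sinh. Qed.
Lemma is_derive_cosh' x : is_derive cosh x (sinh x).
Proof. apply is_derive_Reals, derivable_pt_lim_cosh. Qed.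

Lemma is_derive_scaled (f : R -> R) (k t d : R) :
  is_derive f (k * t) d -> is_derive (fun t => f (k * t)) t (k * d).
Proof.
  intros H. apply (is_derive_comp f (fun t => k * t) t d k H).
  auto_derive; [easy|apply Rmult_1_r].
Qed.

Lemma gsin_derive w t : is_derive (gsin w) t (gcos w t).
Proof.
  unfold gsin, gcos. destruct (Rlt_dec w 0); [|destruct (Rlt_dec 0 w)].
  - assert (0 < sqrt (- w)) by (apply sqrt_lt_R0; lra).
    apply (is_derive_ext (fun t => / sqrt (- w) * sinh (sqrt (- w) * t))).
    { intros u; apply Rmult_comm. }
    replace (cosh (sqrt (- w) * t)) with (/ sqrt (-w) * (sqrt (-w) * cosh (sqrt (- w) * t))) by (field; lra).
    apply (is_derive_scal (fun t => sinh (sqrt (- w) * t))).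
    apply is_derive_scaled, is_derive_sinh'.
  - assert (0 < sqrt w) by (apply sqrt_lt_R0; lra).
    auto_derive; [easy|field; lra].
  - apply @is_derive_id.
Qed.

Lemma gcos_derive w t : is_derive (gcos w) t (- w * gsin w t).
Proof.
  unfold gsin, gcos. destruct (Rlt_dec w 0); [|destruct (Rlt_dec 0 w)].
  - assert (0 < sqrt (- w)) by (apply sqrt_lt_R0; lra).
    assert (Hs : sqrt (- w) * sqrt (- w) = - w) by (apply sqrt_def; lra).
    replace (- w * (sinh (sqrt (- w) * t) / sqrt (- w))) with (sqrt (- w) * sinh (sqrt (- w) * t)).
    + apply is_derive_scaled, is_derive_cosh'.
    + rewrite <- Hs at 3. field. lra.
  - assert (0 < sqrt w) by (apply sqrt_lt_R0; lra).
    assert (Hs : sqrt w * sqrt w = w) by (apply sqrt_def; lra).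
    auto_derive; [easy|]. rewrite <- Hs at 3. field; lra.
  - replace (- w * t) with 0 by (replace w with 0 by lra; ring). apply @is_derive_const.
Qed.

Lemma gsin_0 w : gsin w 0 = 0.
Proof.
  unfold gsin. destruct (Rlt_dec w 0); [|destruct (Rlt_dec 0 w)]; rewrite ?Rmult_0_r, ?sinh_0, ?sin_0;
  unfold Rdiv; try ring.
Qed.

Lemma gcos_0 w : gcos w 0 = 1.
Proof.
  unfold gcos. destruct (Rlt_dec w 0); [|destruct (Rlt_dec 0 w)]; rewrite ?Rmult_0_r, ?cosh_0, ?cos_0; easy.
Qed.

Lemma gcos_gsin w t : gcos w t ^ 2 + w * gsin w t ^ 2 = 1.
Proof.
  unfold gsin, gcos. destruct (Rlt_dec w 0); [|destruct (Rlt_dec 0 w)].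
  - assert (0 < sqrt (- w)) by (apply sqrt_lt_R0; lra).
    assert (Hs : sqrt (- w) ^ 2 = - w) by (apply pow2_sqrt; lra).
    set (z := sqrt (-w) * t).
    replace (w * (sinh z / sqrt (- w)) ^ 2) with (w / sqrt (-w) ^ 2 * sinh z ^ 2) by (field; lra).
    rewrite Hs. replace (w / - w) with (-1) by (field; lra).
    unfold cosh, sinh. assert (Hz : exp z * exp (- z) = 1) by (rewrite <- exp_plus, <- exp_0; f_equal; ring).
    nra.
  - assert (0 < sqrt w) by (apply sqrt_lt_R0; lra).
    assert (Hs : sqrt w ^ 2 = w) by (apply pow2_sqrt; lra).
    set (z := sqrt w * t).
    replace (w * (sin z / sqrt w) ^ 2) with (w / sqrt w ^ 2 * sin z ^ 2) by (field; lra).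
    rewrite Hs. replace (w / w) with 1 by (field; lra).
    assert (H1 := sin2_cos2 z). unfold Rsqr in H1. lra.
  - replace w with 0 by lra. ring.
Qed.

(** Along the geodesic of momentum [2 k], the projection of which has
    curvature [k] in the hyperbolic plane: [gB] is [|B| = sinh (r/2)],
    [gC - i k gB] is [A] up to a phase, and [gphi] is the argument [phi].
    The frequency [w = (k^2 - 1)/4] is positive exactly for circles. *)
Definition gB (k t : R) : R := gsin ((k ^ 2 - 1) / 4) t / 2.
Definition gC (k t : R) : R := gcos ((k ^ 2 - 1) / 4) t.

Lemma gB_derive k t : is_derive (gB k) t (gC k t / 2).
Proof.
  unfold gB, gC.
  apply (is_derive_ext (fun t => / 2 * gsin ((k ^ 2 - 1) / 4) t)).
  { intros u; apply Rmult_comm. }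
  replace (gcos ((k ^ 2 - 1) / 4) t / 2) with (/ 2 * gcos ((k ^ 2 - 1) / 4) t) by field.
  apply (is_derive_scal (gsin _)), gsin_derive.
Qed.

Lemma gC_derive k t : is_derive (gC k) t (- (k ^ 2 - 1) / 2 * gB k t).
Proof.
  unfold gB, gC.
  replace (- (k ^ 2 - 1) / 2 * (gsin ((k ^ 2 - 1) / 4) t / 2))
    with (- ((k ^ 2 - 1) / 4) * gsin ((k ^ 2 - 1) / 4) t) by field.
  apply gcos_derive.
Qed.

Lemma gB_0 k : gB k 0 = 0.
Proof. unfold gB; rewrite gsin_0; field. Qed.
Lemma gC_0 k : gC k 0 = 1.
Proof. apply gcos_0. Qed.
Lemma gC_gB k t : gC k t ^ 2 = 1 - (k ^ 2 - 1) * gB k t ^ 2.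
Proof. unfold gC, gB. assert (H := gcos_gsin ((k ^ 2 - 1) / 4) t). lra. Qed.
Lemma gB_cont k t : continuous (gB k) t.
Proof. eapply is_derive_cont, gB_derive. Qed.

Definition gdphi (k t : R) : R := k * gB k t ^ 2 / (2 * (1 + gB k t ^ 2)).
Definition gphi (k t : R) : R := RInt (gdphi k) 0 t.

Lemma gdphi_cont k t : continuous (gdphi k) t.
Proof.
  unfold gdphi. assert (H := gB_cont k t). cont. nra.
Qed.

Lemma gphi_derive k t : is_derive (gphi k) t (gdphi k t).
Proof.
  apply is_derive_RInt with (a := 0); [|apply gdphi_cont].
  apply filter_forall; intros y. apply (RInt_correct (V := R_CompleteNormedModule)).
  apply (ex_RInt_continuous (V := R_CompleteNormedModule)); intros z _; apply gdphi_cont.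
Qed.
Lemma gphi_cont k t : continuous (gphi k) t.
Proof. eapply is_derive_cont, gphi_derive. Qed.
Lemma gphi_0 k : gphi k 0 = 0.
Proof. unfold gphi. apply (RInt_point (V := R_CompleteNormedModule)). Qed.

(** Minus the argument of [gC - i k gB], by [gth_direction]. *)
Definition gth (k t : R) : R := k * t / 2 - gphi k t.

Lemma gth_derive k t : is_derive (gth k) t (k / (2 * (1 + gB k t ^ 2))).
Proof.
  replace (k / (2 * (1 + gB k t ^ 2))) with (minus (k / 2) (gdphi k t)).
  - apply (is_derive_minus (fun t => k * t / 2)); [|apply gphi_derive].
    auto_derive; [easy|field].
  - unfold minus, plus, opp, gdphi; simpl. field. nra.
Qed.

Lemma gth_cont k t : continuous (gth k) t.
Proof. eapply is_derive_cont, gth_derive. Qed.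
Lemma gth_0 k : gth k 0 = 0.
Proof. unfold gth; rewrite gphi_0; field. Qed.

Lemma derive0_const (f : R -> R) : (forall t, is_derive f t 0) -> forall t, f t = f 0.
Proof.
  intros H t. destruct (Rle_dec 0 t).
  - apply (constant_off_list nil f 0 t); [easy| |].
    + intros u _; eapply is_derive_cont, H.
    + intros; apply H.
  - symmetry. apply (constant_off_list nil f t 0); [lra| |].
    + intros u _; eapply is_derive_cont, H.
    + intros; apply H.
Qed.

Lemma sqrt_1p_pos x : 0 < sqrt (1 + x ^ 2).
Proof. apply sqrt_lt_R0. nra. Qed.
Lemma sqrt_1p_sq x : sqrt (1 + x ^ 2) ^ 2 = 1 + x ^ 2.
Proof. apply pow2_sqrt. nra. Qed.

Lemma rotate_back x y r z : x * cos z + y * sin z = r -> y * cos z - x * sin z = 0 ->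
  x = r * cos z /\ y = r * sin z.
Proof.
  intros <- H. assert (E := sin2_cos2 z). unfold Rsqr in E. split.
  - transitivity (x * (sin z * sin z + cos z * cos z) + sin z * (y * cos z - x * sin z)); [rewrite E, H|]; ring.
  - transitivity (y * (sin z * sin z + cos z * cos z) - cos z * (y * cos z - x * sin z)); [rewrite E, H|]; ring.
Qed.

(** The rotation by [gth] carries the positive real axis to the direction of
    [gC + i k gB]: the component across that direction solves a linear
    equation with zero initial value. *)
Lemma gth_direction k t :
  let a := sqrt (1 + gB k t ^ 2) in
  a * cos (gth k t) = gC k t /\ a * sin (gth k t) = k * gB k t.
Proof.
  assert (Ha := fun t => sqrt_1p_pos (gB k t)). assert (Ha2 := fun t => sqrt_1p_sq (gB k t)). cbv beta in Ha, Ha2.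
  assert (Hda : forall t, is_derive (fun t => / sqrt (1 + gB k t ^ 2)) t
     (- (gB k t * gC k t / (2 * sqrt (1 + gB k t ^ 2) ^ 3)))).
  { intros u.
    replace (- (gB k u * gC k u / (2 * sqrt (1 + gB k u ^ 2) ^ 3)))
      with (- (gB k u * gC k u / (2 * sqrt (1 + gB k u ^ 2))) / sqrt (1 + gB k u ^ 2) ^ 2) by (field; specialize (Ha u); lra).
    apply (is_derive_inv (fun t => sqrt (1 + gB k t ^ 2))); [|specialize (Ha u); lra].
    replace (gB k u * gC k u / (2 * sqrt (1 + gB k u ^ 2)))
      with ((2 * gB k u * (gC k u / 2)) * / (2 * sqrt (1 + gB k u ^ 2))) by (field; specialize (Ha u); lra).
    apply (is_derive_comp sqrt (fun t => 1 + gB k t ^ 2) u (/ (2 * sqrt (1 + gB k u ^ 2)))).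
    - apply is_derive_Reals, derivable_pt_lim_sqrt. nra.
    - assert (H := gB_derive k u). auto_derive; [now exists (gC k u / 2)|].
      rewrite_Derive H. ring. }
  set (g1 := fun t => (gC k t * cos (gth k t) + k * gB k t * sin (gth k t)) * / sqrt (1 + gB k t ^ 2)).
  set (g2 := fun t => (k * gB k t * cos (gth k t) - gC k t * sin (gth k t)) * / sqrt (1 + gB k t ^ 2)).
  assert (H1 : forall t, is_derive g1 t 0 /\ is_derive g2 t 0).
  { intros u. specialize (Hda u). specialize (Ha u). specialize (Ha2 u).
    assert (HB := gB_derive k u). assert (HC := gC_derive k u). assert (HT := gth_derive k u).
    assert (Hcs := gC_gB k u).
    pose (r := fun t => / sqrt (1 + gB k t ^ 2)).
    assert (Hb2 : gB k u ^ 2 = sqrt (1 + gB k u ^ 2) ^ 2 - 1) by lra.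
    split; unfold g1, g2; fold (r u).
    - apply (is_derive_ext (fun t => (gC k t * cos (gth k t) + k * gB k t * sin (gth k t)) * r t)); [easy|].
      auto_derive; [repeat split; try (eexists; eassumption)|].
      unfold r; rewrite_Derive Hda; rewrite_Derive HB; rewrite_Derive HC; rewrite_Derive HT.
      set (x := gth k u) in *. set (a := sqrt (1 + gB k u ^ 2)) in *. set (b := gB k u) in *. set (c := gC k u) in *.
      rewrite <- Ha2.
      match goal with |- ?L = 0 => replace L with (
        (cos x * b * ((1 - k ^ 2) * a ^ 2 + k ^ 2 - c ^ 2) + k * c * sin x * (a ^ 2 - 1 - b ^ 2)) / (2 * a ^ 3)) by (field; lra) end.
      rewrite Hcs, Ha2. field; lra.
    - apply (is_derive_ext (fun t => (k * gB k t * cos (gth k t) - gC k t * sin (gth k t)) * r t)); [easy|].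
      auto_derive; [repeat split; try (eexists; eassumption)|].
      unfold r; rewrite_Derive Hda; rewrite_Derive HB; rewrite_Derive HC; rewrite_Derive HT.
      set (x := gth k u) in *. set (a := sqrt (1 + gB k u ^ 2)) in *. set (b := gB k u) in *. set (c := gC k u) in *.
      rewrite <- Ha2.
      match goal with |- ?L = 0 => replace L with (
        (- sin x * b * ((1 - k ^ 2) * a ^ 2 + k ^ 2 - c ^ 2) + k * c * cos x * (a ^ 2 - 1 - b ^ 2)) / (2 * a ^ 3)) by (field; lra) end.
      rewrite Hcs, Ha2. field; lra. }
  assert (G1 : g1 t = 1).
  { rewrite (derive0_const g1); [|apply H1]. unfold g1. rewrite gC_0, gB_0, gth_0, cos_0, sin_0.
    replace (1 + 0 ^ 2) with 1 by ring. rewrite sqrt_1. field. }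
  assert (G2 : g2 t = 0).
  { rewrite (derive0_const g2); [|apply H1]. unfold g2. rewrite gC_0, gB_0, gth_0, cos_0, sin_0. ring. }
  unfold g1, g2 in G1, G2. cbv zeta.
  set (a := sqrt (1 + gB k t ^ 2)) in *. set (x := gth k t) in *.
  assert (Hap := Ha t). fold a in Hap.
  assert (E1 : gC k t * cos x + k * gB k t * sin x = a).
  { apply Rmult_eq_reg_r with (/ a); [rewrite G1; field; lra|]. apply Rinv_neq_0_compat; lra. }
  assert (E2 : k * gB k t * cos x - gC k t * sin x = 0).
  { apply Rmult_eq_reg_r with (/ a); [rewrite G2; ring|]. apply Rinv_neq_0_compat; lra. }
  destruct (rotate_back (gC k t) (k * gB k t) a x E1 E2) as [-> ->]. easy.
Qed.

(** Admissible parameters: a circle may be run through at most once. *)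
Definition adm (k T : R) : Prop :=
  0 <= k /\ 0 <= T /\ (1 < k -> sqrt (k ^ 2 - 1) / 2 * T <= PI).

Lemma adm_le k T t : adm k T -> 0 <= t <= T -> adm k t.
Proof.
  intros [Hk [HT Hc]] Ht; split; [easy|split; [lra|]].
  intros H1; specialize (Hc H1). assert (0 <= sqrt (k ^ 2 - 1)) by apply sqrt_pos. nra.
Qed.

Lemma sqrt_quarter w : sqrt (w / 4) = sqrt w / 2.
Proof.
  rewrite sqrt_div_alt by lra. replace 4 with (2 ^ 2) by ring. rewrite sqrt_pow2 by lra. easy.
Qed.

Lemma gB_circle k t : 1 < k -> gB k t = sin (sqrt (k ^ 2 - 1) / 2 * t) / sqrt (k ^ 2 - 1).
Proof.
  intros Hk. unfold gB, gsin.
  assert (0 < k ^ 2 - 1) by nra. assert (0 < sqrt (k ^ 2 - 1)) by now apply sqrt_lt_R0.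
  destruct (Rlt_dec ((k ^ 2 - 1) / 4) 0); [lra|]. destruct (Rlt_dec 0 ((k ^ 2 - 1) / 4)); [|lra].
  rewrite sqrt_quarter. field; lra.
Qed.

Lemma gC_circle k t : 1 < k -> gC k t = cos (sqrt (k ^ 2 - 1) / 2 * t).
Proof.
  intros Hk. unfold gC, gcos. assert (0 < k ^ 2 - 1) by nra.
  destruct (Rlt_dec ((k ^ 2 - 1) / 4) 0); [lra|]. destruct (Rlt_dec 0 ((k ^ 2 - 1) / 4)); [|lra].
  now rewrite sqrt_quarter.
Qed.

Lemma gC_pos k t : 0 <= k <= 1 -> 0 < gC k t.
Proof.
  intros Hk. unfold gC, gcos. assert (k ^ 2 - 1 <= 0) by nra.
  destruct (Rlt_dec ((k ^ 2 - 1) / 4) 0).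
  - unfold cosh. assert (forall z, 0 < exp z) by (intros; apply exp_pos).
    set (z := sqrt _ * t). assert (H1 := H0 z). specialize (H0 (- z)). lra.
  - destruct (Rlt_dec 0 ((k ^ 2 - 1) / 4)); lra.
Qed.

Lemma gB_pos k t : adm k t -> 0 < t -> (1 < k -> sqrt (k ^ 2 - 1) / 2 * t < PI) -> 0 < gB k t.
Proof.
  intros [Hk [_ _]] Ht Hc. destruct (Rlt_dec 1 k) as [H1|H1].
  - rewrite gB_circle by easy. specialize (Hc H1).
    assert (0 < sqrt (k ^ 2 - 1)) by (apply sqrt_lt_R0; nra).
    apply Rdiv_lt_0_compat; [|easy]. apply sin_gt_0; [|easy]. nra.
  - assert (Hdec : - gB k t < - gB k 0).
    { destruct (MVT_gen (gB k) 0 t (fun t => gC k t / 2)) as [c [_ Hc2]].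
      - intros; apply gB_derive.
      - intros; apply continuity_pt_filterlim, gB_cont.
      - assert (0 < gC k c) by (apply gC_pos; lra). nra. }
    rewrite gB_0 in Hdec. lra.
Qed.

Lemma gB_nonneg k t : adm k t -> 0 <= gB k t.
Proof.
  intros H. assert (Ha := H). destruct H as [Hk [HT Hc]].
  destruct (Req_dec t 0) as [->|Ht]; [rewrite gB_0; lra|].
  destruct (Rlt_dec 1 k) as [H1|H1].
  - rewrite gB_circle by easy. specialize (Hc H1).
    assert (0 < sqrt (k ^ 2 - 1)) by (apply sqrt_lt_R0; nra).
    apply Rdiv_le_0_compat; [|easy]. apply sin_ge_0; [|easy]. nra.
  - left. apply gB_pos; [easy|lra|]. intros; lra.
Qed.

Lemma gth_mono k s t : 0 <= k -> s <= t -> gth k s <= gth k t.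
Proof.
  intros Hk Hst. apply Ropp_le_cancel.
  apply (nonincreasing_off_list nil (fun t => - gth k t)); [easy| |].
  - intros u _. assert (H := gth_cont k u). cont.
  - intros u _ _. exists (- (k / (2 * (1 + gB k u ^ 2)))). split.
    + apply (is_derive_opp (gth k)), gth_derive.
    + assert (0 <= k / (2 * (1 + gB k u ^ 2))); [|lra]. apply Rdiv_le_0_compat; nra.
Qed.

(** As long as [k gB >= 0], the angle [gth], starting from 0, stays in
    [[0, PI]]: past [PI] its sine would be negative. *)
Lemma gth_range k t : adm k t -> 0 <= gth k t <= PI.
Proof.
  intros Ha. assert (Hk : 0 <= k) by apply Ha. assert (Ht : 0 <= t) by apply Ha.
  split. { rewrite <- (gth_0 k). now apply gth_mono. }
  apply Rnot_lt_le; intros Hlt.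
  assert (HPI := PI_RGT_0).
  set (y := Rmin (gth k t) (3 * PI / 2)).
  assert (Hy1 : PI < y) by (unfold y; apply Rmin_glb_lt; lra).
  assert (Hy2 : y < 2 * PI) by (unfold y; apply Rle_lt_trans with (1 := Rmin_r _ _); lra).
  destruct (IVT_gen (gth k) 0 t y) as [u [Hu1 Hu2]].
  - intros u; apply continuity_pt_filterlim, gth_cont.
  - rewrite gth_0, Rmin_left, Rmax_right by lra. split; [lra|]. apply Rmin_l.
  - rewrite Rmin_left, Rmax_right in Hu1 by lra.
    destruct (gth_direction k u) as [_ Hs]. rewrite Hu2 in Hs.
    assert (0 <= gB k u) by (apply gB_nonneg, (adm_le k t); easy).
    assert (sin y < 0) by (apply sin_lt_0; easy).
    assert (0 < sqrt (1 + gB k u ^ 2)) by (apply sqrt_lt_R0; nra). nra.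
Qed.

Lemma cos_inj_0_PI x y : 0 <= x <= PI -> 0 <= y <= PI -> cos x = cos y -> x = y.
Proof.
  intros Hx Hy H. destruct (Rtotal_order x y) as [h|[h|h]]; [|easy|].
  - assert (cos y < cos x) by (apply cos_decreasing_1; lra). lra.
  - assert (cos x < cos y) by (apply cos_decreasing_1; lra). lra.
Qed.

Lemma gth_eq k t x : adm k t -> 0 <= x <= PI ->
  sqrt (1 + gB k t ^ 2) * cos x = gC k t -> gth k t = x.
Proof.
  intros Ha Hx H. apply cos_inj_0_PI; [now apply gth_range|easy|].
  destruct (gth_direction k t) as [Hc _].
  assert (0 < sqrt (1 + gB k t ^ 2)) by (apply sqrt_lt_R0; nra). nra.
Qed.

Lemma gphi_mono k s t : 0 <= k -> s <= t -> gphi k s <= gphi k t.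
Proof.
  intros Hk Hst. apply Ropp_le_cancel.
  apply (nonincreasing_off_list nil (fun t => - gphi k t)); [easy| |].
  - intros u _. assert (H := gphi_cont k u). cont.
  - intros u _ _. exists (- gdphi k u). split.
    + apply (is_derive_opp (gphi k)), gphi_derive.
    + assert (0 <= gdphi k u); [|lra]. apply Rdiv_le_0_compat; nra.
Qed.

Lemma gphi_nonneg k t : 0 <= k -> 0 <= t -> 0 <= gphi k t.
Proof. intros; rewrite <- (gphi_0 k); now apply gphi_mono. Qed.

Lemma redpath_geodesic k a b : a <= b ->
  redpath a b nil (fun t => gB k t ^ 2) (gphi k) (fun t => t).
Proof.
  intros Hab; split; [easy|split].
  - intros t _. split; [nra|split; [|split; [apply gphi_cont|apply continuous_id]]].
    assert (H := gB_cont k t). cont.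
  - intros t _ _. exists (gB k t * gC k t), (k * gB k t ^ 2), 1.
    split; [|split; [apply gphi_derive|split; [apply @is_derive_id|split; [lra|]]]].
    + assert (H := gB_derive k t). auto_derive; [now exists (gC k t / 2)|].
      rewrite_Derive H. field.
    + rewrite !Rpow_mult_distr, gC_gB. nra.
Qed.

Lemma dradial_gB k t : 0 <= gC k t -> dradial k (gB k t) = 2 * gC k t / (1 + gB k t ^ 2).
Proof.
  intros Hc. unfold dradial.
  replace (1 + (1 - k ^ 2) * gB k t ^ 2) with (gC k t ^ 2) by (rewrite gC_gB; ring).
  now rewrite sqrt_pow2.
Qed.

(** The calibration of momentum [2 k] is exact on the geodesic of the same
    momentum, as long as this geodesic moves away from the axis. *)
Lemma radial_gB k t : adm k t -> (forall u, 0 <= u <= t -> 0 <= gC k u) ->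
  radial k (gB k t) = t - 2 * k * gphi k t.
Proof.
  intros Ha Hc. assert (Ht : 0 <= t) by apply Ha.
  set (F := fun t => radial k (gB k t) + 2 * k * gphi k t - t).
  enough (F t = F 0).
  { unfold F in H. rewrite gB_0, radial_0, gphi_0 in H. lra. }
  apply (constant_off_list nil); [easy| |].
  - intros u _. assert (H := gphi_cont k u). unfold F. cont.
    apply (continuous_comp (gB k) (radial k)); [apply gB_cont|apply radial_cont].
  - intros u Hu _. unfold F.
    replace 0 with (minus (plus (gC k u / 2 * dradial k (gB k u)) (2 * k * gdphi k u)) 1).
    + apply (is_derive_minus (fun t => radial k (gB k t) + 2 * k * gphi k t)); [|apply @is_derive_id].
      apply (is_derive_plus (fun t => radial k (gB k t))).
      * apply (is_derive_comp (radial k) (gB k)); [apply radial_derive|apply gB_derive].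
      * apply (is_derive_scal (gphi k)), gphi_derive.
    + change (gC k u / 2 * dradial k (gB k u) + 2 * k * gdphi k u + - (1) = 0).
      rewrite dradial_gB by (apply Hc; lra).
      unfold gdphi. assert (H := gC_gB k u).
      transitivity ((gC k u ^ 2 + k ^ 2 * gB k u ^ 2 - 1 - gB k u ^ 2) / (1 + gB k u ^ 2)); [field; nra|].
      rewrite H. field. nra.
Qed.

Lemma region_gB k t : k ^ 2 * gB k t ^ 2 <= 1 + gB k t ^ 2.
Proof. assert (H := gC_gB k t). assert (0 <= gC k t ^ 2) by nra. lra. Qed.

Lemma adm_half k : 1 < k -> adm k (PI / sqrt (k ^ 2 - 1)).
Proof.
  intros Hk. assert (0 < sqrt (k ^ 2 - 1)) by (apply sqrt_lt_R0; nra). assert (HP := PI_RGT_0).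
  split; [lra|split; [apply Rdiv_le_0_compat; lra|]]. intros _.
  replace (sqrt (k ^ 2 - 1) / 2 * (PI / sqrt (k ^ 2 - 1))) with (PI / 2) by (field; lra). lra.
Qed.

Lemma adm_full k : 1 < k -> adm k (2 * PI / sqrt (k ^ 2 - 1)).
Proof.
  intros Hk. assert (0 < sqrt (k ^ 2 - 1)) by (apply sqrt_lt_R0; nra). assert (HP := PI_RGT_0).
  split; [lra|split; [apply Rdiv_le_0_compat; lra|]]. intros _.
  replace (sqrt (k ^ 2 - 1) / 2 * (2 * PI / sqrt (k ^ 2 - 1))) with PI by (field; lra). lra.
Qed.

Lemma gB_half k : 1 < k -> gB k (PI / sqrt (k ^ 2 - 1)) = 1 / sqrt (k ^ 2 - 1).
Proof.
  intros Hk. rewrite gB_circle by easy. assert (0 < sqrt (k ^ 2 - 1)) by (apply sqrt_lt_R0; nra).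
  replace (sqrt (k ^ 2 - 1) / 2 * (PI / sqrt (k ^ 2 - 1))) with (PI / 2) by (field; lra).
  now rewrite sin_PI2.
Qed.

Lemma gphi_half k : 1 < k -> gphi k (PI / sqrt (k ^ 2 - 1)) = k * PI / (2 * sqrt (k ^ 2 - 1)) - PI / 2.
Proof.
  intros Hk. assert (0 < sqrt (k ^ 2 - 1)) by (apply sqrt_lt_R0; nra). assert (HP := PI_RGT_0).
  assert (Hth : gth k (PI / sqrt (k ^ 2 - 1)) = PI / 2).
  { apply gth_eq; [now apply adm_half|lra|]. rewrite gC_circle, cos_PI2 by easy.
    replace (sqrt (k ^ 2 - 1) / 2 * (PI / sqrt (k ^ 2 - 1))) with (PI / 2) by (field; lra).
    rewrite cos_PI2; ring. }
  unfold gth in Hth. apply (Rplus_eq_reg_r (PI / 2)). rewrite <- Hth at 1. field. lra.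
Qed.

Lemma gB_full k : 1 < k -> gB k (2 * PI / sqrt (k ^ 2 - 1)) = 0.
Proof.
  intros Hk. rewrite gB_circle by easy. assert (0 < sqrt (k ^ 2 - 1)) by (apply sqrt_lt_R0; nra).
  replace (sqrt (k ^ 2 - 1) / 2 * (2 * PI / sqrt (k ^ 2 - 1))) with PI by (field; lra).
  rewrite sin_PI. field; lra.
Qed.

Lemma gphi_full k : 1 < k -> gphi k (2 * PI / sqrt (k ^ 2 - 1)) = k * PI / sqrt (k ^ 2 - 1) - PI.
Proof.
  intros Hk. assert (0 < sqrt (k ^ 2 - 1)) by (apply sqrt_lt_R0; nra). assert (HP := PI_RGT_0).
  assert (Hth : gth k (2 * PI / sqrt (k ^ 2 - 1)) = PI).
  { apply gth_eq; [now apply adm_full|lra|]. rewrite gC_circle, gB_full, cos_PI by easy.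
    replace (sqrt (k ^ 2 - 1) / 2 * (2 * PI / sqrt (k ^ 2 - 1))) with PI by (field; lra).
    rewrite cos_PI. replace (1 + 0 ^ 2) with 1 by ring. rewrite sqrt_1. ring. }
  unfold gth in Hth. apply (Rplus_eq_reg_r PI). rewrite <- Hth at 2. field. lra.
Qed.

Lemma radial_max k : 1 < k -> radial k (1 / sqrt (k ^ 2 - 1)) = PI * (k - sqrt (k ^ 2 - 1)).
Proof.
  intros Hk. assert (Hs : 0 < sqrt (k ^ 2 - 1)) by (apply sqrt_lt_R0; nra). assert (HP := PI_RGT_0).
  rewrite <- gB_half by easy. rewrite radial_gB.
  - rewrite gphi_half by easy.
    replace (PI / sqrt (k ^ 2 - 1) - 2 * k * (k * PI / (2 * sqrt (k ^ 2 - 1)) - PI / 2))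
      with (PI * (k - (k ^ 2 - 1) / sqrt (k ^ 2 - 1))) by (field; lra).
    f_equal. f_equal. rewrite <- (sqrt_sqrt (k ^ 2 - 1)) at 1 by nra. field; lra.
  - now apply adm_half.
  - intros u Hu. rewrite gC_circle by easy. apply cos_ge_0.
    + assert (0 <= sqrt (k ^ 2 - 1) / 2 * u) by nra. lra.
    + replace (PI / 2) with (sqrt (k ^ 2 - 1) / 2 * (PI / sqrt (k ^ 2 - 1))) by (field; lra).
      apply Rmult_le_compat_l; lra.
Qed.

(** * The isoperimetric lower bound *)

Lemma region_bound k M N : 1 < k -> 0 <= N -> (k ^ 2 - 1) * M ^ 2 = 1 -> N <= M ^ 2 -> k ^ 2 * N <= 1 + N.
Proof. intros Hk HN H1 H2. assert (0 < k ^ 2 - 1) by nra. nra. Qed.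

(** Reversed Cauchy inequality for the unit vectors [(k, sqrt (k^2 - 1))] of
    the Lorentz plane.  It holds for every [k'], so the full circle of momentum
    [k] is shorter than what any other momentum allows for its holonomy. *)
Lemma reversed_cauchy k k' : 1 < k -> 1 < k' ->
  1 <= k * k' - sqrt (k ^ 2 - 1) * sqrt (k' ^ 2 - 1).
Proof.
  intros Hk Hk'. assert (H1 : sqrt (k ^ 2 - 1) ^ 2 = k ^ 2 - 1) by (apply pow2_sqrt; nra).
  assert (H2 : sqrt (k' ^ 2 - 1) ^ 2 = k' ^ 2 - 1) by (apply pow2_sqrt; nra).
  assert (H3 := sqrt_pos (k ^ 2 - 1)). assert (H4 := sqrt_pos (k' ^ 2 - 1)).
  set (p := sqrt (k ^ 2 - 1)) in *. set (q := sqrt (k' ^ 2 - 1)) in *.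
  assert (Hkk : 1 < k * k') by nra.
  assert (Hpq : (p * q) ^ 2 = (k ^ 2 - 1) * (k' ^ 2 - 1)) by (rewrite Rpow_mult_distr, H1, H2; ring).
  assert (0 <= p * q) by (apply Rmult_le_pos; easy).
  assert (0 <= (k - k') ^ 2) by (apply pow2_ge_0).
  assert ((p * q) ^ 2 <= (k * k' - 1) ^ 2).
  { rewrite Hpq. apply Rminus_le.
    replace ((k ^ 2 - 1) * (k' ^ 2 - 1) - (k * k' - 1) ^ 2) with (- (k - k') ^ 2) by ring. lra. }
  assert (p * q <= k * k' - 1) by (apply Rsqr_incr_0_var; unfold Rsqr; nra). lra.
Qed.

(** On the right is the bound that the calibration of momentum [2 k'] gives for
    a closed curve of holonomy [Phi] going out to the turning radius and back;
    on the left is the length of the full circle of momentum [2 k]. *)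
Lemma loop_bound k k' Phi : 1 < k -> 1 < k' -> k * PI / sqrt (k ^ 2 - 1) - PI <= Phi ->
  2 * PI / sqrt (k ^ 2 - 1) <= 2 * k' * Phi + 2 * (PI * (k' - sqrt (k' ^ 2 - 1))).
Proof.
  intros Hk Hk' HPhi. assert (HP := PI_RGT_0).
  assert (Hs : 0 < sqrt (k ^ 2 - 1)) by (apply sqrt_lt_R0; nra).
  assert (Hrc := reversed_cauchy k k' Hk Hk').
  set (p := sqrt (k ^ 2 - 1)) in *. set (q := sqrt (k' ^ 2 - 1)) in *.
  apply Rle_trans with (2 * k' * (k * PI / p - PI) + 2 * (PI * (k' - q))); [|nra].
  apply Rmult_le_reg_r with p; [easy|].
  replace (2 * PI / p * p) with (2 * PI) by (field; lra).
  replace ((2 * k' * (k * PI / p - PI) + 2 * (PI * (k' - q))) * p)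
    with (2 * PI * (k * k' - p * q)) by (field; lra).
  nra.
Qed.

Lemma momentum_of_radius M : 0 < M ->
  let k := sqrt (1 + M ^ 2) / M in
  1 < k /\ (k ^ 2 - 1) * M ^ 2 = 1 /\ 1 / sqrt (k ^ 2 - 1) = M.
Proof.
  intros HM k.
  assert (H : sqrt (1 + M ^ 2) ^ 2 = 1 + M ^ 2) by (apply pow2_sqrt; nra).
  assert (H0 : 0 < sqrt (1 + M ^ 2)) by (apply sqrt_lt_R0; nra).
  assert (Hk2 : k ^ 2 - 1 = (1 / M) ^ 2).
  { unfold k. replace ((sqrt (1 + M ^ 2) / M) ^ 2) with (sqrt (1 + M ^ 2) ^ 2 / M ^ 2) by (field; lra).
    rewrite H. field. lra. }
  assert (HMi : 0 < 1 / M) by (apply Rdiv_lt_0_compat; lra).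
  split; [|split].
  - assert (0 < k) by (apply Rdiv_lt_0_compat; lra). nra.
  - rewrite Hk2. field. lra.
  - rewrite Hk2, sqrt_pow2 by lra. field; lra.
Qed.

Lemma redpath_max a b l N phi s : redpath a b l N phi s ->
  exists tau, a <= tau <= b /\ forall t, a <= t <= b -> N t <= N tau.
Proof.
  intros [Hab [Hc _]].
  destruct (continuity_ab_maj N a b Hab) as [tau [H1 H2]].
  - intros t Ht. apply continuity_pt_filterlim, (Hc t Ht).
  - now exists tau.
Qed.

Lemma calib_le a b l N phi s k e :
  redpath a b l N phi s -> (forall t, a <= t <= b -> k ^ 2 * N t <= 1 + N t) -> e = 1 \/ e = -1 ->
  2 * k * (phi b - phi a) + e * (radial k (sqrt (N b)) - radial k (sqrt (N a))) <= s b - s a.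
Proof. intros H1 H2 H3. apply (calibration a b l); [easy|easy|]. destruct H3 as [-> | ->]; ring. Qed.

(** In the second half of its turn a circle comes back to the axis. *)
Lemma gB_return k T t : 1 < k -> adm k T -> PI / sqrt (k ^ 2 - 1) <= T ->
  T <= t <= 2 * PI / sqrt (k ^ 2 - 1) -> gB k t <= gB k T.
Proof.
  intros Hk Ha HT Ht. rewrite !gB_circle by easy.
  assert (Hs : 0 < sqrt (k ^ 2 - 1)) by (apply sqrt_lt_R0; nra).
  apply Rmult_le_compat_r; [left; now apply Rinv_0_lt_compat|].
  set (p := sqrt (k ^ 2 - 1)) in *.
  assert (PI / 2 <= p / 2 * T).
  { replace (PI / 2) with (p / 2 * (PI / p)) by (field; lra). apply Rmult_le_compat_l; lra. }
  assert (p / 2 * t <= PI).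
  { apply Rle_trans with (p / 2 * (2 * PI / p)); [apply Rmult_le_compat_l; lra|right; field; lra]. }
  assert (p / 2 * T <= p / 2 * t) by (apply Rmult_le_compat_l; lra).
  destruct (Req_dec (p / 2 * T) (p / 2 * t)) as [->|Hne]; [lra|].
  left. apply sin_decreasing_1; lra.
Qed.

Lemma gB_le_max k t : 1 < k -> gB k t <= 1 / sqrt (k ^ 2 - 1).
Proof.
  intros Hk. rewrite gB_circle by easy. assert (Hs : 0 < sqrt (k ^ 2 - 1)) by (apply sqrt_lt_R0; nra).
  apply Rmult_le_compat_r; [left; now apply Rinv_0_lt_compat|]. apply SIN_bound.
Qed.

(** Circle arcs are compared with closed curves: close up with the rest of
    the circle, let [M] be the largest value of [sqrt N] on the path, and
    calibrate with the momentum for which [M] is the turning radius.  The rest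
    of the circle may leave this region only if [M] is below the turning radius
    of the circle and the arc ends before it; then the momentum of the circle
    itself calibrates both pieces. *)
Lemma geodesic_minimal_circle k T a b l N phi s :
  1 < k -> adm k T -> redpath a b l N phi s -> N a = 0 -> phi a = 0 ->
  N b = gB k T ^ 2 -> gphi k T <= phi b -> T <= s b - s a.
Proof.
  intros Hk HT Hp HNa Hpa HNb Hpb.
  assert (HP := PI_RGT_0).
  assert (Hs : 0 < sqrt (k ^ 2 - 1)) by (apply sqrt_lt_R0; nra).
  set (Tf := 2 * PI / sqrt (k ^ 2 - 1)).
  assert (HTf : T <= Tf).
  { destruct HT as [_ [_ HT]]. specialize (HT Hk). unfold Tf.
    apply Rmult_le_reg_l with (sqrt (k ^ 2 - 1) / 2); [lra|].
    replace (sqrt (k ^ 2 - 1) / 2 * (2 * PI / sqrt (k ^ 2 - 1))) with PI by (field; lra). lra. }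
  assert (HT0 : 0 <= T) by apply HT.
  assert (HsB : sqrt (N b) = gB k T) by (rewrite HNb; apply sqrt_pow2, gB_nonneg, HT).
  assert (HgT : gB k Tf = 0) by now apply gB_full.
  assert (HpT : gphi k Tf = k * PI / sqrt (k ^ 2 - 1) - PI) by now apply gphi_full.
  assert (HB : forall t, 0 <= t <= Tf -> 0 <= gB k t).
  { intros t Ht. apply gB_nonneg, (adm_le k Tf); [now apply adm_full|lra]. }
  assert (Hsq : forall t, 0 <= t <= Tf -> sqrt (gB k t ^ 2) = gB k t) by (intros t Ht; now apply sqrt_pow2, HB).
  destruct (redpath_max _ _ _ _ _ _ Hp) as [tau [Ht1 Ht2]].
  assert (HN0 : forall t, a <= t <= b -> 0 <= N t) by (intros t Ht; now apply (proj1 (proj2 Hp))).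
  assert (Hab : a <= b) by apply Hp.
  set (M := sqrt (N tau)).
  assert (HM2 : M ^ 2 = N tau) by (apply pow2_sqrt, HN0, Ht1).
  assert (HM0 : 0 <= M) by apply sqrt_pos.
  (* the bound on the closed curve when the given path reaches its largest radius *)
  assert (Main : 0 < M -> (forall t, T <= t <= Tf -> gB k t <= M) -> T <= s b - s a).
  { intros HM Hin. destruct (momentum_of_radius M HM) as [Hk' [Hkm HkM]].
    set (k' := sqrt (1 + M ^ 2) / M) in *.
    assert (Hreg : forall t, a <= t <= b -> k' ^ 2 * N t <= 1 + N t).
    { intros t Ht. apply (region_bound k' M); auto. rewrite HM2. auto. }
    assert (C1 := calib_le a tau l N phi s k' 1 (redpath_sub _ _ _ _ _ _ a tau Hp ltac:(lra) ltac:(lra) ltac:(lra))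
       ltac:(intros; apply Hreg; lra) ltac:(now left)).
    assert (C2 := calib_le tau b l N phi s k' (-1) (redpath_sub _ _ _ _ _ _ tau b Hp ltac:(lra) ltac:(lra) ltac:(lra))
       ltac:(intros; apply Hreg; lra) ltac:(now right)).
    assert (C3 := calib_le T Tf nil _ _ _ k' (-1) (redpath_geodesic k T Tf HTf)
       ltac:(intros t Ht; apply (region_bound k' M); auto; [nra|]; assert (Hb1 := Hin t Ht);
             assert (Hb2 := HB t ltac:(lra)); nra) ltac:(now right)).
    rewrite HNa, sqrt_0, radial_0, Hpa in C1. fold M in C1, C2. rewrite HsB in C2.
    cbv beta in C3. rewrite !Hsq, HgT, radial_0 in C3 by lra.
    rewrite <- HkM, radial_max in C1, C2 by easy.
    assert (L := loop_bound k k' (phi b + (gphi k Tf - gphi k T)) Hk Hk' ltac:(lra)).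
    fold Tf in L. lra. }
  destruct (Rle_dec (1 / sqrt (k ^ 2 - 1)) M) as [HMk|HMk].
  { apply Main.
    - apply Rlt_le_trans with (2 := HMk). apply Rdiv_lt_0_compat; lra.
    - intros t Ht. apply Rle_trans with (2 := HMk). now apply gB_le_max. }
  set (Th := PI / sqrt (k ^ 2 - 1)).
  assert (HTh : 0 < Th) by (apply Rdiv_lt_0_compat; lra).
  destruct (Rle_dec Th T) as [Hret|Hout].
  - assert (HBM : gB k T <= M).
    { rewrite <- HsB. apply sqrt_le_1_alt, Ht2. lra. }
    destruct (Req_dec M 0) as [HMz|HMz].
    + (* the path never leaves the axis, where [phi] cannot move: any momentum calibrates *)
      exfalso.
      assert (Hpos : 0 < phi b).
      { apply Rlt_le_trans with (2 := Hpb).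
        assert (HT2 := gphi_mono k Th T ltac:(lra) Hret). unfold Th in HT2. rewrite gphi_half in HT2 by easy.
        apply Rlt_le_trans with (2 := HT2).
        assert (Hp2 : sqrt (k ^ 2 - 1) ^ 2 = k ^ 2 - 1) by (apply pow2_sqrt; nra).
        assert (sqrt (k ^ 2 - 1) < k) by nra.
        replace (k * PI / (2 * sqrt (k ^ 2 - 1)) - PI / 2)
          with (PI * (k - sqrt (k ^ 2 - 1)) / (2 * sqrt (k ^ 2 - 1))) by (field; lra).
        apply Rdiv_lt_0_compat; nra. }
      assert (HNz : forall t, a <= t <= b -> N t = 0).
      { intros t Ht. specialize (Ht2 t Ht). specialize (HN0 t Ht). rewrite <- HM2, HMz in Ht2. nra. }
      set (k' := (Rabs (s b - s a) + 1) / (2 * phi b)).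
      assert (C := calib_le a b l N phi s k' 1 Hp
         ltac:(intros t Ht; rewrite HNz by easy; lra) ltac:(now left)).
      rewrite (HNz a), (HNz b), Hpa in C by lra.
      assert (E : 2 * k' * (phi b - 0) = Rabs (s b - s a) + 1) by (unfold k'; field; lra).
      assert (Hr := Rle_abs (s b - s a)). lra.
    + apply Main; [lra|]. intros t Ht. apply Rle_trans with (2 := HBM). now apply gB_return.
  - assert (HTh2 : Th <= Tf) by (unfold Th, Tf; apply Rmult_le_compat_r; [left; now apply Rinv_0_lt_compat|lra]).
    assert (C1 := calib_le a b l N phi s k 1 Hp
      ltac:(intros t Ht; assert (Ha := Ht2 t Ht); assert (Hb := HN0 t Ht);
            apply (region_bound k (1 / sqrt (k ^ 2 - 1))); auto;
            [replace (k ^ 2 - 1) with (sqrt (k ^ 2 - 1) ^ 2) at 1 by (apply pow2_sqrt; nra); field; lra|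
             assert (M < 1 / sqrt (k ^ 2 - 1)) by lra; nra]) ltac:(now left)).
    assert (C2 := calib_le T Th nil _ _ _ k 1 (redpath_geodesic k T Th ltac:(lra))
       ltac:(intros; apply region_gB) ltac:(now left)).
    assert (C3 := calib_le Th Tf nil _ _ _ k (-1) (redpath_geodesic k Th Tf HTh2)
       ltac:(intros; apply region_gB) ltac:(now right)).
    cbv beta in C2, C3. rewrite !Hsq in C2, C3 by lra.
    rewrite HNa, sqrt_0, radial_0, Hpa, HsB in C1. rewrite HgT, radial_0 in C3.
    unfold Th in C2, C3. rewrite gB_half, radial_max in C2, C3 by easy. fold Th in C2, C3.
    assert (L := loop_bound k k (phi b + (gphi k Tf - gphi k T)) Hk Hk ltac:(lra)).
    fold Tf in L. lra.
Qed.

(** For [k <= 1] the calibration is defined everywhere and exact on the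
    geodesic. *)
Lemma geodesic_minimal_open k T a b l N phi s :
  0 <= k <= 1 -> adm k T -> redpath a b l N phi s -> N a = 0 -> phi a = 0 ->
  N b = gB k T ^ 2 -> gphi k T <= phi b -> T <= s b - s a.
Proof.
  intros Hk HT Hp HNa Hpa HNb Hpb.
  assert (C := calib_le a b l N phi s k 1 Hp).
  rewrite HNa, HNb, sqrt_0, radial_0, Hpa, sqrt_pow2, radial_gB in C; try easy.
  - assert (2 * k * gphi k T <= 2 * k * phi b) by nra.
    enough (2 * k * (phi b - 0) + 1 * (T - 2 * k * gphi k T - 0) <= s b - s a) by lra.
    apply C; [|now left]. intros t Ht. assert (HN : 0 <= N t) by now apply (proj1 (proj2 Hp)). assert (0 <= 1 - k ^ 2) by nra. nra.
  - intros u _. left. now apply gC_pos.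
  - now apply gB_nonneg.
Qed.

Theorem geodesic_minimal k T a b l N phi s :
  adm k T -> redpath a b l N phi s -> N a = 0 -> phi a = 0 ->
  N b = gB k T ^ 2 -> gphi k T <= Rabs (phi b) -> T <= s b - s a.
Proof.
  intros HT Hp HNa Hpa HNb Hpb. assert (Hk : 0 <= k) by apply HT.
  assert (Haux : forall phi, redpath a b l N phi s -> phi a = 0 -> gphi k T <= phi b -> T <= s b - s a).
  { intros ph H1 H2 H3. destruct (Rlt_dec 1 k) as [h|h].
    - now apply (geodesic_minimal_circle k T a b l N ph).
    - apply (geodesic_minimal_open k T a b l N ph); auto. lra. }
  destruct (Rle_dec 0 (phi b)) as [h|h].
  - rewrite Rabs_pos_eq in Hpb by easy. now apply (Haux phi).
  - rewrite Rabs_left in Hpb by lra. apply (Haux (fun t => - phi t)); auto.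
    + now apply redpath_reflect.
    + rewrite Hpa; ring.
Qed.

Definition geo (b phi T : R) : Prop :=
  exists k, adm k T /\ gB k T = b /\ gphi k T = phi.

(** The second geodesic is a path from the axis, so the first one, with less [phi],
    is no longer. *)
Lemma geo_le b phi phi' T T' : geo b phi T -> geo b phi' T' -> phi <= phi' -> T <= T'.
Proof.
  intros [k [H1 [H2 H3]]] [k' [H1' [H2' H3']]] Hle.
  assert (HT' : 0 <= T') by apply H1'. assert (Hk' : 0 <= k') by apply H1'.
  replace T' with (T' - 0) by ring.
  apply (geodesic_minimal k T 0 T' nil _ _ (fun t => t) H1 (redpath_geodesic k' 0 T' HT')).
  - rewrite gB_0; ring.
  - apply gphi_0.
  - congruence.
  - rewrite H3, H3'. apply Rle_trans with (1 := Hle), Rle_abs.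
Qed.

Lemma geo_unique b phi T T' : geo b phi T -> geo b phi T' -> T = T'.
Proof. intros H H'; apply Rle_antisym; eapply geo_le; eauto; lra. Qed.

(** * Explicit families of geodesics *)

(** The slope of [f] at the origin, extended by its limit. *)
Definition slope (f : R -> R) (d z : R) : R := if Req_dec_T z 0 then d else f z / z.

Lemma slope_loc (f : R -> R) (d z : R) : z <> 0 -> locally z (fun y => f y / y = slope f d y).
Proof.
  intros Hz. apply (locally_near z (Rabs z)); [now apply Rabs_pos_lt|]. intros y Hy.
  unfold slope. destruct (Req_dec_T y 0) as [->|]; [|easy].
  unfold Rminus in Hy. rewrite Rplus_0_l, Rabs_Ropp in Hy. lra.
Qed.

Lemma slope_cont (f : R -> R) (d z : R) : f 0 = 0 -> is_derive f 0 d ->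
  (z <> 0 -> continuous f z) -> continuous (slope f d) z.
Proof.
  intros Hf0 Hd Hc. destruct (Req_dec z 0) as [->|Hz].
  - apply filterlim_locally. intros eps.
    apply is_derive_Reals in Hd. destruct (Hd eps (cond_pos eps)) as [del Hdel].
    exists del. intros y Hy. change (Rabs (y - 0) < del) in Hy. apply ball_R. rewrite Rminus_0_r in Hy.
    unfold slope. destruct (Req_dec_T 0 0) as [_|]; [|easy]. destruct (Req_dec_T y 0) as [->|Hy0].
    + unfold Rminus. rewrite Rplus_opp_r, Rabs_R0. apply cond_pos.
    + specialize (Hdel y Hy0 Hy). now rewrite Rplus_0_l, Hf0, Rminus_0_r in Hdel.
  - apply (continuous_ext_loc _ (fun z => f z * / z)).
    + now apply slope_loc.
    + specialize (Hc Hz). cont.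
Qed.

Lemma arcsinh_derive z : is_derive arcsinh z (/ sqrt (z ^ 2 + 1)).
Proof. apply is_derive_Reals, derivable_pt_lim_arcsinh. Qed.

Lemma slope_arcsinh_cont z : continuous (slope arcsinh 1) z.
Proof.
  apply slope_cont.
  - apply arcsinh_0.
  - replace 1 with (/ sqrt (0 ^ 2 + 1)) at 1; [apply arcsinh_derive|].
    replace (0 ^ 2 + 1) with 1 by ring. rewrite sqrt_1; field.
  - intros _. eapply is_derive_cont, arcsinh_derive.
Qed.

Lemma slope_sin_cont z : continuous (slope sin 1) z.
Proof.
  apply slope_cont.
  - apply sin_0.
  - rewrite <- cos_0 at 1. apply is_derive_sin.
  - intros _. eapply is_derive_cont, is_derive_sin.
Qed.

Lemma slope_sin_pos x : 0 <= x < PI -> 0 < slope sin 1 x.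
Proof.
  intros Hx. unfold slope. destruct (Req_dec_T x 0); [lra|].
  apply Rdiv_lt_0_compat; [apply sin_gt_0; lra|lra].
Qed.

Lemma gth_atan_open k t : adm k t -> 0 < gC k t -> gth k t = atan (k * gB k t / gC k t).
Proof.
  intros Ha Hc. assert (Hb := gB_nonneg k t Ha). assert (Hk : 0 <= k) by apply Ha.
  set (v := k * gB k t / gC k t).
  assert (Hv : 0 <= v) by (apply Rdiv_le_0_compat; [nra|easy]).
  apply gth_eq; [easy| |].
  - assert (H := atan_bound v). assert (0 <= atan v).
    { destruct Hv as [Hv| <-]; [|rewrite atan_0; lra]. left. rewrite <- atan_0. now apply atan_increasing. }
    lra.
  - rewrite cos_atan. assert (Hcg := gC_gB k t).
    assert (E : sqrt (1 + v²) = sqrt (1 + gB k t ^ 2) / gC k t).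
    { rewrite <- (sqrt_pow2 (gC k t)) at 1 by lra. rewrite <- sqrt_div_alt by nra. f_equal.
      rewrite Rsqr_pow2. unfold v.
      replace (1 + (k * gB k t / gC k t) ^ 2) with ((gC k t ^ 2 + k ^ 2 * gB k t ^ 2) / gC k t ^ 2) by (field; lra).
      rewrite Hcg at 1. f_equal. ring. }
    rewrite E. assert (Hsq := sqrt_1p_pos (gB k t)). field. split; lra.
Qed.

Lemma gth_atan_side k t : adm k t -> 0 < k * gB k t ->
  gth k t = PI / 2 - atan (gC k t / (k * gB k t)).
Proof.
  intros Ha Hc. set (v := gC k t / (k * gB k t)).
  apply gth_eq; [easy| |].
  - assert (H := atan_bound v). lra.
  - rewrite cos_shift, sin_atan. assert (Hcg := gC_gB k t).
    assert (E : sqrt (1 + v²) = sqrt (1 + gB k t ^ 2) / (k * gB k t)).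
    { rewrite <- (sqrt_pow2 (k * gB k t)) at 1 by lra. rewrite <- sqrt_div_alt by nra. f_equal.
      rewrite Rsqr_pow2. unfold v.
      replace (1 + (gC k t / (k * gB k t)) ^ 2) with ((gC k t ^ 2 + k ^ 2 * gB k t ^ 2) / (k * gB k t) ^ 2).
      - rewrite Hcg at 1. f_equal. ring.
      - field. split; intros E; rewrite E in Hc; lra. }
    rewrite E. assert (Hsq := sqrt_1p_pos (gB k t)). unfold v. field.
    repeat split; try lra; intros E'; rewrite E' in Hc; lra.
Qed.

(** The argument [phi] at which the equidistant, or for [eps = 0] the
    horocycle, with [eps = sqrt (1 - k^2)] reaches the radius [b]. *)
Definition phi_open (b eps : R) : R :=
  sqrt (1 - eps ^ 2) * (b * slope arcsinh 1 (eps * b))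
  - atan (sqrt (1 - eps ^ 2) * b / sqrt (1 + eps ^ 2 * b ^ 2)).

Lemma gB_open k t : 0 <= k < 1 -> gB k t = sinh (sqrt (1 - k ^ 2) / 2 * t) / sqrt (1 - k ^ 2).
Proof.
  intros Hk. unfold gB, gsin.
  assert (0 < 1 - k ^ 2) by nra. assert (0 < sqrt (1 - k ^ 2)) by now apply sqrt_lt_R0.
  destruct (Rlt_dec ((k ^ 2 - 1) / 4) 0); [|lra].
  replace (- ((k ^ 2 - 1) / 4)) with ((1 - k ^ 2) / 4) by field.
  rewrite sqrt_quarter. field; lra.
Qed.

Lemma gB_horocycle t : gB 1 t = t / 2.
Proof.
  unfold gB, gsin. destruct (Rlt_dec ((1 ^ 2 - 1) / 4) 0); [lra|].
  destruct (Rlt_dec 0 ((1 ^ 2 - 1) / 4)); lra.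
Qed.

Lemma gC_of_pos k t : 0 <= k <= 1 -> gC k t = sqrt (1 + (1 - k ^ 2) * gB k t ^ 2).
Proof.
  intros Hk. rewrite <- (sqrt_pow2 (gC k t)) by (left; now apply gC_pos).
  f_equal. rewrite gC_gB. ring.
Qed.

Lemma adm_open k T : 0 <= k <= 1 -> 0 <= T -> adm k T.
Proof. intros Hk HT; split; [easy|split; [easy|]]. intros; lra. Qed.

Lemma open_family b eps : 0 < b -> 0 <= eps <= 1 ->
  let k := sqrt (1 - eps ^ 2) in
  let T := 2 * (b * slope arcsinh 1 (eps * b)) in
  0 <= k <= 1 /\ k ^ 2 = 1 - eps ^ 2 /\ adm k T /\ gB k T = b /\ gphi k T = phi_open b eps.
Proof.
  intros Hb He k T.
  assert (Hk2 : k ^ 2 = 1 - eps ^ 2) by (apply pow2_sqrt; nra).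
  assert (Hk0 : 0 <= k) by apply sqrt_pos.
  assert (Hk1 : k <= 1) by nra.
  assert (HT : 0 <= T /\ gB k T = b).
  { unfold T, slope. destruct (Req_dec_T (eps * b) 0) as [H0|H0].
    - assert (eps = 0) by (apply Rmult_integral in H0; lra). subst eps.
      replace k with 1 by (unfold k; replace (1 - 0 ^ 2) with 1 by ring; now rewrite sqrt_1).
      rewrite gB_horocycle. lra.
    - assert (He0 : 0 < eps). { destruct (Req_dec eps 0) as [->|]; [rewrite Rmult_0_l in H0|]; lra. }
      assert (Hpos : 0 < arcsinh (eps * b)) by (rewrite <- arcsinh_0; apply arcsinh_lt; nra).
      split.
      + replace (2 * (b * (arcsinh (eps * b) / (eps * b)))) with (2 * arcsinh (eps * b) / eps) by (field; lra).
        apply Rdiv_le_0_compat; lra.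
      + rewrite gB_open by nra. replace (1 - k ^ 2) with (eps ^ 2) by lra. rewrite sqrt_pow2 by lra.
        replace (eps / 2 * (2 * (b * (arcsinh (eps * b) / (eps * b))))) with (arcsinh (eps * b)) by (field; lra).
        rewrite sinh_arcsinh. field; lra. }
  destruct HT as [HT HgB].
  assert (Ha : adm k T) by (apply adm_open; lra).
  split; [lra|split; [easy|split; [easy|split; [easy|]]]].
  assert (Hth := gth_atan_open k T Ha (gC_pos k T ltac:(lra))).
  rewrite gC_of_pos, HgB in Hth by lra. unfold gth in Hth.
  replace ((1 - k ^ 2) * b ^ 2) with (eps ^ 2 * b ^ 2) in Hth by (rewrite Hk2; ring).
  unfold phi_open. fold k. rewrite <- Hth. unfold T. field.
Qed.

(** The same for the circles, and for the horocycle if [x = 0], where [x] is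
    half the angle of the arc seen from the centre.  The momentum would not
    do as a parameter, since a circle passes through the radius [b] twice. *)
Definition half_chord (b x : R) : R := sqrt (b ^ 2 + sin x ^ 2).
Definition phi_circle (b x : R) : R :=
  half_chord b x / slope sin 1 x - (PI / 2 - atan (cos x / half_chord b x)).

Lemma half_chord_pos b x : 0 < b -> 0 < half_chord b x.
Proof. intros Hb. apply sqrt_lt_R0. nra. Qed.

Lemma half_chord_sq b x : half_chord b x ^ 2 = b ^ 2 + sin x ^ 2.
Proof. apply pow2_sqrt. nra. Qed.

Lemma circle_family b x : 0 < b -> 0 <= x < PI ->
  let k := half_chord b x / b in
  let T := 2 * b / slope sin 1 x in
  1 <= k /\ adm k T /\ (1 < k -> sqrt (k ^ 2 - 1) / 2 * T < PI) /\
  gB k T = b /\ gC k T = cos x /\ gphi k T = phi_circle b x.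
Proof.
  intros Hb Hx k T.
  assert (Hh := half_chord_pos b x Hb). assert (Hh2 := half_chord_sq b x).
  assert (Hsl := slope_sin_pos x Hx).
  assert (HT : 0 < T) by (apply Rdiv_lt_0_compat; lra).
  assert (Hsx : 0 <= sin x) by (apply sin_ge_0; lra).
  assert (Hk2 : k ^ 2 - 1 = (sin x / b) ^ 2).
  { unfold k. replace ((half_chord b x / b) ^ 2) with (half_chord b x ^ 2 / b ^ 2) by (field; lra).
    rewrite Hh2. field; lra. }
  assert (Hk0 : 0 < k) by (apply Rdiv_lt_0_compat; lra).
  assert (Hk1 : 1 <= k) by (assert (0 <= (sin x / b) ^ 2) by nra; nra).
  assert (Hq : sqrt (k ^ 2 - 1) = sin x / b).
  { rewrite Hk2. apply sqrt_pow2. apply Rdiv_le_0_compat; lra. }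
  assert (HxT : sqrt (k ^ 2 - 1) / 2 * T = x).
  { rewrite Hq. unfold T, slope in *. destruct (Req_dec_T x 0) as [->|H0].
    - rewrite sin_0. field; lra.
    - assert (0 < sin x) by (apply sin_gt_0; lra). field. lra. }
  assert (Hadm : adm k T).
  { split; [lra|split; [lra|]]. intros _. lra. }
  assert (HBC : gB k T = b /\ gC k T = cos x).
  { destruct (Req_dec x 0) as [H0|H0].
    - assert (k = 1). { rewrite H0, sin_0 in Hk2. unfold Rdiv in Hk2. rewrite Rmult_0_l in Hk2. nra. }
      rewrite H. rewrite gB_horocycle. split.
      + unfold T, slope. destruct (Req_dec_T x 0); [field|easy].
      + rewrite gC_of_pos by lra.
        replace (1 + (1 - 1 ^ 2) * gB 1 T ^ 2) with 1 by ring. now rewrite sqrt_1, H0, cos_0.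
    - assert (0 < sin x) by (apply sin_gt_0; lra).
      assert (Hk1' : 1 < k). { assert (0 < sin x / b) by (apply Rdiv_lt_0_compat; lra). nra. }
      rewrite gB_circle, gC_circle, HxT, Hq by easy. split; [field; lra|easy]. }
  destruct HBC as [HB HC].
  split; [easy|split; [easy|split; [intros; lra|split; [easy|split; [easy|]]]]].
  assert (Hth := gth_atan_side k T Hadm ltac:(rewrite HB; nra)).
  rewrite HB, HC in Hth. unfold gth in Hth.
  replace (k * b) with (half_chord b x) in Hth by (unfold k; field; lra).
  unfold phi_circle. rewrite <- Hth. unfold k, T. field. lra.
Qed.

Lemma phi_open_cont b eps : 0 < b -> continuous (phi_open b) eps.
Proof.
  intros Hb. assert (H1 : 0 < sqrt (1 + eps ^ 2 * b ^ 2)) by (apply sqrt_lt_R0; nra).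
  unfold phi_open. cont; [|lra].
  apply (continuous_comp (fun eps => eps * b) (slope arcsinh 1)); [cont|apply slope_arcsinh_cont].
Qed.

Lemma half_chord_cont b x : continuous (half_chord b) x.
Proof.
  unfold half_chord. cont.
Qed.

Lemma phi_circle_cont b x : 0 < b -> 0 <= x < PI -> continuous (phi_circle b) x.
Proof.
  intros Hb Hx. assert (Hh := half_chord_pos b x Hb). assert (Hsl := slope_sin_pos x Hx).
  assert (H1 := half_chord_cont b x). assert (H2 := slope_sin_cont x).
  unfold phi_circle. cont; lra.
Qed.

Lemma phi_open_0 b : 0 < b -> phi_open b 0 = b - atan b.
Proof.
  intros Hb. unfold phi_open. replace (1 - 0 ^ 2) with 1 by ring. replace (1 + 0 ^ 2 * b ^ 2) with 1 by ring.
  rewrite sqrt_1, Rmult_0_l. unfold slope. destruct (Req_dec_T 0 0); [|easy].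
  replace (1 * b / 1) with b by field. ring.
Qed.

Lemma phi_open_1 b : phi_open b 1 = 0.
Proof.
  unfold phi_open. replace (1 - 1 ^ 2) with 0 by ring. rewrite sqrt_0, !Rmult_0_l.
  unfold Rdiv. rewrite Rmult_0_l, atan_0. ring.
Qed.

Lemma phi_circle_0 b : 0 < b -> phi_circle b 0 = b - atan b.
Proof.
  intros Hb. unfold phi_circle, half_chord, slope. rewrite sin_0, cos_0.
  replace (b ^ 2 + 0 ^ 2) with (b ^ 2) by ring. rewrite sqrt_pow2 by lra.
  destruct (Req_dec_T 0 0); [|easy].
  replace (1 / b) with (/ b) by (field; lra). rewrite atan_inv by lra. lra.
Qed.

Lemma open_ivt b phi : 0 < b -> 0 <= phi <= b - atan b ->
  exists eps, 0 <= eps <= 1 /\ phi_open b eps = phi.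
Proof.
  intros Hb Hphi. destruct (IVT_gen (phi_open b) 0 1 phi) as [e [He1 He2]].
  - intros e. apply continuity_pt_filterlim. now apply phi_open_cont.
  - rewrite phi_open_0, phi_open_1, Rmin_right, Rmax_left by lra. lra.
  - rewrite Rmin_left, Rmax_right in He1 by lra. now exists e.
Qed.

Lemma phi_circle_unbounded b phi : 0 < b -> exists x, 0 < x < PI /\ phi < phi_circle b x.
Proof.
  intros Hb. assert (HP := PI_RGT_0).
  (* near [x = PI] the first term exceeds [b x / sin x] with [sin x <= PI - x] *)
  set (m := Rmax 1 (phi + PI + 1)).
  assert (Hm : 1 <= m /\ phi + PI + 1 <= m) by (split; [apply Rmax_l|apply Rmax_r]).
  set (d := Rmin (PI / 2) (b * (PI / 2) / m)).
  assert (Hd : 0 < d). { apply Rmin_glb_lt; [lra|]. apply Rdiv_lt_0_compat; nra. }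
  assert (Hd1 : d <= PI / 2) by apply Rmin_l.
  assert (Hd2 : d <= b * (PI / 2) / m) by apply Rmin_r.
  exists (PI - d). split; [lra|].
  assert (Hsin : sin (PI - d) <= d).
  { rewrite sin_PI_x. left; now apply sin_lt_x. }
  assert (Hsp : 0 < sin (PI - d)) by (apply sin_gt_0; lra).
  unfold phi_circle.
  assert (Hat := atan_bound (cos (PI - d) / half_chord b (PI - d))).
  enough (m <= half_chord b (PI - d) / slope sin 1 (PI - d)) by lra.
  assert (Hhb : b <= half_chord b (PI - d)).
  { rewrite <- (sqrt_pow2 b) at 1 by lra. apply sqrt_le_1_alt. nra. }
  unfold slope. destruct (Req_dec_T (PI - d) 0); [lra|].
  replace (half_chord b (PI - d) / (sin (PI - d) / (PI - d)))
    with (half_chord b (PI - d) * (PI - d) / sin (PI - d)) by (field; lra).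
  apply Rle_div_r; [lra|].
  apply Rle_trans with (m * d); [nra|].
  apply Rle_trans with (b * (PI / 2)).
  - apply Rmult_le_reg_r with (/ m); [apply Rinv_0_lt_compat; lra|].
    replace (m * d * / m) with d by (field; lra). exact Hd2.
  - apply Rmult_le_compat; lra.
Qed.

Lemma circle_ivt b phi x1 : 0 < b -> 0 < x1 < PI -> b - atan b <= phi <= phi_circle b x1 ->
  exists x, 0 <= x <= x1 /\ phi_circle b x = phi.
Proof.
  intros Hb Hx1 Hphi.
  destruct (Req_dec phi (phi_circle b 0)) as [E|E]; [exists 0; split; [lra|easy]|].
  destruct (Req_dec phi (phi_circle b x1)) as [E1|E1]; [exists x1; split; [lra|easy]|].
  rewrite phi_circle_0 in E by easy.
  destruct (Ranalysis5.IVT_interv (fun x => phi_circle b x - phi) 0 x1) as [x [Hx1' Hx2]].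
  - intros x Hx. apply continuity_pt_filterlim.
    assert (H := phi_circle_cont b x Hb ltac:(lra)). cont.
  - lra.
  - rewrite phi_circle_0 by easy. lra.
  - lra.
  - exists x. split; [easy|lra].
Qed.

(** By the intermediate value theorem: [phi] runs from 0 to the value of the
    horocycle in the first family, and from there to infinity in the second. *)
Lemma geo_exists b phi : 0 < b -> 0 <= phi ->
  exists k T, adm k T /\ (1 < k -> sqrt (k ^ 2 - 1) / 2 * T < PI) /\ gB k T = b /\ gphi k T = phi /\ 0 < T.
Proof.
  intros Hb Hphi.
  enough (H : exists k T, adm k T /\ (1 < k -> sqrt (k ^ 2 - 1) / 2 * T < PI) /\ gB k T = b /\ gphi k T = phi).
  { destruct H as [k [T [H1 [H2 [H3 H4]]]]]. exists k, T. repeat split; auto; try apply H1.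
    assert (0 <= T) by apply H1. destruct (Req_dec T 0) as [->|]; [|lra]. rewrite gB_0 in H3; lra. }
  destruct (Rle_dec phi (b - atan b)) as [h|h].
  - destruct (open_ivt b phi Hb (conj Hphi h)) as [e [He1 He2]].
    destruct (open_family b e Hb He1) as [H1 [_ [H2 [H3 H4]]]].
    eexists; eexists; split; [exact H2|split; [intros; lra|split; [exact H3|congruence]]].
  - destruct (phi_circle_unbounded b phi Hb) as [x1 [Hx1 Hx2]].
    destruct (circle_ivt b phi x1 Hb Hx1) as [x [Hx3 Hx4]]; [lra|].
    destruct (circle_family b x Hb ltac:(lra)) as [H1 [H2 [H3 [H4 [H5 H6]]]]].
    eexists; eexists; split; [exact H2|split; [exact H3|split; [exact H4|congruence]]].
Qed.

Definition loop_length (phi : R) : R := 2 * sqrt (phi ^ 2 + 2 * PI * phi).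

(** The momentum is found by solving [phi = k PI / sqrt (k^2 - 1) - PI], the
    holonomy of a full circle. *)
Lemma loop_geo phi : 0 < phi -> geo 0 phi (loop_length phi).
Proof.
  intros Hphi. assert (HP := PI_RGT_0).
  set (q := sqrt (phi ^ 2 + 2 * PI * phi)).
  assert (Hq0 : 0 < q) by (apply sqrt_lt_R0; nra).
  assert (Hq2 : q ^ 2 = phi ^ 2 + 2 * PI * phi) by (apply pow2_sqrt; nra).
  set (k := (phi + PI) / q).
  assert (Hk2 : k ^ 2 - 1 = (PI / q) ^ 2).
  { unfold k. replace (((phi + PI) / q) ^ 2 - 1) with (((phi + PI) ^ 2 - q ^ 2) / q ^ 2) by (field; lra).
    rewrite Hq2 at 1. field; lra. }
  assert (Hpq : 0 < PI / q) by (apply Rdiv_lt_0_compat; lra).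
  assert (Hk : 1 < k). { assert (0 < k) by (apply Rdiv_lt_0_compat; lra). nra. }
  assert (Hs : sqrt (k ^ 2 - 1) = PI / q) by (rewrite Hk2; apply sqrt_pow2; lra).
  exists k. unfold loop_length. fold q.
  assert (Hf := adm_full k Hk). assert (Hg := gB_full k Hk). assert (Hp := gphi_full k Hk).
  rewrite Hs in Hf, Hg, Hp.
  replace (2 * PI / (PI / q)) with (2 * q) in * by (field; lra).
  split; [easy|split; [easy|]]. rewrite Hp. unfold k. field. lra.
Qed.

(** * Strict inequalities at the cut points *)

Lemma decrease_right (f : R -> R) (d : R) : is_derive f 0 d -> d < 0 ->
  exists e, 0 < e /\ forall h, 0 < h < e -> f h < f 0.
Proof.
  intros Hd Hneg. apply is_derive_Reals in Hd.
  assert (Hp : 0 < - d / 2) by lra.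
  destruct (Hd _ Hp) as [del Hdel]. exists del. split; [apply cond_pos|].
  intros h Hh. assert (Hh0 : h <> 0) by lra.
  specialize (Hdel h Hh0). rewrite Rabs_pos_eq, Rplus_0_l in Hdel by lra.
  specialize (Hdel (proj2 Hh)). apply Rabs_def2 in Hdel.
  assert (H : (f h - f 0) / h < 0) by lra.
  assert (E : f h - f 0 = (f h - f 0) / h * h) by (field; lra). nra.
Qed.

Lemma arcsinh_slope x : / sqrt (x ^ 2 + 1) = sqrt (1 + x ^ 2) / (1 + x ^ 2).
Proof.
  rewrite (Rplus_comm (x ^ 2)). assert (H := sqrt_1p_pos x).
  assert (E : sqrt (1 + x ^ 2) ^ 2 = 1 + x ^ 2) by (apply pow2_sqrt; nra).
  rewrite <- E at 3. field. lra.
Qed.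

(** The calibration of a nonzero momentum does not charge the full price of a
    radial step. *)
Lemma radial_lt_distance k b b' : 0 < k <= 1 -> 0 < b -> 0 < b' -> b <> b' ->
  radial k b' - radial k b < 2 * Rabs (arcsinh b' - arcsinh b).
Proof.
  intros Hk Hb Hb' Hne.
  assert (Hd0 : forall x, 0 <= dradial k x).
  { intros x. apply Rdiv_le_0_compat; [|nra]. assert (H := sqrt_pos (1 + (1 - k ^ 2) * x ^ 2)). lra. }
  destruct (Rlt_dec b b') as [h|h].
  - destruct (MVT_gen (fun x => 2 * arcsinh x - radial k x) b b' (fun x => 2 * / sqrt (x ^ 2 + 1) - dradial k x))
      as [c [Hc1 Hc2]].
    + intros x _. apply (is_derive_minus (fun x => 2 * arcsinh x)); [|apply radial_derive].
      apply (is_derive_scal arcsinh), arcsinh_derive.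
    + intros x _. apply continuity_pt_filterlim.
      assert (H1 := radial_cont k x). assert (H2 := is_derive_cont _ _ _ (arcsinh_derive x)). cont.
    + rewrite Rmin_left, Rmax_right in Hc1 by lra.
      assert (Hlt : dradial k c < 2 * / sqrt (c ^ 2 + 1)).
      { rewrite arcsinh_slope. unfold dradial.
        replace (2 * (sqrt (1 + c ^ 2) / (1 + c ^ 2))) with (2 * sqrt (1 + c ^ 2) / (1 + c ^ 2)) by (field; nra).
        apply Rmult_lt_compat_r; [apply Rinv_0_lt_compat; nra|].
        apply Rmult_lt_compat_l; [lra|]. apply sqrt_lt_1_alt.
        assert (0 < k ^ 2 <= 1) by nra. assert (0 < c ^ 2) by nra. nra. }
      rewrite Rabs_pos_eq by (assert (arcsinh b < arcsinh b') by (now apply arcsinh_lt); lra).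
      nra.
  - assert (Hle : radial k b' <= radial k b).
    { apply Ropp_le_cancel. apply (nonincreasing_off_list nil (fun x => - radial k x)); [lra| |].
      - intros x _. assert (H1 := radial_cont k x). cont.
      - intros x _ _. exists (- dradial k x). split; [apply (is_derive_opp (radial k)), radial_derive|].
        specialize (Hd0 x). lra. }
    assert (arcsinh b' < arcsinh b) by (apply arcsinh_lt; lra).
    rewrite Rabs_left by lra. lra.
Qed.

Lemma geo_calibrated b phi T k : geo b phi T -> 0 <= k <= 1 -> 2 * k * phi + radial k b <= T.
Proof.
  intros [k0 [H1 [H2 H3]]] Hk. assert (HT : 0 <= T) by apply H1.
  assert (C := calib_le 0 T nil _ _ _ k 1 (redpath_geodesic k0 0 T HT)).
  cbv beta in C. rewrite gB_0, gphi_0, H2, H3 in C.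
  replace (0 ^ 2) with 0 in C by ring. rewrite sqrt_0, radial_0 in C.
  rewrite sqrt_pow2 in C by (rewrite <- H2; now apply gB_nonneg).
  enough (2 * k * (phi - 0) + 1 * (radial k b - 0) <= T - 0) by lra.
  apply C; [|now left]. intros t _. assert (0 <= gB k0 t ^ 2) by nra. assert (0 <= 1 - k ^ 2) by nra. nra.
Qed.

(** The calibration of the second geodesic bounds the first one from below, is
    exact on the second, and charges less than the full price for the step from
    [b] to [b']. *)
Lemma strict_open b b' phi T T' : 0 < b -> 0 < b' -> b <> b' -> 0 < phi -> phi <= b' - atan b' ->
  geo b phi T -> geo b' phi T' -> T' < T + 2 * Rabs (arcsinh b' - arcsinh b).
Proof.
  intros Hb Hb' Hne Hphi Hle HT HT'.
  destruct (open_ivt b' phi Hb' ltac:(lra)) as [e [He1 He2]].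
  destruct (open_family b' e Hb' He1) as [H1 [H0 [H2 [H3 H4]]]].
  set (k := sqrt (1 - e ^ 2)) in *. set (T2 := 2 * (b' * slope arcsinh 1 (e * b'))) in *.
  assert (T' = T2) as ->.
  { apply (geo_unique b' phi); [easy|]. exists k. repeat split; try apply H2; try easy. congruence. }
  assert (Hk : 0 < k).
  { destruct (Req_dec k 0) as [E|]; [|lra]. exfalso.
    rewrite E in H0. assert (e = 1) by nra. subst e. rewrite phi_open_1 in He2. lra. }
  assert (C := geo_calibrated b phi T k HT H1).
  assert (D := radial_gB k T2 H2 ltac:(intros; left; now apply gC_pos)).
  rewrite H3, H4, He2 in D.
  assert (L := radial_lt_distance k b b' ltac:(lra) Hb Hb' Hne). lra.
Qed.

Lemma sub_atan_increasing x y : 0 <= x -> x <= y -> x - atan x <= y - atan y.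
Proof.
  intros Hx Hy. apply Ropp_le_cancel.
  apply (nonincreasing_off_list nil (fun x => - (x - atan x))); [easy| |].
  - intros t _. cont.
  - intros t _ _. exists (- (1 - / (1 + t²))). split.
    + auto_derive; [easy|]. unfold Rsqr. field. nra.
    + assert (/ (1 + t²) <= / 1); [|lra]. apply Rinv_le_contravar; [lra|]. unfold Rsqr; nra.
Qed.

(** [x cos x < sin x], because the difference has derivative [x sin x]. *)
Lemma sin_minus_xcos x : 0 < x < PI -> 0 < sin x - x * cos x.
Proof.
  intros Hx.
  set (f := fun x => sin x - x * cos x).
  assert (Hf : forall y, is_derive f y (y * sin y)) by (intros y; unfold f; auto_derive; [easy|ring]).
  assert (Hc : forall y, continuity_pt f y) by (intros y; eapply continuity_pt_filterlim, is_derive_cont, Hf).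
  destruct (MVT_gen f 0 (x / 2) (fun x => x * sin x)) as [c [Hc1 Hc2]]; [intros; apply Hf|intros; apply Hc|].
  destruct (MVT_gen f (x / 2) x (fun x => x * sin x)) as [c' [Hc1' Hc2']]; [intros; apply Hf|intros; apply Hc|].
  rewrite Rmin_left, Rmax_right in Hc1, Hc1' by lra.
  assert (0 <= sin c) by (apply sin_ge_0; lra). assert (0 < sin c') by (apply sin_gt_0; lra).
  assert (Hf0 : f 0 = 0) by (unfold f; rewrite sin_0; ring).
  assert (0 < c' * sin c') by nra. assert (0 <= c * sin c) by nra.
  change (0 < f x). nra.
Qed.

(** The horocycle is compared with the circles of the same length [2 b] that
    end at the smaller radii [b * slope sin 1 x]: they gain area, since [phi]
    increases with [x]. *)
Lemma phi_circle_same_length b x : 0 < b -> 0 < x <= PI / 2 ->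
  b - atan b <= phi_circle (b * slope sin 1 x) x.
Proof.
  intros Hb Hx. assert (HP := PI_RGT_0).
  set (H := fun x => sqrt (b ^ 2 + x ^ 2) + atan (cos x / (slope sin 1 x * sqrt (b ^ 2 + x ^ 2)))).
  assert (Hq : forall t, 0 < sqrt (b ^ 2 + t ^ 2)) by (intros t; apply sqrt_lt_R0; nra).
  assert (Hs : forall t, 0 <= t <= PI / 2 -> 0 < slope sin 1 t) by (intros t Ht; apply slope_sin_pos; lra).
  assert (Hmono : H 0 <= H x).
  { apply Ropp_le_cancel. apply (nonincreasing_off_list nil (fun t => - H t)); [lra| |].
    - intros t Ht. assert (Hs1 := Hs t ltac:(lra)). specialize (Hq t). assert (H1 := slope_sin_cont t).
      unfold H. cont. nra.
    - intros t Ht _.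
      assert (Hsin : 0 < sin t) by (apply sin_gt_0; lra).
      assert (Hcos : 0 <= cos t) by (apply cos_ge_0; lra).
      assert (Hsc := sin_minus_xcos t ltac:(lra)).
      specialize (Hq t). set (q := sqrt (b ^ 2 + t ^ 2)) in *.
      assert (Hq2 : q ^ 2 = b ^ 2 + t ^ 2) by (apply pow2_sqrt; nra).
      assert (Hqd : is_derive (fun t => sqrt (b ^ 2 + t ^ 2)) t (t / q)).
      { replace (t / q) with ((2 * t) * / (2 * q)) by (field; lra).
        apply (is_derive_comp sqrt (fun t => b ^ 2 + t ^ 2) t (/ (2 * q)) (2 * t)).
        - apply is_derive_Reals, derivable_pt_lim_sqrt. nra.
        - auto_derive; [easy|ring]. }
      exists (- (b ^ 2 * cos t * (sin t - t * cos t) / (q * (q ^ 2 * sin t ^ 2 + t ^ 2 * cos t ^ 2)))).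
      assert (HD : 0 < q ^ 2 * sin t ^ 2 + t ^ 2 * cos t ^ 2).
      { assert (0 < q ^ 2 * sin t ^ 2) by (apply Rmult_lt_0_compat; nra). assert (0 <= t ^ 2 * cos t ^ 2) by (apply Rmult_le_pos; nra). lra. }
      split.
      + apply (is_derive_opp H). unfold H.
        apply (is_derive_ext_loc (fun t => sqrt (b ^ 2 + t ^ 2) + atan (cos t / (sin t / t * sqrt (b ^ 2 + t ^ 2))))).
        { apply filter_imp with (2 := slope_loc sin 1 t ltac:(lra)). intros y ->. easy. }
        pose (r := fun t => sqrt (b ^ 2 + t ^ 2)).
        apply (is_derive_ext (fun t => r t + atan (cos t / (sin t / t * r t)))); [easy|].
        assert (Hr : is_derive r t (t / q)) by exact Hqd. assert (Hrt : r t = q) by easy.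
        clearbody r. clear Hqd.
        auto_derive.
        * repeat split; try lra; try now exists (t / q).
          rewrite Hrt. apply Rgt_not_eq, Rmult_lt_0_compat; [apply Rdiv_lt_0_compat|]; lra.
        * rewrite_Derive Hr. rewrite Hrt. field_simplify_eq.
          -- replace (b ^ 2) with (q ^ 2 - t ^ 2) by lra. ring.
          -- replace ((q * sin t) ^ 2 + (t * cos t) ^ 2) with (q ^ 2 * sin t ^ 2 + t ^ 2 * cos t ^ 2) by ring.
             repeat split; lra.
      + assert (0 <= b ^ 2 * cos t * (sin t - t * cos t) / (q * (q ^ 2 * sin t ^ 2 + t ^ 2 * cos t ^ 2))); [|lra].
        apply Rdiv_le_0_compat; [|nra]. apply Rmult_le_pos; nra. }
  assert (H0 : H 0 = b + (PI / 2 - atan b)).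
  { unfold H, slope. destruct (Req_dec_T 0 0); [|easy].
    replace (b ^ 2 + 0 ^ 2) with (b ^ 2) by ring. rewrite sqrt_pow2, cos_0 by lra.
    replace (1 / (1 * b)) with (/ b) by (field; lra). now rewrite atan_inv. }
  assert (Hsx := Hs x ltac:(lra)). specialize (Hq x).
  assert (Hsin : sin x = slope sin 1 x * x).
  { unfold slope. destruct (Req_dec_T x 0); [lra|field; lra]. }
  assert (Hhc : half_chord (b * slope sin 1 x) x = slope sin 1 x * sqrt (b ^ 2 + x ^ 2)).
  { unfold half_chord. rewrite Hsin.
    replace ((b * slope sin 1 x) ^ 2 + (slope sin 1 x * x) ^ 2) with (slope sin 1 x ^ 2 * (b ^ 2 + x ^ 2)) by ring.
    rewrite sqrt_mult by nra. now rewrite sqrt_pow2 by lra. }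
  unfold phi_circle. rewrite Hhc.
  replace (slope sin 1 x * sqrt (b ^ 2 + x ^ 2) / slope sin 1 x) with (sqrt (b ^ 2 + x ^ 2)) by (field; lra).
  unfold H in Hmono at 2. lra.
Qed.

(** Towards the axis the step costs nothing: a circle of the length of the
    horocycle ends at the smaller radius with at least the same [phi]. *)
Lemma strict_horocycle b : 0 < b ->
  exists e, 0 < e <= b /\ forall b', b - e < b' < b ->
    forall T', geo b' (b - atan b) T' -> T' <= 2 * b.
Proof.
  intros Hb. assert (HP := PI_RGT_0). assert (HP4 := PI2_3_2).
  exists (b * (1 - 2 / PI)).
  assert (Hf : 0 < 2 / PI < 1).
  { split; [apply Rdiv_lt_0_compat; lra|]. apply Rlt_div_l; lra. }
  set (u := 2 / PI) in *. split; [nra|]. intros b' Hb' T' HT'.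
  assert (Hb'0 : 0 < b') by nra.
  destruct (IVT_gen (slope sin 1) 0 (PI / 2) (b' / b)) as [x [Hx1 Hx2]].
  - intros x; apply continuity_pt_filterlim, slope_sin_cont.
  - assert (E0 : slope sin 1 0 = 1) by (unfold slope; now destruct (Req_dec_T 0 0)).
    assert (E1 : slope sin 1 (PI / 2) = u).
    { unfold slope. destruct (Req_dec_T (PI / 2) 0); [lra|]. rewrite sin_PI2. unfold u. field; lra. }
    rewrite E0, E1, Rmin_right, Rmax_left by lra. split.
    + apply (proj1 (Rle_div_r u b' b Hb)). lra.
    + apply (proj2 (Rle_div_l b' 1 b Hb)). lra.
  - rewrite Rmin_left, Rmax_right in Hx1 by lra.
    assert (Hx0 : x <> 0).
    { intros ->. unfold slope in Hx2. destruct (Req_dec_T 0 0); [|easy].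
      assert (b' = b' / b * b) by (field; lra). rewrite <- Hx2 in H. lra. }
    assert (Hbb : b' = b * slope sin 1 x) by (rewrite Hx2; field; lra).
    destruct (circle_family b' x Hb'0 ltac:(lra)) as [_ [H2 [_ [H4 [_ H6]]]]].
    assert (Hle := phi_circle_same_length b x Hb ltac:(lra)). rewrite <- Hbb in Hle.
    replace (2 * b) with (2 * b' / slope sin 1 x).
    + eapply geo_le; [exact HT'| |exact Hle].
      exists (half_chord b' x / b'). repeat split; try apply H2; easy.
    + rewrite Hbb. field. assert (Hs := slope_sin_pos x ltac:(lra)). lra.
Qed.

(** First variation of the circle through radius [b], in the direction in
    which the radius moves by [sg] and the angle [x] by [lam]. *)
Lemma phi_circle_variation b x sg lam : 0 < b -> 0 < x < PI ->
  is_derive (fun h => phi_circle (b + sg * h) (x + lam * h)) 0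
    (sg * (b * x / (half_chord b x * sin x) - b * cos x / (half_chord b x * (1 + b ^ 2)))
     + lam * (b ^ 2 * (sin x - x * cos x) / (half_chord b x * sin x ^ 2))).
Proof.
  intros Hb Hx.
  assert (Hsin : 0 < sin x) by (apply sin_gt_0; lra).
  assert (Hh := half_chord_pos b x Hb). assert (Hh2 := half_chord_sq b x).
  set (s := half_chord b x) in *.
  pose (r := fun h => half_chord (b + sg * h) (x + lam * h)).
  assert (Hr0 : r 0 = s) by (unfold r, s; f_equal; ring).
  assert (Hr : is_derive r 0 ((b * sg + sin x * cos x * lam) / s)).
  { replace ((b * sg + sin x * cos x * lam) / s) with ((2 * b * sg + 2 * sin x * cos x * lam) * / (2 * s)) by (field; lra).
    apply (is_derive_comp sqrt (fun h => (b + sg * h) ^ 2 + sin (x + lam * h) ^ 2) 0 (/ (2 * s)) (2 * b * sg + 2 * sin x * cos x * lam)).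
    - rewrite !Rmult_0_r, !Rplus_0_r. apply is_derive_Reals, derivable_pt_lim_sqrt. nra.
    - auto_derive; [easy|]. rewrite !Rmult_0_r, !Rplus_0_r. ring. }
  apply (is_derive_ext_loc (fun h => r h * (x + lam * h) / sin (x + lam * h) - (PI / 2 - atan (cos (x + lam * h) / r h)))).
  - assert (Hcx : continuous (fun h => x + lam * h) 0) by cont.
    assert (Hloc := slope_loc sin 1 x ltac:(lra)).
    replace x with (x + lam * 0) in Hloc by ring.
    assert (Hl2 : locally 0 (fun h => sin (x + lam * h) / (x + lam * h) = slope sin 1 (x + lam * h)))
      by exact (Hcx _ Hloc).
    generalize Hl2. apply filter_imp. intros h Hh'. unfold phi_circle. fold (r h).
    rewrite <- Hh'. unfold Rdiv. rewrite Rinv_mult, Rinv_inv.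
    match goal with |- ?u = ?v => change (@eq R u v) end. ring.
  - clearbody r. auto_derive.
    + repeat split; try easy; try (now eexists; exact Hr); rewrite ?Rmult_0_r, ?Rplus_0_r; lra.
    + rewrite_Derive Hr. rewrite Hr0, !Rmult_0_r, !Rplus_0_r.
      assert (Hsc := sin2_cos2 x). unfold Rsqr in Hsc.
      replace (1 + cos x * / s * (cos x * / s * 1)) with ((s ^ 2 + cos x ^ 2) / s ^ 2) by (field; lra).
      replace (1 + b ^ 2) with (s ^ 2 + cos x ^ 2) by nra.
      replace (b ^ 2) with (s ^ 2 - sin x ^ 2) by lra.
      field. repeat split; try lra. nra.
Qed.

Lemma chord_derivative b x sg lam : 0 < b -> 0 < x < PI ->
  is_derive (fun h => 2 * (b + sg * h) * (x + lam * h) / sin (x + lam * h)) 0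
    (sg * (2 * x / sin x) + lam * (2 * b * (sin x - x * cos x) / sin x ^ 2)).
Proof.
  intros Hb Hx. assert (Hsin : 0 < sin x) by (apply sin_gt_0; lra).
  auto_derive; rewrite !Rmult_0_r, !Rplus_0_r.
  - lra.
  - field. lra.
Qed.

(** Off the axis the final direction of a circle is never radial, so a
    radial step combined with a change of the circle does better than the
    triangle inequality.  The angle [x] varies at a rate [lam] for which
    [phi] increases to first order, so slowly that the length grows less than
    the distance covered, which has the rate [2 / sqrt (1 + b^2)]. *)
Lemma circle_side b x sg : 0 < b -> 0 < x < PI -> sg = 1 \/ sg = -1 ->
  exists e, 0 < e /\ forall h, 0 < h < e -> 0 < b + sg * h /\
    forall T', geo (b + sg * h) (phi_circle b x) T' ->
      T' < 2 * b / slope sin 1 x + 2 * Rabs (arcsinh (b + sg * h) - arcsinh b).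
Proof.
  intros Hb Hx Hsg.
  assert (Hsin : 0 < sin x) by (apply sin_gt_0; lra).
  assert (Hh := half_chord_pos b x Hb). assert (Hh2 := half_chord_sq b x).
  assert (Hsc := sin_minus_xcos x Hx).
  set (s := half_chord b x) in *.
  set (a := sqrt (1 + b ^ 2)).
  assert (Ha : 0 < a) by apply sqrt_1p_pos.
  assert (Ha2 : a ^ 2 = 1 + b ^ 2) by (apply pow2_sqrt; nra).
  assert (Ha1 : 1 < a) by nra.
  assert (Hc := COS_bound x).
  set (P0 := b * x / (s * sin x) - b * cos x / (s * (1 + b ^ 2))).
  set (P1 := b ^ 2 * (sin x - x * cos x) / (s * sin x ^ 2)).
  assert (HP1 : 0 < P1) by (apply Rdiv_lt_0_compat; apply Rmult_lt_0_compat; try apply pow_lt; lra).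
  (* the rate of [phi], half of the one at which the length would grow like the distance *)
  set (dl := b / (2 * s) * (1 / a - sg * cos x / a ^ 2)).
  assert (Hdl : 0 < dl).
  { apply Rmult_lt_0_compat; [apply Rdiv_lt_0_compat; lra|].
    replace (1 / a - sg * cos x / a ^ 2) with ((a - sg * cos x) / a ^ 2) by (field; lra).
    apply Rdiv_lt_0_compat; [|nra]. destruct Hsg as [-> | ->]; lra. }
  set (lam := (dl - sg * P0) / P1).
  assert (D1 := phi_circle_variation b x sg lam Hb Hx). fold s P0 P1 in D1.
  assert (E1 : sg * P0 + lam * P1 = dl) by (unfold lam; field; lra).
  rewrite E1 in D1.
  assert (D2 := chord_derivative b x sg lam Hb Hx).
  assert (E2 : sg * (2 * x / sin x) + lam * (2 * b * (sin x - x * cos x) / sin x ^ 2)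
    = 1 / a + sg * cos x / a ^ 2).
  { transitivity (2 * s / b * (sg * P0 + lam * P1) + 2 * sg * cos x / a ^ 2).
    - unfold P0, P1. rewrite Ha2. field. repeat split; try lra. nra.
    - rewrite E1. unfold dl. field. lra. }
  rewrite E2 in D2.
  destruct (decrease_right (fun h => - phi_circle (b + sg * h) (x + lam * h)) (- dl)) as [e1 [He1 H1]].
  { exact (is_derive_opp _ _ _ D1). } { lra. }
  destruct (decrease_right (fun h => 2 * (b + sg * h) * (x + lam * h) / sin (x + lam * h)
      - 2 * sg * arcsinh (b + sg * h)) (1 / a + sg * cos x / a ^ 2 - 2 / a)) as [e2 [He2 H2]].
  { apply (is_derive_minus (fun h => 2 * (b + sg * h) * (x + lam * h) / sin (x + lam * h))); [exact D2|].
    replace (2 / a) with (2 * sg * (sg * / sqrt ((b + sg * 0) ^ 2 + 1))).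
    - apply (is_derive_scal (fun h => arcsinh (b + sg * h)) 0 (2 * sg)).
      apply (is_derive_comp arcsinh (fun h => b + sg * h)); [apply arcsinh_derive|].
      auto_derive; [easy|ring].
    - rewrite Rmult_0_r, Rplus_0_r, (Rplus_comm (b ^ 2)). fold a.
      destruct Hsg as [-> | ->]; field; lra. }
  { replace (1 / a + sg * cos x / a ^ 2 - 2 / a) with (- ((a - sg * cos x) / a ^ 2)) by (field; lra).
    assert (0 < (a - sg * cos x) / a ^ 2); [|lra].
    apply Rdiv_lt_0_compat; [|nra]. destruct Hsg as [-> | ->]; lra. }
  set (m := Rmin x (PI - x)).
  assert (Hm : 0 < m /\ m <= x /\ m <= PI - x).
  { split; [apply Rmin_glb_lt; lra|split; [apply Rmin_l|apply Rmin_r]]. }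
  set (e3 := m / (Rabs lam + 1)).
  assert (Hla := Rabs_pos lam).
  assert (He3 : 0 < e3) by (apply Rdiv_lt_0_compat; lra).
  exists (Rmin (Rmin e1 e2) (Rmin e3 b)).
  split; [repeat apply Rmin_glb_lt; easy|].
  intros h [Hh0 Hhe].
  assert (Hb1 := Rmin_l (Rmin e1 e2) (Rmin e3 b)). assert (Hb2 := Rmin_r (Rmin e1 e2) (Rmin e3 b)).
  assert (Hb3 := Rmin_l e1 e2). assert (Hb4 := Rmin_r e1 e2).
  assert (Hb5 := Rmin_l e3 b). assert (Hb6 := Rmin_r e3 b).
  assert (Hbh : 0 < b + sg * h) by (destruct Hsg as [-> | ->]; lra).
  split; [easy|]. intros T' HT'.
  assert (Hxl : 0 < x + lam * h < PI).
  { assert (Hlh : Rabs (lam * h) < m).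
    { rewrite Rabs_mult, (Rabs_pos_eq h) by lra.
      apply Rle_lt_trans with ((Rabs lam + 1) * h); [nra|].
      apply Rlt_le_trans with ((Rabs lam + 1) * e3); [nra|]. right. unfold e3. field. lra. }
    apply Rabs_def2 in Hlh. lra. }
  specialize (H1 h ltac:(lra)). specialize (H2 h ltac:(lra)). cbv beta in H1, H2.
  rewrite !Rmult_0_r, !Rplus_0_r in H1, H2.
  destruct (circle_family (b + sg * h) (x + lam * h) Hbh ltac:(lra)) as [_ [G2 [_ [G4 [_ G6]]]]].
  assert (Hgeo : geo (b + sg * h) (phi_circle (b + sg * h) (x + lam * h)) (2 * (b + sg * h) / slope sin 1 (x + lam * h))).
  { eexists; split; [exact G2|split; [exact G4|exact G6]]. }
  assert (Hle := geo_le _ _ _ _ _ HT' Hgeo ltac:(lra)).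
  assert (Hsl : forall y c, 0 < y < PI -> 2 * c / slope sin 1 y = 2 * c * y / sin y).
  { intros y c Hy. unfold slope. destruct (Req_dec_T y 0); [lra|].
    assert (0 < sin y) by (apply sin_gt_0; lra). field. lra. }
  rewrite Hsl in Hle by easy. rewrite Hsl by easy.
  replace (2 * Rabs (arcsinh (b + sg * h) - arcsinh b)) with (2 * sg * (arcsinh (b + sg * h) - arcsinh b)); [lra|].
  destruct Hsg as [-> | ->].
  - assert (arcsinh b < arcsinh (b + 1 * h)) by (apply arcsinh_lt; lra). rewrite Rabs_pos_eq by lra. ring.
  - assert (arcsinh (b + -1 * h) < arcsinh b) by (apply arcsinh_lt; lra). rewrite Rabs_left by lra. ring.
Qed.

(** No geodesic with [phi > 0] arrives radially at a point off the axis.  The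
    cases are those of an equidistant, a horocycle and a circle. *)
Theorem strict_radial b phi T : 0 < b -> 0 < phi -> geo b phi T ->
  exists e, 0 < e <= b /\ forall b', Rabs (b' - b) < e -> b' <> b ->
    forall T', geo b' phi T' -> T' < T + 2 * Rabs (arcsinh b' - arcsinh b).
Proof.
  intros Hb Hphi HT.
  destruct (Rtotal_order phi (b - atan b)) as [h|[h|h]].
  - assert (Hc : continuous (fun b => b - atan b) b) by cont.
    destruct (continuous_near _ b Hc (b - atan b - phi) ltac:(lra)) as [d [Hd0 Hd]].
    exists (Rmin d b). split; [split; [apply Rmin_glb_lt; easy|apply Rmin_r]|].
    intros b' Hb' Hne T' HT'.
    assert (H1 := Rmin_l d b). assert (H2 := Rmin_r d b).
    specialize (Hd b' ltac:(lra)).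
    apply Rabs_def2 in Hd. apply Rabs_def2 in Hb'.
    apply (strict_open b b' phi T T'); auto; lra.
  - destruct (strict_horocycle b Hb) as [e [He1 He2]]. exists e. split; [easy|].
    intros b' Hb' Hne T' HT'. apply Rabs_def2 in Hb'.
    destruct (Rlt_dec b' b) as [hb|hb].
    + rewrite h in HT'. specialize (He2 b' ltac:(lra) T' HT').
      assert (E : T = 2 * b).
      { apply (geo_unique b phi); [easy|].
        destruct (circle_family b 0 Hb) as [_ [G2 [_ [G4 [_ G6]]]]]; [assert (HP := PI_RGT_0); lra|].
        assert (E0 : 2 * b / slope sin 1 0 = 2 * b) by (unfold slope; destruct (Req_dec_T 0 0); [field|easy]).
        rewrite E0 in *. eexists; split; [exact G2|split; [exact G4|]]. rewrite G6, phi_circle_0; easy. }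
      assert (arcsinh b' < arcsinh b) by now apply arcsinh_lt.
      rewrite Rabs_left by lra. lra.
    + apply (strict_open b b' phi T T'); auto; try lra.
      rewrite h. apply sub_atan_increasing; lra.
  - destruct (phi_circle_unbounded b phi Hb) as [x1 [Hx1 Hx2]].
    destruct (circle_ivt b phi x1 Hb Hx1 ltac:(lra)) as [x [Hx3 Hx4]].
    assert (Hx0 : x <> 0) by (intros ->; rewrite phi_circle_0 in Hx4; lra).
    destruct (circle_family b x Hb ltac:(lra)) as [_ [G2 [_ [G4 [_ G6]]]]].
    assert (E : T = 2 * b / slope sin 1 x).
    { apply (geo_unique b phi); [easy|]. eexists; split; [exact G2|split; [exact G4|congruence]]. }
    destruct (circle_side b x 1 Hb ltac:(lra) ltac:(now left)) as [e1 [He1 H1]].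
    destruct (circle_side b x (-1) Hb ltac:(lra) ltac:(now right)) as [e2 [He2 H2]].
    exists (Rmin b (Rmin e1 e2)). split; [split; [repeat apply Rmin_glb_lt; easy|apply Rmin_l]|].
    assert (M1 := Rmin_r b (Rmin e1 e2)). assert (M2 := Rmin_l e1 e2). assert (M3 := Rmin_r e1 e2).
    intros b' Hb' Hne T' HT'. apply Rabs_def2 in Hb'. rewrite E. rewrite <- Hx4 in HT'.
    destruct (Rlt_dec b b') as [hb|hb].
    + destruct (H1 (b' - b) ltac:(lra)) as [_ H3].
      replace (b + 1 * (b' - b)) with b' in H3 by ring. now apply H3.
    + destruct (H2 (b - b') ltac:(lra)) as [_ H3].
      replace (b + -1 * (b - b')) with b' in H3 by ring. now apply H3.
Qed.

Lemma loop_length_sq phi : 0 <= phi -> loop_length phi ^ 2 = 4 * (phi ^ 2 + 2 * PI * phi).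
Proof.
  intros H. assert (HP := PI_RGT_0). unfold loop_length. rewrite Rpow_mult_distr, pow2_sqrt by nra. ring.
Qed.

Lemma loop_length_pos phi : 0 < phi -> 0 < loop_length phi.
Proof.
  intros H. assert (HP := PI_RGT_0). unfold loop_length.
  assert (0 < sqrt (phi ^ 2 + 2 * PI * phi)) by (apply sqrt_lt_R0; nra). lra.
Qed.

(** Near the axis an arc is not longer than the loop with the same [phi]: leave
    out the last part, of angle [2 e] seen from the centre, of the circle of
    curvature [K / sqrt (K^2 - 1)] with [K = 1 + phi / (PI - e)].  What is left
    ends at radius [b] for a suitable [e] and still has at least this [phi]. *)
Lemma near_axis phi b T : 0 < phi -> 0 < b -> b <= sqrt ((1 + 2 * phi / PI) ^ 2 - 1) ->
  geo b phi T -> T <= loop_length phi.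
Proof.
  intros Hphi Hb Hle HT. assert (HP := PI_RGT_0).
  set (K := fun e => 1 + phi / (PI - e)).
  assert (HK : forall e, e <= PI / 2 -> 1 < K e).
  { intros e He. unfold K. assert (0 < phi / (PI - e)) by (apply Rdiv_lt_0_compat; lra). lra. }
  destruct (IVT_gen (fun e => sqrt (K (Rmin e (PI / 2)) ^ 2 - 1) * sin e) 0 (PI / 2) b) as [e [He1 He2]].
  - intros e. apply continuity_pt_filterlim.
    assert (Hm := Rmin_r e (PI / 2)).
    assert (Hmc : continuous (fun e => Rmin e (PI / 2)) e).
    { apply (continuous_ext (fun e => (e + PI / 2 - Rabs (e - PI / 2)) / 2)); [|cont; lra].
      intros y. unfold Rmin, Rabs. destruct (Rle_dec y (PI / 2)), (Rcase_abs (y - PI / 2)); lra. }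
    unfold K. cont. lra.
  - rewrite sin_0, sin_PI2, Rmult_0_r, (Rmin_left (PI / 2) (PI / 2)) by lra.
    unfold K. replace (phi / (PI - PI / 2)) with (2 * phi / PI) by (field; lra).
    rewrite Rmult_1_r, Rmin_left, Rmax_right by (apply sqrt_pos). lra.
  - rewrite Rmin_left, Rmax_right in He1 by lra. rewrite Rmin_left in He2 by lra.
    assert (He0 : e <> 0) by (intros ->; rewrite sin_0 in He2; lra).
    specialize (HK e (proj2 He1)). set (k1 := sqrt (K e ^ 2 - 1)) in *.
    assert (Hk1 : k1 ^ 2 = K e ^ 2 - 1) by (apply pow2_sqrt; nra).
    assert (Hk1p : 0 < k1) by (apply sqrt_lt_R0; nra).
    assert (Hsin : 0 < sin e) by (apply sin_gt_0; lra).
    set (x := PI - e).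
    assert (Hsx : sin x = sin e) by (unfold x; apply sin_PI_x).
    destruct (circle_family b x Hb ltac:(unfold x; lra)) as [_ [G2 [_ [G4 [G5 G6]]]]].
    assert (Hsl : slope sin 1 x = sin e / x).
    { unfold slope. destruct (Req_dec_T x 0); [unfold x in *; lra|now rewrite Hsx]. }
    assert (HTx : 2 * b / slope sin 1 x = 2 * k1 * x).
    { rewrite Hsl, <- He2. field. unfold x; lra. }
    rewrite HTx in *.
    assert (Hkb : half_chord b x / b = K e / k1).
    { assert (E : half_chord b x = K e * sin e).
      { unfold half_chord. rewrite Hsx, <- He2.
        replace ((k1 * sin e) ^ 2 + sin e ^ 2) with ((K e * sin e) ^ 2); [apply sqrt_pow2; nra|].
        rewrite !Rpow_mult_distr, Hk1. ring. }
      rewrite E, <- He2. field. lra. }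
    set (k := half_chord b x / b) in *.
    assert (Hge : phi <= gphi k (2 * k1 * x)).
    { (* the angle [gth] is at most [x], since [cos x <= 0] *)
      assert (Hth : gth k (2 * k1 * x) <= x).
      { apply Rnot_lt_le. intros Hlt.
        assert (Hr := gth_range k _ G2). destruct (gth_direction k (2 * k1 * x)) as [Hd _].
        rewrite G4, G5 in Hd.
        assert (Hcos : cos (gth k (2 * k1 * x)) < cos x) by (apply cos_decreasing_1; unfold x in *; lra).
        assert (Hcx : cos x <= 0) by (apply cos_le_0; unfold x; lra).
        assert (Hq := sqrt_1p_pos b). assert (1 <= sqrt (1 + b ^ 2)).
        { rewrite <- sqrt_1 at 1. apply sqrt_le_1_alt. nra. }
        nra. }
      unfold gth in Hth. apply (Rplus_le_reg_r (- phi)).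
      assert (E : k * (2 * k1 * x) / 2 = phi + x).
      { rewrite Hkb. unfold K. fold x. field. unfold x in *. lra. }
      lra. }
    apply Rle_trans with (2 * k1 * x).
    + eapply geo_le; [exact HT| |exact Hge]. exists k; auto.
    + apply Rsqr_incr_0_var; [|left; now apply loop_length_pos].
      rewrite !Rsqr_pow2, loop_length_sq by lra.
      replace ((2 * k1 * x) ^ 2) with (4 * (k1 ^ 2 * x ^ 2)) by ring.
      rewrite Hk1. unfold K. fold x.
      replace (4 * (((1 + phi / x) ^ 2 - 1) * x ^ 2)) with (4 * (phi ^ 2 + 2 * phi * x)) by (field; unfold x; lra).
      unfold x. nra.
Qed.

Lemma sinh_le x : 0 <= x <= 1 -> sinh x <= 2 * x.
Proof.
  intros Hx.
  enough (sinh x - 2 * x <= sinh 0 - 2 * 0) by (rewrite sinh_0 in H; lra).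
  apply (nonincreasing_off_list nil (fun x => sinh x - 2 * x)); [easy| |].
  - intros t _. assert (H1 := is_derive_cont _ _ _ (is_derive_sinh' t)). cont.
  - intros t Ht _. exists (cosh t - 2 * 1). split.
    + apply (is_derive_minus sinh (fun x => 2 * x)); [apply is_derive_sinh'|apply (is_derive_scal (fun x => x)), @is_derive_id].
    + unfold cosh. assert (exp t <= exp 1) by (left; apply exp_increasing; lra).
      assert (exp (- t) <= exp 0) by (left; apply exp_increasing; lra).
      rewrite exp_0 in *. assert (H3 := exp_le_3). lra.
Qed.

(** A loop is not prolonged by any short path: moving by [s] changes [phi]
    only to second order, so the length of the best curve changes by less than
    [s]. *)
Theorem strict_axis phi : 0 < phi ->
  exists s0, 0 < s0 <= 1 /\ forall s eta b T, 0 < s < s0 -> 0 <= eta <= s ^ 2 -> 0 <= b <= sinh (s / 2) ->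
    geo b (phi + eta) T -> T < loop_length phi + s.
Proof.
  intros Hphi. assert (HP := PI_RGT_0).
  set (bm := sqrt ((1 + 2 * phi / PI) ^ 2 - 1)).
  assert (Hphip : 0 < 2 * phi / PI) by (apply Rdiv_lt_0_compat; lra).
  assert (Hbm : 0 < bm) by (apply sqrt_lt_R0; nra).
  assert (HL := loop_length_pos phi Hphi). assert (HL2 := loop_length_sq phi ltac:(lra)).
  set (L := loop_length phi) in *.
  set (C := 2 * (2 * phi + 1 + 2 * PI)).
  assert (HC : 0 < C) by (unfold C; lra).
  set (s1 := L / C). assert (Hs1 : 0 < s1) by now apply Rdiv_lt_0_compat.
  exists (Rmin 1 (Rmin bm s1)).
  split; [split; [repeat apply Rmin_glb_lt; lra|apply Rmin_l]|].
  intros s eta b T Hs Heta Hb HT.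
  assert (M1 := Rmin_l 1 (Rmin bm s1)). assert (M2 := Rmin_r 1 (Rmin bm s1)).
  assert (M3 := Rmin_l bm s1). assert (M4 := Rmin_r bm s1).
  assert (Hbs : b <= s) by (assert (H := sinh_le (s / 2) ltac:(lra)); lra).
  assert (Hup : T <= loop_length (phi + eta)).
  { destruct (Req_dec b 0) as [->|Hb0].
    - right. apply (geo_unique 0 (phi + eta)); [easy|]. apply loop_geo; lra.
    - apply (near_axis (phi + eta) b); auto; try lra.
      apply Rle_trans with bm; [lra|]. apply sqrt_le_1_alt.
      assert (2 * phi / PI <= 2 * (phi + eta) / PI).
      { apply Rmult_le_compat_r; [left; now apply Rinv_0_lt_compat|lra]. }
      nra. }
  apply Rle_lt_trans with (1 := Hup).
  apply Rsqr_incrst_0; [|left; apply loop_length_pos; lra|lra].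
  rewrite !Rsqr_pow2, loop_length_sq by lra.
  assert (HsC : s * C < L).
  { apply Rlt_le_trans with (s1 * C); [apply Rmult_lt_compat_r; lra|]. right. unfold s1. field. lra. }
  assert (E : 4 * eta * (2 * phi + eta + 2 * PI) <= 2 * (s * (s * C))).
  { unfold C. replace (2 * (s * (s * (2 * (2 * phi + 1 + 2 * PI))))) with (4 * s ^ 2 * (2 * phi + 1 + 2 * PI)) by ring.
    apply Rmult_le_compat; nra. }
  assert (s * (s * C) < s * L) by nra. nra.
Qed.

(** * Paths leaving the axis *)

Lemma redpath_s_mono a b l N phi s : redpath a b l N phi s -> s a <= s b.
Proof.
  intros [Hab [Hc Hd]]. apply Ropp_le_cancel.
  apply (nonincreasing_off_list l (fun t => - s t)); [easy| |].
  - intros t Ht. destruct (Hc t Ht) as [_ [_ [_ H1]]]. cont.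
  - intros t Ht Hn. destruct (Hd t Ht Hn) as [x [y [sg [_ [_ [Hs [Hsg _]]]]]]].
    exists (- sg). split; [now apply (is_derive_opp s)|lra].
Qed.

Lemma radial_zero b : radial 0 b = 2 * arcsinh b.
Proof.
  set (F := fun b => radial 0 b - 2 * arcsinh b).
  enough (F b = F 0). { unfold F in H. rewrite radial_0, arcsinh_0 in H. lra. }
  apply derive0_const. intros t.
  assert (D : is_derive F t (dradial 0 t - 2 * / sqrt (t ^ 2 + 1))).
  { apply (is_derive_minus (radial 0)); [apply radial_derive|].
    apply (is_derive_scal arcsinh), arcsinh_derive. }
  replace (dradial 0 t - 2 * / sqrt (t ^ 2 + 1)) with 0 in D; [exact D|].
  rewrite arcsinh_slope. unfold dradial. replace (1 + (1 - 0 ^ 2) * t ^ 2) with (1 + t ^ 2) by ring.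
  field. nra.
Qed.

Lemma redpath_radius a b l N phi s : redpath a b l N phi s ->
  2 * Rabs (arcsinh (sqrt (N b)) - arcsinh (sqrt (N a))) <= s b - s a.
Proof.
  intros H.
  assert (Hr : forall t, a <= t <= b -> 0 ^ 2 * N t <= 1 + N t).
  { intros t Ht. assert (0 <= N t) by now apply (proj1 (proj2 H)). lra. }
  assert (C1 := calib_le a b l N phi s 0 1 H Hr ltac:(now left)).
  assert (C2 := calib_le a b l N phi s 0 (-1) H Hr ltac:(now right)).
  rewrite !radial_zero in C1, C2. unfold Rabs. destruct (Rcase_abs _); lra.
Qed.

(** A path of length at most [M <= 1] from the axis stays where the calibration
    of momentum [2 / M] is defined, so [2 / M] times the change of [phi] is
    at most the length; take [M] to be the length. *)
Lemma redpath_axis_phi a b l N phi s : redpath a b l N phi s -> N a = 0 -> s b - s a <= 1 ->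
  Rabs (phi b - phi a) <= (s b - s a) ^ 2.
Proof.
  intros H HN Hs. set (S := s b - s a) in *.
  assert (HS0 : 0 <= S) by (assert (Hm := redpath_s_mono _ _ _ _ _ _ H); unfold S; lra).
  assert (Hbound : forall M, 0 < M -> S <= M -> M <= 1 -> Rabs (phi b - phi a) <= M * S).
  { intros M HM HSM HM1.
    assert (Hin : forall t, a <= t <= b -> (/ M) ^ 2 * N t <= 1 + N t).
    { intros t Ht. assert (HNt : 0 <= N t) by now apply (proj1 (proj2 H)).
      assert (R1 := redpath_radius a t l N phi s (redpath_sub _ _ _ _ _ _ a t H ltac:(lra) ltac:(lra) ltac:(lra))).
      assert (R2 := redpath_s_mono t b l N phi s (redpath_sub _ _ _ _ _ _ t b H ltac:(lra) ltac:(lra) ltac:(lra))).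
      rewrite HN, sqrt_0, arcsinh_0, Rminus_0_r in R1.
      assert (R3 : arcsinh (sqrt (N t)) <= M / 2).
      { assert (Ha := Rle_abs (arcsinh (sqrt (N t)))). unfold S in HSM. lra. }
      assert (R4 : sqrt (N t) <= M).
      { rewrite <- (sinh_arcsinh (sqrt (N t))).
        apply Rle_trans with (sinh (M / 2)).
        - destruct R3 as [R3|R3]; [left; now apply sinh_lt|rewrite R3; lra].
        - assert (H1 := sinh_le (M / 2) ltac:(lra)). lra. }
      assert (R5 : N t <= M ^ 2).
      { rewrite <- (pow2_sqrt (N t)) by easy. assert (H1 := sqrt_pos (N t)). nra. }
      rewrite pow_inv. apply Rmult_le_reg_l with (M ^ 2); [nra|].
      rewrite <- Rmult_assoc, Rinv_r by nra. nra. }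
    assert (Hrad : 0 <= radial (/ M) (sqrt (N b)) - radial (/ M) (sqrt (N a))).
    { rewrite HN, sqrt_0.
      enough (- radial (/ M) (sqrt (N b)) <= - radial (/ M) 0) by lra.
      apply (nonincreasing_off_list nil (fun x => - radial (/ M) x)); [apply sqrt_pos| |].
      - intros x _. assert (H1 := radial_cont (/ M) x). cont.
      - intros x _ _. exists (- dradial (/ M) x). split; [apply (is_derive_opp (radial _)), radial_derive|].
        assert (0 <= dradial (/ M) x); [|lra].
        apply Rdiv_le_0_compat; [|nra]. assert (Hp := sqrt_pos (1 + (1 - (/ M) ^ 2) * x ^ 2)). lra. }
    assert (C1 := calib_le a b l N phi s (/ M) 1 H Hin ltac:(now left)).
    assert (C2 := calib_le a b l N _ s (/ M) 1 (redpath_reflect _ _ _ _ _ _ H) Hin ltac:(now left)).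
    cbv beta in C2. fold S in C1, C2.
    assert (HMi : 0 < / M) by now apply Rinv_0_lt_compat.
    assert (K1 : / M * (phi b - phi a) <= S) by lra.
    assert (K2 : / M * (- (phi b - phi a)) <= S) by lra.
    apply (Rmult_le_compat_l M) in K1; [|lra]. apply (Rmult_le_compat_l M) in K2; [|lra].
    rewrite <- Rmult_assoc, Rinv_r, Rmult_1_l in K1, K2 by lra.
    apply Rabs_le; lra. }
  destruct (Req_dec S 0) as [E|E].
  - rewrite E. assert (Hb := Hbound 1 ltac:(lra) ltac:(lra) ltac:(lra)). rewrite E in Hb. lra.
  - assert (Hb := Hbound S ltac:(lra) ltac:(lra) ltac:(lra)). lra.
Qed.

(** * Matrices in coordinates *)

Definition elt (A1 A2 B1 B2 v : R) : M3 := SU11R_elt (A1, A2) (B1, B2) v.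

Lemma entry_mk (f : nat -> nat -> C) i j : (i < 3)%nat -> (j < 3)%nat -> entry (mk_matrix 3 3 f) i j = f i j.
Proof. intros Hi Hj. unfold entry. now apply coeff_mat_bij. Qed.

Lemma entry_mult (M N : M3) i j : (i < 3)%nat -> (j < 3)%nat ->
  entry (mat_mult M N) i j =
  (entry M i 0 * entry N 0 j + entry M i 1 * entry N 1 j + entry M i 2 * entry N 2 j)%C.
Proof.
  intros Hi Hj. unfold mat_mult, Mmult. rewrite entry_mk by easy. simpl pred.
  rewrite !sum_Sn, sum_O. reflexivity.
Qed.

Lemma elt_Id : elt 1 0 0 0 0 = mat_Id.
Proof.
  unfold elt, mat_Id, Mone. apply mk_matrix_ext. intros i j Hi Hj.
  destruct i as [|[|[|i]]], j as [|[|[|j]]]; try lia; simpl; unfold one, zero; simpl;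
    unfold RtoC, Cconj; simpl; rewrite ?exp_0, ?Ropp_0; reflexivity.
Qed.

(** The matrix [x1 E1 + x2 (E4 - E3) + x3 E2]. *)
Definition velocity (x1 x2 x3 : R) (i j : nat) : C :=
  match i, j with
  | 0%nat, 0%nat => (0, - x2 / 2)
  | 0%nat, 1%nat => (x1 / 2, x3 / 2)
  | 1%nat, 0%nat => (x1 / 2, - x3 / 2)
  | 1%nat, 1%nat => (0, x2 / 2)
  | 2%nat, 2%nat => (x2, 0)
  | _, _ => (0, 0)
  end.

Lemma entry_lin_comb x1 x2 x3 i j : (i < 3)%nat -> (j < 3)%nat ->
  entry (lin_comb (x1, x2, x3)) i j = velocity x1 x2 x3 i j.
Proof.
  intros Hi Hj.
  unfold lin_comb, mat_plus, plus, E1, E2, E3, E4, mat_scal, mat_minus, minus, mat_plus, plus, opp, munit.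
  simpl. unfold Mplus, Mopp. unfold entry.
  destruct i as [|[|[|i]]], j as [|[|[|j]]]; try lia;
  repeat (rewrite coeff_mat_bij by lia); simpl;
  unfold velocity, Cmult, Cplus, Cdiv, Cinv, Copp, RtoC, Ci, plus, opp; simpl;
  apply injective_projections; simpl; field.
Qed.

Lemma entry_elt A1 A2 B1 B2 v i j : (i < 3)%nat -> (j < 3)%nat ->
  entry (elt A1 A2 B1 B2 v) i j =
  match i, j with
  | 0%nat, 0%nat => (A1, A2)
  | 0%nat, 1%nat => (B1, B2)
  | 1%nat, 0%nat => (B1, - B2)
  | 1%nat, 1%nat => (A1, - A2)
  | 2%nat, 2%nat => (exp v, 0)
  | _, _ => (0, 0)
  end.
Proof.
  intros Hi Hj. unfold elt, SU11R_elt. rewrite entry_mk by easy.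
  destruct i as [|[|[|i]]], j as [|[|[|j]]]; try lia; reflexivity.
Qed.

Lemma elt_inj A1 A2 B1 B2 v A1' A2' B1' B2' v' :
  elt A1 A2 B1 B2 v = elt A1' A2' B1' B2' v' ->
  A1 = A1' /\ A2 = A2' /\ B1 = B1' /\ B2 = B2' /\ v = v'.
Proof.
  intros H.
  assert (H0 := f_equal (fun M => entry M 0 0) H). assert (H1 := f_equal (fun M => entry M 0 1) H).
  assert (H2 := f_equal (fun M => entry M 2 2) H). cbv beta in H0, H1, H2.
  rewrite !entry_elt in H0, H1, H2 by lia.
  injection H0 as -> ->. injection H1 as -> ->. injection H2 as H2. apply exp_inv in H2. easy.
Qed.

Lemma in_SU11R_elt (M : M3) : in_SU11R M <->
  exists A1 A2 B1 B2 v, M = elt A1 A2 B1 B2 v /\ A1 ^ 2 + A2 ^ 2 = 1 + (B1 ^ 2 + B2 ^ 2).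
Proof.
  assert (Hm : forall x y : R, Cmod (x, y) ^ 2 = x ^ 2 + y ^ 2).
  { intros x y. unfold Cmod. simpl fst; simpl snd. rewrite pow2_sqrt; [easy|nra]. }
  split.
  - intros [[A1 A2] [[B1 B2] [v [H ->]]]]. exists A1, A2, B1, B2, v. split; [easy|].
    unfold SU11 in H. rewrite !Hm in H. lra.
  - intros [A1 [A2 [B1 [B2 [v [-> H]]]]]]. exists (A1, A2), (B1, B2), v. split; [|easy].
    unfold SU11. rewrite !Hm. lra.
Qed.

(** * Horizontal curves in coordinates *)

Lemma is_derive_C_components (f : R -> C) t (l : C) :
  @is_derive R_AbsRing C_R_NormedModule f t l <->
  is_derive (fun s => fst (f s)) t (fst l) /\ is_derive (fun s => snd (f s)) t (snd l).
Proof.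
  split.
  - intros H. split.
    + unfold is_derive in *.
      refine (filterdiff_comp' (U := R_NormedModule) (V := C_R_NormedModule) (W := R_NormedModule)
        f (fun z => fst z) t (fun y => scal y l) (fun z => fst z) H _).
      apply filterdiff_linear, is_linear_fst.
    + unfold is_derive in *.
      refine (filterdiff_comp' (U := R_NormedModule) (V := C_R_NormedModule) (W := R_NormedModule)
        f (fun z => snd z) t (fun y => scal y l) (fun z => snd z) H _).
      apply filterdiff_linear, is_linear_snd.
  - intros [H1 H2].
    assert (H := filterdiff_comp'_2 (fun s => fst (f s)) (fun s => snd (f s))
      (fun x y => (x, y) : prod_NormedModule R_AbsRing R_NormedModule R_NormedModule) t _ _ (fun x y => (x, y)) H1 H2).
    unfold is_derive.
    eapply filterdiff_ext_lin; [eapply filterdiff_ext; [|apply H]|].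
    + intros y. simpl. now destruct (f y).
    + apply filterdiff_ext_lin with (fun t => t).
      * apply filterdiff_ext with (fun t => t); [intros [x y]; reflexivity|]. apply filterdiff_id.
      * intros [x y]; reflexivity.
    + intros y. simpl. reflexivity.
Qed.

(** The equation [gamma' = gamma (x1 E1 + x2 (E4 - E3) + x3 E2)]. *)
Definition coord_ode (A1 A2 B1 B2 v : R -> R) (t x1 x2 x3 : R) : Prop :=
  is_derive A1 t ((A2 t * x2 + B1 t * x1 + B2 t * x3) / 2) /\
  is_derive A2 t ((- (A1 t * x2) + B2 t * x1 - B1 t * x3) / 2) /\
  is_derive B1 t ((A1 t * x1 - A2 t * x3 - B2 t * x2) / 2) /\
  is_derive B2 t ((A1 t * x3 + A2 t * x1 + B1 t * x2) / 2) /\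
  is_derive v t x2.

Lemma is_derive_pair (f g : R -> R) t d1 d2 (F : R -> C) (l : C) :
  is_derive f t d1 -> is_derive g t d2 -> (forall s, (f s, g s) = F s) -> (d1, d2) = l ->
  @is_derive R_AbsRing C_R_NormedModule F t l.
Proof.
  intros Hf Hg HF <-. apply (is_derive_ext (V := C_R_NormedModule) (fun s => (f s, g s))); [exact HF|].
  apply is_derive_C_components. now split.
Qed.

Lemma entries_of_coord_ode A1 A2 B1 B2 v t x1 x2 x3 i j : (i < 3)%nat -> (j < 3)%nat ->
  coord_ode A1 A2 B1 B2 v t x1 x2 x3 ->
  @is_derive R_AbsRing C_R_NormedModule (fun s => entry (elt (A1 s) (A2 s) (B1 s) (B2 s) (v s)) i j) t
    (entry (mat_mult (elt (A1 t) (A2 t) (B1 t) (B2 t) (v t)) (lin_comb (x1, x2, x3))) i j).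
Proof.
  intros Hi Hj [HA1 [HA2 [HB1 [HB2 Hv]]]].
  rewrite entry_mult, !entry_lin_comb, !entry_elt by lia.
  assert (HA2' := is_derive_opp A2 t _ HA2). assert (HB2' := is_derive_opp B2 t _ HB2).
  assert (Hc : is_derive (fun _ : R => 0) t 0) by apply @is_derive_const.
  assert (He : is_derive (fun s => exp (v s)) t (x2 * exp (v t))).
  { apply (is_derive_comp exp v); [apply is_derive_exp|easy]. }
  assert (Hfin : forall z w : C, fst z = fst w -> snd z = snd w -> z = w) by (intros; now apply injective_projections).
  destruct i as [|[|[|i]]], j as [|[|[|j]]]; try lia;
    (eapply is_derive_pair; [ | |intros s; rewrite entry_elt by lia; reflexivity|]);
    [ exact HA1 | exact HA2 | | exact HB1 | exact HB2 | | exact Hc | exact Hc |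
    | exact HB1 | exact HB2' | | exact HA1 | exact HA2' | | exact Hc | exact Hc |
    | exact Hc | exact Hc | | exact Hc | exact Hc | | exact He | exact Hc | ];
    apply Hfin; unfold opp; simpl; field.
Qed.

Lemma coord_ode_of_entries (gam : R -> M3) t x1 x2 x3 :
  (forall i j, (i < 3)%nat -> (j < 3)%nat ->
     @is_derive R_AbsRing C_R_NormedModule (fun s => entry (gam s) i j) t
       (entry (mat_mult (gam t) (lin_comb (x1, x2, x3))) i j)) ->
  in_SU11R (gam t) ->
  coord_ode (fun s => fst (entry (gam s) 0 0)) (fun s => snd (entry (gam s) 0 0))
    (fun s => fst (entry (gam s) 0 1)) (fun s => snd (entry (gam s) 0 1))
    (fun s => ln (fst (entry (gam s) 2 2))) t x1 x2 x3.
Proof.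
  intros H Hin. apply in_SU11R_elt in Hin. destruct Hin as [A1 [A2 [B1 [B2 [v [E _]]]]]].
  assert (H00 := proj1 (is_derive_C_components _ _ _) (H 0%nat 0%nat ltac:(lia) ltac:(lia))).
  assert (H01 := proj1 (is_derive_C_components _ _ _) (H 0%nat 1%nat ltac:(lia) ltac:(lia))).
  assert (H22 := proj1 (is_derive_C_components _ _ _) (H 2%nat 2%nat ltac:(lia) ltac:(lia))).
  clear H. rewrite !entry_mult, !entry_lin_comb, E, !entry_elt in H00, H01, H22 by lia.
  unfold coord_ode. rewrite E, !entry_elt by lia. simpl in H00, H01, H22 |- *.
  destruct H00 as [D1 D2], H01 as [D3 D4], H22 as [D5 _].
  split; [|split; [|split; [|split]]].
  - eapply is_derive_eq; [exact D1|real_eq; field].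
  - eapply is_derive_eq; [exact D2|real_eq; field].
  - eapply is_derive_eq; [exact D3|real_eq; field].
  - eapply is_derive_eq; [exact D4|real_eq; field].
  - assert (He := exp_pos v).
    assert (D6 : is_derive ln (fst (entry (gam t) 2 2)) (/ exp v)).
    { rewrite E, entry_elt by lia. simpl. apply is_derive_Reals, derivable_pt_lim_ln, He. }
    eapply is_derive_eq; [exact (is_derive_comp ln (fun s => fst (entry (gam s) 2 2)) t _ _ D6 D5)|].
    change (scal ?a ?b) with (a * b). unfold scal; simpl; unfold mult; simpl. real_eq. field. lra.
Qed.

(** * Primitives of piecewise continuous functions *)

Lemma clamp_cont a b t : continuous (fun t => Rmax a (Rmin b t)) t.
Proof.
  apply (continuous_ext (fun t => (a + (b + t - Rabs (b - t)) / 2 + Rabs (a - (b + t - Rabs (b - t)) / 2)) / 2)); [|cont; lra].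
  intros y. unfold Rmax, Rmin, Rabs.
  destruct (Rle_dec b y), (Rcase_abs (b - y)); try (destruct (Rcase_abs _)); destruct (Rle_dec _ _); lra.
Qed.

Lemma Rmin_cont b t : continuous (fun t => Rmin b t) t.
Proof.
  apply (continuous_ext (fun t => (b + t - Rabs (b - t)) / 2)); [|cont; lra].
  intros y. unfold Rmin, Rabs. destruct (Rle_dec b y), (Rcase_abs (b - y)); lra.
Qed.

Lemma Rmax_cont b t : continuous (fun t => Rmax b t) t.
Proof.
  apply (continuous_ext (fun t => (b + t + Rabs (b - t)) / 2)); [|cont; lra].
  intros y. unfold Rmax, Rabs. destruct (Rle_dec b y), (Rcase_abs (b - y)); lra.
Qed.

Lemma locally_interval (a b t : R) (P : R -> Prop) : a < t < b -> (forall s, a < s < b -> P s) -> locally t P.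
Proof.
  intros Ht H. apply (locally_near t (Rmin (t - a) (b - t))); [apply Rmin_glb_lt; lra|].
  intros s Hs. assert (H1 := Rmin_l (t - a) (b - t)). assert (H2 := Rmin_r (t - a) (b - t)).
  apply Rabs_def2 in Hs. apply H. lra.
Qed.

Definition knots (p : nat -> R) (n : nat) : list R := map p (seq 0 (S n)).

Lemma knots_in p n k : (k <= n)%nat -> In (p k) (knots p n).
Proof. intros Hk. apply in_map, in_seq. lia. Qed.

Lemma partition_le (p : nat -> R) n : (forall k, (k < n)%nat -> p k < p (S k)) ->
  forall k, (k <= n)%nat -> p 0%nat <= p k <= p n.
Proof.
  intros Hp k Hk. split.
  - induction k as [|k IH]; [lra|]. specialize (IH ltac:(lia)). specialize (Hp k ltac:(lia)). lra.
  - induction n as [|n IH]; [replace k with 0%nat by lia; lra|].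
    destruct (Nat.eq_dec k (S n)) as [->|]; [lra|].
    assert (H := Hp n ltac:(lia)). assert (p k <= p n); [|lra].
    apply IH; [intros; apply Hp; lia|lia].
Qed.

Lemma piece_of (p : nat -> R) n t : p 0%nat < t < p n -> ~ In t (knots p n) ->
  exists k, (k < n)%nat /\ p k < t < p (S k).
Proof.
  intros Ht Hn. induction n as [|n IH]; [lra|].
  destruct (Rtotal_order t (p n)) as [h|[h|h]].
  - destruct IH as [k [Hk Hk2]]; [lra| |exists k; split; [lia|easy]].
    intros Hin. apply Hn. unfold knots in *. apply in_map_iff in Hin. destruct Hin as [j [<- Hj]].
    apply in_seq in Hj. apply in_map, in_seq. lia.
  - exfalso. apply Hn. rewrite h. apply knots_in. lia.
  - exists n. split; [lia|lra].
Qed.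

Lemma primitive_continuous (h : R -> R) (c : R) : (forall t, continuous h t) ->
  forall t, is_derive (fun t => RInt h c t) t (h t).
Proof.
  intros Hc t. apply is_derive_RInt with (a := c); [|apply Hc].
  apply filter_forall; intros y. apply (RInt_correct (V := R_CompleteNormedModule)).
  apply (ex_RInt_continuous (V := R_CompleteNormedModule)); intros z _; apply Hc.
Qed.

(** The primitive is extended past a knot by the integral of a control that is
    continuous on the whole line. *)
Lemma primitive_piecewise (h : R -> R) (p : nat -> R) (n : nat) :
  (forall k, (k < n)%nat -> p k < p (S k) /\
     exists hk : R -> R, (forall t, continuous hk t) /\ forall t, p k < t < p (S k) -> h t = hk t) ->
  exists G : R -> R, (forall t, continuous G t) /\ G (p 0%nat) = 0 /\
    (forall t, p 0%nat < t < p n -> ~ In t (knots p n) -> is_derive G t (h t)) /\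
    is_RInt h (p 0%nat) (p n) (G (p n)).
Proof.
  induction n as [|n IH]; intros H.
  - exists (fun _ => 0). split; [intros; apply continuous_const|split; [easy|split; [intros; lra|]]].
    apply (is_RInt_point (V := R_NormedModule)).
  - destruct IH as [G [G1 [G2 [G3 G4]]]]; [intros k Hk; apply H; lia|].
    destruct (H n ltac:(lia)) as [Hlt [hn [Hh1 Hh2]]].
    assert (Hpos : p 0%nat <= p n).
    { apply (partition_le p n); [|lia]. intros k Hk; apply H; lia. }
    assert (HI := primitive_continuous hn (p n) Hh1). set (I := fun t => RInt hn (p n) t) in *.
    assert (HI0 : I (p n) = 0) by (unfold I; apply (RInt_point (V := R_CompleteNormedModule))).
    exists (fun t => G (Rmin (p n) t) + I (Rmax (p n) t)).
    split; [|split; [|split]].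
    + intros t. apply (continuous_plus (fun t => G (Rmin (p n) t))).
      * apply (continuous_comp (fun t => Rmin (p n) t) G); [apply Rmin_cont|apply G1].
      * apply (continuous_comp (fun t => Rmax (p n) t) I); [apply Rmax_cont|]. eapply is_derive_cont, HI.
    + rewrite Rmin_right, Rmax_left, HI0 by lra. lra.
    + intros t Ht Hn.
      assert (Hnot : t <> p n) by (intros ->; apply Hn, knots_in; lia).
      destruct (Rlt_dec t (p n)) as [h1|h1].
      * apply (is_derive_ext_loc G).
        { apply (locally_interval (p 0%nat) (p n)); [lra|]. intros s Hs.
          rewrite Rmin_right, Rmax_left, HI0 by lra. simpl. lra. }
        apply G3; [lra|]. intros Hin. apply Hn. unfold knots in *. apply in_map_iff in Hin.
        destruct Hin as [j [<- Hj]]. apply in_seq in Hj. apply in_map, in_seq. lia.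
      * apply (is_derive_ext_loc (fun t => G (p n) + I t)).
        { apply (locally_interval (p n) (p (S n))); [lra|]. intros s Hs.
          rewrite Rmin_left, Rmax_right by lra. easy. }
        rewrite (Hh2 t) by lra.
        eapply is_derive_eq; [apply (is_derive_plus (fun _ => G (p n))); [apply @is_derive_const|apply HI]|].
        apply Rplus_0_l.
    + rewrite Rmin_left, Rmax_right by lra.
      apply (is_RInt_Chasles (V := R_NormedModule)) with (p n); [easy|].
      apply (is_RInt_ext hn).
      { rewrite Rmin_left, Rmax_right by lra. intros x Hx. symmetry. now apply Hh2. }
      apply (RInt_correct (V := R_CompleteNormedModule)).
      apply (ex_RInt_continuous (V := R_CompleteNormedModule)); intros z _; apply Hh1.
Qed.

(** * Polar coordinates *)

Lemma polar x y r : 0 <= r -> x ^ 2 + y ^ 2 = r ^ 2 ->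
  exists th sg, 0 <= th <= PI /\ (sg = 1 \/ sg = -1) /\ x = r * cos (sg * th) /\ y = r * sin (sg * th).
Proof.
  intros Hr H. destruct (Req_dec r 0) as [->|Hr0].
  - exists 0, 1. assert (HP := PI_RGT_0). split; [lra|split; [now left|]]. split; nra.
  - assert (Hb : -1 <= x / r <= 1).
    { assert (- r <= x <= r) by nra. split; [apply Rle_div_r; lra|apply Rle_div_l; lra]. }
    set (th := acos (x / r)).
    assert (Hth : 0 <= th <= PI) by apply acos_bound.
    assert (Hc : cos th = x / r) by (apply cos_acos; lra).
    assert (Hs : 0 <= sin th) by (apply sin_ge_0; lra).
    assert (Hs2 := sin2_cos2 th). unfold Rsqr in Hs2. rewrite Hc in Hs2.
    assert (Hy : (r * sin th) ^ 2 = y ^ 2).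
    { replace ((r * sin th) ^ 2) with (r ^ 2 * (sin th * sin th + x / r * (x / r)) - x ^ 2) by (field; lra).
      rewrite Hs2. lra. }
    destruct (Rle_dec 0 y) as [h|h].
    + exists th, 1. split; [easy|split; [now left|]]. rewrite Rmult_1_l, Hc. split; [field; lra|].
      apply Rsqr_inj; [easy|nra|]. rewrite !Rsqr_pow2. easy.
    + exists th, (-1). split; [easy|split; [now right|]].
      replace (-1 * th) with (- th) by ring. rewrite cos_neg, sin_neg, Hc. split; [field; lra|].
      assert (- y = r * sin th); [|lra]. apply Rsqr_inj; [lra|nra|]. rewrite !Rsqr_pow2. nra.
Qed.

Lemma angle_min th x : 0 <= th <= PI -> cos x = cos th -> th <= Rabs x.
Proof.
  intros Hth H. apply Rnot_lt_le. intros Hlt.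
  assert (E : cos (Rabs x) = cos x).
  { unfold Rabs. destruct (Rcase_abs x); [apply cos_neg|easy]. }
  assert (Hp := Rabs_pos x).
  assert (cos th < cos (Rabs x)) by (apply cos_decreasing_1; lra). lra.
Qed.

Lemma cos_sg sg x : sg = 1 \/ sg = -1 -> cos (sg * x) = cos x.
Proof.
  intros [-> | ->]; [now rewrite Rmult_1_l|]. replace (-1 * x) with (- x) by ring. apply cos_neg.
Qed.

Lemma cos_of_pair x y z : cos (x - z) = cos (y - z) -> sin (x - z) = sin (y - z) -> cos x = cos y.
Proof.
  intros H1 H2. replace x with (x - z + z) by ring. replace y with (y - z + z) by ring.
  rewrite !cos_plus, H1, H2. reflexivity.
Qed.

Definition modA (B1 B2 : R) : R := sqrt (1 + (B1 ^ 2 + B2 ^ 2)).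

Lemma modA_pos B1 B2 : 0 < modA B1 B2.
Proof. apply sqrt_lt_R0. nra. Qed.
Lemma modA_sq B1 B2 : modA B1 B2 ^ 2 = 1 + (B1 ^ 2 + B2 ^ 2).
Proof. apply pow2_sqrt. nra. Qed.

(** [ph] is an argument of [A e^(i v / 2)]; in the group [|A|] is [modA]. *)
Definition has_arg (A1 A2 B1 B2 v ph : R) : Prop :=
  A1 = modA B1 B2 * cos (ph - v / 2) /\ A2 = modA B1 B2 * sin (ph - v / 2).

Lemma has_arg_norm A1 A2 B1 B2 v ph : has_arg A1 A2 B1 B2 v ph -> A1 ^ 2 + A2 ^ 2 = 1 + (B1 ^ 2 + B2 ^ 2).
Proof.
  intros [-> ->]. rewrite <- modA_sq. assert (E := sin2_cos2 (ph - v / 2)). unfold Rsqr in E.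
  transitivity (modA B1 B2 ^ 2 * (sin (ph - v / 2) * sin (ph - v / 2) + cos (ph - v / 2) * cos (ph - v / 2))); [ring|].
  rewrite E. ring.
Qed.

Lemma arg_exists A1 A2 B1 B2 v ph0 : A1 ^ 2 + A2 ^ 2 = 1 + (B1 ^ 2 + B2 ^ 2) ->
  exists th sg, 0 <= th <= PI /\ (sg = 1 \/ sg = -1) /\ has_arg A1 A2 B1 B2 v (ph0 + sg * th).
Proof.
  intros H. set (z := ph0 - v / 2).
  assert (E := sin2_cos2 z). unfold Rsqr in E.
  destruct (polar (A1 * cos z + A2 * sin z) (A2 * cos z - A1 * sin z) (modA B1 B2)) as [th [sg [Hth [Hsg [H1 H2]]]]].
  - left; apply modA_pos.
  - rewrite modA_sq, <- H.
    transitivity ((A1 ^ 2 + A2 ^ 2) * (sin z * sin z + cos z * cos z)); [ring|rewrite E; ring].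
  - exists th, sg. split; [easy|split; [easy|]]. unfold has_arg.
    replace (ph0 + sg * th - v / 2) with (z + sg * th) by (unfold z; ring).
    rewrite cos_plus, sin_plus. split.
    + transitivity (cos z * (modA B1 B2 * cos (sg * th)) - sin z * (modA B1 B2 * sin (sg * th))); [|ring].
      rewrite <- H1, <- H2. transitivity (A1 * (sin z * sin z + cos z * cos z)); [rewrite E|]; ring.
    + transitivity (sin z * (modA B1 B2 * cos (sg * th)) + cos z * (modA B1 B2 * sin (sg * th))); [|ring].
      rewrite <- H1, <- H2. transitivity (A2 * (sin z * sin z + cos z * cos z)); [rewrite E|]; ring.
Qed.

Lemma has_arg_cos A1 A2 B1 B2 v x y : has_arg A1 A2 B1 B2 v x -> has_arg A1 A2 B1 B2 v y ->
  cos x = cos y /\ forall z, cos (x - z) = cos (y - z).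
Proof.
  intros [H1 H2] [H3 H4]. assert (Hm := modA_pos B1 B2).
  assert (E1 : cos (x - v / 2) = cos (y - v / 2)) by (apply Rmult_eq_reg_l with (modA B1 B2); lra).
  assert (E2 : sin (x - v / 2) = sin (y - v / 2)) by (apply Rmult_eq_reg_l with (modA B1 B2); lra).
  split; [now apply (cos_of_pair x y (v / 2))|].
  intros z. apply (cos_of_pair (x - z) (y - z) (v / 2 - z)).
  - replace (x - z - (v / 2 - z)) with (x - v / 2) by ring. replace (y - z - (v / 2 - z)) with (y - v / 2) by ring. easy.
  - replace (x - z - (v / 2 - z)) with (x - v / 2) by ring. replace (y - z - (v / 2 - z)) with (y - v / 2) by ring. easy.
Qed.

(** * Reduction of horizontal curves *)

Definition c1 (x : R * R * R) : R := fst (fst x).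
Definition c2 (x : R * R * R) : R := snd (fst x).
Definition c3 (x : R * R * R) : R := snd x.

Lemma frame_norm_c x : frame_norm x = sqrt (c1 x ^ 2 + c2 x ^ 2 + c3 x ^ 2).
Proof. now destruct x as [[x1 x2] x3]. Qed.

Lemma c1_cont (w : R -> R * R * R) t : continuous w t -> continuous (fun t => c1 (w t)) t.
Proof.
  intros H. apply (continuous_comp (fun t => fst (w t)) fst); [|apply continuous_fst].
  apply (continuous_comp w fst); [easy|apply continuous_fst].
Qed.
Lemma c2_cont (w : R -> R * R * R) t : continuous w t -> continuous (fun t => c2 (w t)) t.
Proof.
  intros H. apply (continuous_comp (fun t => fst (w t)) snd); [|apply continuous_snd].
  apply (continuous_comp w fst); [easy|apply continuous_fst].
Qed.
Lemma c3_cont (w : R -> R * R * R) t : continuous w t -> continuous (fun t => c3 (w t)) t.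
Proof. intros H. apply (continuous_comp w snd); [easy|apply continuous_snd]. Qed.

Lemma clamp_id a b t : a <= t <= b -> Rmax a (Rmin b t) = t.
Proof. intros H. rewrite Rmin_right, Rmax_right; lra. Qed.

Lemma clamp_range a b t : a <= b -> a <= Rmax a (Rmin b t) <= b.
Proof. intros H. split; [apply Rmax_l|]. apply Rmax_lub; [easy|apply Rmin_l]. Qed.

Lemma continuous_on_clamp {U : UniformSpace} (f : R -> U) a b t : a <= b ->
  continuous_on (fun t => a <= t <= b) f -> continuous (fun t => f (Rmax a (Rmin b t))) t.
Proof.
  intros Hab Hf. unfold continuous.
  apply filterlim_comp with (2 := Hf (Rmax a (Rmin b t)) (clamp_range a b t Hab)).
  intros P HP. generalize (clamp_cont a b t _ HP). unfold filtermap. apply filter_imp.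
  intros s Hs. apply Hs. now apply clamp_range.
Qed.

(** Coordinates of a curve; the parameter is clamped to make them continuous
    on the whole line. *)
Lemma curve_coords gam a b : curve_in_SU11R gam a b ->
  let cl := fun t => Rmax a (Rmin b t) in
  (forall t, continuous (fun t => fst (entry (gam (cl t)) 0 0)) t /\
     continuous (fun t => snd (entry (gam (cl t)) 0 0)) t /\
     continuous (fun t => fst (entry (gam (cl t)) 0 1)) t /\
     continuous (fun t => snd (entry (gam (cl t)) 0 1)) t /\
     continuous (fun t => ln (fst (entry (gam (cl t)) 2 2))) t) /\
  (forall t, a <= t <= b ->
     gam t = elt (fst (entry (gam t) 0 0)) (snd (entry (gam t) 0 0))
       (fst (entry (gam t) 0 1)) (snd (entry (gam t) 0 1)) (ln (fst (entry (gam t) 2 2))) /\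
     fst (entry (gam t) 0 0) ^ 2 + snd (entry (gam t) 0 0) ^ 2
       = 1 + (fst (entry (gam t) 0 1) ^ 2 + snd (entry (gam t) 0 1) ^ 2)).
Proof.
  intros [Hab [Hin Hcont]] cl.
  assert (Hcl : forall t, a <= cl t <= b) by (intros t; now apply clamp_range).
  assert (Hci : forall i j t, (i < 3)%nat -> (j < 3)%nat ->
    continuous (fun t => fst (entry (gam (cl t)) i j)) t /\ continuous (fun t => snd (entry (gam (cl t)) i j)) t).
  { intros i j t Hi Hj.
    assert (H := continuous_on_clamp (U := C_UniformSpace) (fun t => entry (gam t) i j) a b t Hab (Hcont i j Hi Hj)).
    split.
    - apply (continuous_comp (V := C_UniformSpace) (fun t => entry (gam (cl t)) i j) fst); [exact H|apply continuous_fst].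
    - apply (continuous_comp (V := C_UniformSpace) (fun t => entry (gam (cl t)) i j) snd); [exact H|apply continuous_snd]. }
  assert (Hrep : forall t, a <= t <= b -> exists A1 A2 B1 B2 v, gam t = elt A1 A2 B1 B2 v /\
     A1 ^ 2 + A2 ^ 2 = 1 + (B1 ^ 2 + B2 ^ 2)).
  { intros t Ht. now apply in_SU11R_elt, Hin. }
  split.
  - intros t. destruct (Hci 0%nat 0%nat t ltac:(lia) ltac:(lia)) as [K1 K2].
    destruct (Hci 0%nat 1%nat t ltac:(lia) ltac:(lia)) as [K3 K4].
    destruct (Hci 2%nat 2%nat t ltac:(lia) ltac:(lia)) as [K5 _].
    split; [exact K1|split; [exact K2|split; [exact K3|split; [exact K4|]]]].
    apply (continuous_comp (fun t => fst (entry (gam (cl t)) 2 2)) ln); [exact K5|].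
    eapply is_derive_cont, is_derive_Reals, derivable_pt_lim_ln.
    destruct (Hrep (cl t) (Hcl t)) as [A1 [A2 [B1 [B2 [v [-> _]]]]]]. rewrite entry_elt by lia. apply exp_pos.
  - intros t Ht. destruct (Hrep t Ht) as [A1 [A2 [B1 [B2 [v [-> H]]]]]].
    rewrite !entry_elt by lia. simpl fst. simpl snd. now rewrite ln_exp.
Qed.

(** A horizontal curve, in coordinates that are continuous on the whole line,
    with primitives of the functions of the control that occur below. *)
Lemma horizontal_coords gam u a b : horizontal_curve gam u a b ->
  a <= b /\ exists (A1 A2 B1 B2 v : R -> R) (l : list R),
    (forall t, continuous A1 t /\ continuous A2 t /\ continuous B1 t /\ continuous B2 t /\ continuous v t) /\
    (forall t, a <= t <= b -> gam t = elt (A1 t) (A2 t) (B1 t) (B2 t) (v t) /\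
       A1 t ^ 2 + A2 t ^ 2 = 1 + (B1 t ^ 2 + B2 t ^ 2)) /\
    (forall t, a < t < b -> ~ In t l -> coord_ode A1 A2 B1 B2 v t (c1 (u t)) (c2 (u t)) (c3 (u t))) /\
    (forall g : R -> R * R * R -> R,
       (forall w : R -> R * R * R, (forall t, continuous w t) -> forall t, continuous (fun t => g t (w t)) t) ->
       exists G : R -> R, (forall t, continuous G t) /\ G a = 0 /\
         (forall t, a < t < b -> ~ In t l -> is_derive G t (g t (u t))) /\
         is_RInt (fun t => g t (u t)) a b (G b)).
Proof.
  intros [Hcurve [n [p [Hp0 [Hpn Hp]]]]].
  destruct (curve_coords gam a b Hcurve) as [Hcc Hrep]. destruct Hcurve as [Hab [Hin _]]. split; [easy|].
  set (cl := fun t => Rmax a (Rmin b t)) in *.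
  assert (Hclid : forall t, a <= t <= b -> cl t = t) by (intros t; apply clamp_id).
  exists (fun t => fst (entry (gam (cl t)) 0 0)), (fun t => snd (entry (gam (cl t)) 0 0)),
    (fun t => fst (entry (gam (cl t)) 0 1)), (fun t => snd (entry (gam (cl t)) 0 1)),
    (fun t => ln (fst (entry (gam (cl t)) 2 2))), (knots p n).
  split; [|split; [|split]].
  - exact Hcc.
  - intros t Ht. rewrite Hclid by easy. now apply Hrep.
  - intros t Ht Hn. rewrite <- Hp0, <- Hpn in Ht.
    destruct (piece_of p n t Ht Hn) as [k [Hk Hkt]].
    destruct (Hp k Hk) as [_ [w [_ Hw]]]. destruct (Hw t Hkt) as [_ Hd]. clear Hw.
    rewrite Hp0, Hpn in Ht.
    assert (O : coord_ode (fun s => fst (entry (gam s) 0 0)) (fun s => snd (entry (gam s) 0 0))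
      (fun s => fst (entry (gam s) 0 1)) (fun s => snd (entry (gam s) 0 1))
      (fun s => ln (fst (entry (gam s) 2 2))) t (c1 (u t)) (c2 (u t)) (c3 (u t))).
    { apply coord_ode_of_entries; [|apply Hin; lra]. intros i j Hi Hj. specialize (Hd i j Hi Hj).
      replace (c1 (u t), c2 (u t), c3 (u t)) with (u t) by now destruct (u t) as [[? ?] ?]. exact Hd. }
    assert (Hloc : forall f : R -> R, forall d, is_derive f t d -> is_derive (fun t => f (cl t)) t d).
    { intros f d Hf. apply (is_derive_ext_loc f); [|exact Hf].
      apply (locally_interval a b); [easy|]. intros s Hs. now rewrite Hclid by lra. }
    unfold coord_ode in *. rewrite (Hclid t) by lra.
    destruct O as [O1 [O2 [O3 [O4 O5]]]].
    split; [|split; [|split; [|split]]].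
    + exact (Hloc _ _ O1).
    + exact (Hloc _ _ O2).
    + exact (Hloc _ _ O3).
    + exact (Hloc _ _ O4).
    + exact (Hloc _ _ O5).
  - intros g Hg.
    destruct (primitive_piecewise (fun t => g t (u t)) p n) as [G HG].
    + intros k Hk. destruct (Hp k Hk) as [Hlt [w [Hw1 Hw2]]]. split; [easy|].
      exists (fun t => g t (w t)). split; [now apply Hg|].
      intros t Ht. now rewrite (proj1 (Hw2 t Ht)).
    + rewrite Hp0, Hpn in HG. now exists G.
Qed.

Lemma is_derive_sumsq (f g : R -> R) t d e : is_derive f t d -> is_derive g t e ->
  is_derive (fun t => f t ^ 2 + g t ^ 2) t (2 * (f t * d + g t * e)).
Proof.
  intros Hf Hg. auto_derive; [split; [now exists d|split; [now exists e|easy]]|].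
  rewrite_Derive Hf. rewrite_Derive Hg. ring.
Qed.

Lemma cont_sumsq (f g : R -> R) t : continuous f t -> continuous g t -> continuous (fun t => f t ^ 2 + g t ^ 2) t.
Proof.
  intros Hf Hg. cont.
Qed.

Lemma frame_norm_cont (w : R -> R * R * R) : (forall t, continuous w t) ->
  forall t, continuous (fun t => frame_norm (w t)) t.
Proof.
  intros Hw t. apply (continuous_ext (fun t => sqrt (c1 (w t) ^ 2 + c2 (w t) ^ 2 + c3 (w t) ^ 2))).
  { intros s. now rewrite frame_norm_c. }
  assert (H1 := c1_cont w t (Hw t)). assert (H2 := c2_cont w t (Hw t)). assert (H3 := c3_cont w t (Hw t)). cont.
Qed.

(** The norm of a vector as a supremum over directions; this replaces a
    triangle inequality for integrals of plane vectors. *)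
Lemma sqrt_sumsq_le c d L : (forall x y, 0 <= x -> x ^ 2 + y ^ 2 = 1 -> x * c + y * d <= L) -> 0 <= c -> sqrt (c ^ 2 + d ^ 2) <= L.
Proof.
  intros H Hc. set (r := sqrt (c ^ 2 + d ^ 2)).
  assert (Hr : r ^ 2 = c ^ 2 + d ^ 2) by (apply pow2_sqrt; nra).
  assert (Hr0 : 0 <= r) by apply sqrt_pos.
  destruct (Req_dec r 0) as [E|E].
  - assert (H1 := H 1 0 ltac:(lra) ltac:(ring)). rewrite E. lra.
  - assert (H1 := H (c / r) (d / r) ltac:(apply Rdiv_le_0_compat; lra)).
    replace ((c / r) ^ 2 + (d / r) ^ 2) with ((c ^ 2 + d ^ 2) / r ^ 2) in H1 by (field; lra).
    rewrite <- Hr in H1. replace (c / r * c + d / r * d) with (r ^ 2 / r) in H1 by (rewrite Hr; field; lra).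
    replace (r ^ 2 / r) with r in H1 by (field; lra). apply H1. field; lra.
Qed.

(** The phase of [B] is forgotten, and [v] becomes the second leg of a right
    triangle, since [v' = x2] while the arclength of the projection has
    derivative [sqrt (x1^2 + x3^2)].  The argument [phi] is defined by
    integration, and shown to be an argument by a differential equation, which
    avoids the lifting of angles. *)
Lemma reduction gam u a b p1 p2 q1 q2 v0 p1' p2' q1' q2' v1 phi0 :
  horizontal_curve gam u a b -> gam a = elt p1 p2 q1 q2 v0 -> gam b = elt p1' p2' q1' q2' v1 ->
  has_arg p1 p2 q1 q2 v0 phi0 ->
  exists l N phi s, redpath a b l N phi s /\ N a = q1 ^ 2 + q2 ^ 2 /\ N b = q1' ^ 2 + q2' ^ 2 /\
    phi a = phi0 /\ s a = 0 /\ has_arg p1' p2' q1' q2' v1 (phi b) /\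
    sqrt (s b ^ 2 + (v1 - v0) ^ 2) <= RInt (fun t => frame_norm (u t)) a b.
Proof.
  intros Hh Ha Hb [Hp1 Hp2].
  destruct (horizontal_coords gam u a b Hh) as [Hab [A1 [A2 [B1 [B2 [v [l [Hc [He [Hode Hprim]]]]]]]]]].
  assert (Ea := proj1 (He a ltac:(lra))). rewrite Ha in Ea. apply elt_inj in Ea.
  assert (Eb := proj1 (He b ltac:(lra))). rewrite Hb in Eb. apply elt_inj in Eb.
  destruct Ea as [-> [-> [-> [-> ->]]]]. destruct Eb as [-> [-> [-> [-> ->]]]].
  set (N := fun t => B1 t ^ 2 + B2 t ^ 2).
  assert (HN0 : forall t, 0 <= N t) by (intros t; unfold N; nra).
  assert (HNc : forall t, continuous N t) by (intros t; destruct (Hc t) as [_ [_ [K3 [K4 _]]]]; now apply cont_sumsq).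
  (* real and imaginary parts of [B W conj A], where [W = x1 + i x3] *)
  set (F := fun t (w : R * R * R) => B1 t * c1 w + B2 t * c3 w).
  set (H := fun t (w : R * R * R) => B2 t * c1 w - B1 t * c3 w).
  set (X := fun t w => F t w * A1 t + H t w * A2 t). set (Y := fun t w => H t w * A1 t - F t w * A2 t).
  destruct (Hprim (fun t w => frame_norm w)) as [ell [L1 [L2 [L3 L4]]]]; [exact frame_norm_cont|].
  destruct (Hprim (fun t w => sqrt (c1 w ^ 2 + c3 w ^ 2))) as [s [S1 [S2 [S3 _]]]].
  { intros w Hw t. assert (Cw1 := c1_cont w t (Hw t)). assert (Cw3 := c3_cont w t (Hw t)). cont. }
  destruct (Hprim (fun t w => Y t w / (2 * (1 + N t)))) as [ph [P1 [P2 [P3 _]]]].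
  { intros w Hw t. destruct (Hc t) as [CA1 [CA2 [CB1 [CB2 _]]]]. specialize (HNc t). specialize (HN0 t).
    assert (Cw1 := c1_cont w t (Hw t)). assert (Cw3 := c3_cont w t (Hw t)).
    unfold Y, F, H. cont. lra. }
  assert (HdN : forall t, a < t < b -> ~ In t l -> is_derive N t (X t (u t))).
  { intros t Ht Hn. destruct (Hode t Ht Hn) as [_ [_ [D3 [D4 _]]]].
    eapply is_derive_eq; [apply (is_derive_sumsq B1 B2); eassumption|]. unfold X, F, H. real_eq. field. }
  set (phi := fun t => phi0 + ph t).
  assert (Hdphi : forall t, a < t < b -> ~ In t l -> is_derive phi t (Y t (u t) / (2 * (1 + N t)))).
  { intros t Ht Hn. eapply is_derive_eq; [apply (is_derive_plus (fun _ => phi0)); [apply @is_derive_const|exact (P3 t Ht Hn)]|].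
    apply Rplus_0_l. }
  set (psi := fun t => phi t - v t / 2).
  set (m := fun t => sqrt (1 + N t)).
  assert (Hm0 : forall t, 0 < m t) by (intros t; apply sqrt_lt_R0; specialize (HN0 t); lra).
  assert (Hm2 : forall t, m t ^ 2 = 1 + N t) by (intros t; apply pow2_sqrt; specialize (HN0 t); lra).
  assert (Hcont : forall t, continuous (fun t => cos (psi t)) t /\ continuous (fun t => sin (psi t)) t /\
    continuous (fun t => / m t) t).
  { intros t. destruct (Hc t) as [_ [_ [_ [_ C5]]]]. specialize (P1 t). specialize (HNc t). specialize (Hm0 t).
    assert (Hcpsi : continuous psi t) by (unfold psi, phi; cont; lra).
    split; [cont|split; [cont|]]. unfold m in *. cont. lra. }
  (* [A e^{- i psi}] has a constant direction: its logarithmic derivative is that of [|A|].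
     The pair [P, Q] stands for [A1, A2] and for [A2, - A1]. *)
  assert (Hdir : forall P Q f h : R -> R,
    (forall t, continuous P t /\ continuous Q t) ->
    (forall t, a <= t <= b -> P t ^ 2 + Q t ^ 2 = 1 + N t) ->
    (forall t, a < t < b -> ~ In t l ->
       is_derive P t ((Q t * c2 (u t) + f t) / 2) /\ is_derive Q t ((- (P t * c2 (u t)) + h t) / 2) /\
       X t (u t) = f t * P t + h t * Q t /\ Y t (u t) = h t * P t - f t * Q t) ->
    (P b * cos (psi b) + Q b * sin (psi b)) * / m b = (P a * cos (psi a) + Q a * sin (psi a)) * / m a).
  { intros P Q f h CPQ En DPQ.
    apply (constant_off_list l (fun t => (P t * cos (psi t) + Q t * sin (psi t)) * / m t) a b Hab).
    - intros t _. destruct (CPQ t) as [CP CQ]. destruct (Hcont t) as [K1 [K2 K3]]. cont.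
    - intros t Ht Hn. destruct (DPQ t Ht Hn) as [D1 [D2 [EX EY]]]. destruct (Hode t Ht Hn) as [_ [_ [_ [_ D5]]]].
      specialize (Hm0 t). specialize (Hm2 t). specialize (En t ltac:(lra)). rewrite <- Hm2 in En.
      assert (D6 : is_derive psi t (Y t (u t) / (2 * m t ^ 2) - c2 (u t) / 2)).
      { rewrite Hm2. apply (is_derive_minus phi (fun t => v t / 2)); [now apply Hdphi|].
        apply (is_derive_ext (fun t => / 2 * v t)); [intros; apply Rmult_comm|].
        eapply is_derive_eq; [exact (is_derive_scal v t (/ 2) _ D5)|]. apply Rmult_comm. }
      assert (D7 : is_derive (fun t => / m t) t (- (X t (u t) / (2 * m t ^ 3)))).
      { eapply is_derive_eq; [apply (is_derive_inv m)|].
        - apply (is_derive_comp sqrt (fun t => 1 + N t) t (/ (2 * m t))).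
          + apply is_derive_Reals, derivable_pt_lim_sqrt. specialize (HN0 t). lra.
          + apply (is_derive_plus (fun _ => 1)); [apply @is_derive_const|exact (HdN t Ht Hn)].
        - lra.
        - unfold scal, plus, zero; simpl. unfold mult; simpl. real_eq. field. lra. }
      pose (r := fun t => / m t). assert (Er : r t = / m t) by easy.
      apply (is_derive_ext (fun t => (P t * cos (psi t) + Q t * sin (psi t)) * r t)); [easy|].
      change (is_derive r t (- (X t (u t) / (2 * m t ^ 3)))) in D7. clearbody r.
      auto_derive; [repeat split; try (eexists; eassumption)|].
      rewrite_Derive D1; rewrite_Derive D2; rewrite_Derive D6; rewrite_Derive D7. rewrite Er, EX, EY. real_eq.
      transitivity ((m t ^ 2 - (P t ^ 2 + Q t ^ 2)) * (cos (psi t) * f t + sin (psi t) * h t) / (2 * m t ^ 3));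
        [field; lra|]. rewrite En. field. lra. }
  assert (HE : forall t, a <= t <= b -> A1 t ^ 2 + A2 t ^ 2 = 1 + N t) by (intros t Ht; exact (proj2 (He t Ht))).
  assert (H1 := Hdir A1 A2 (fun t => F t (u t)) (fun t => H t (u t))).
  assert (H2 := Hdir A2 (fun t => - A1 t) (fun t => H t (u t)) (fun t => - F t (u t))).
  cbv beta in H1, H2.
  assert (Hpsia : psi a = phi0 - v a / 2) by (unfold psi, phi; rewrite P2; ring).
  assert (E := sin2_cos2 (psi a)). unfold Rsqr in E. rewrite <- Hpsia in Hp1, Hp2.
  change (modA (B1 a) (B2 a)) with (m a) in Hp1, Hp2.
  assert (Hma := Hm0 a). assert (Hmb := Hm0 b).
  exists l, N, phi, s. split; [|split; [|split; [|split; [|split; [|split]]]]].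
  - split; [easy|split].
    + intros t _. split; [apply HN0|split; [apply HNc|split; [|apply S1]]].
      specialize (P1 t). unfold phi. cont.
    + intros t Ht Hn. exists (X t (u t)), (Y t (u t)), (sqrt (c1 (u t) ^ 2 + c3 (u t) ^ 2)).
      split; [now apply HdN|split; [now apply Hdphi|split; [now apply S3|split; [apply sqrt_pos|]]]].
      rewrite pow2_sqrt by nra. rewrite <- (HE t) by lra. right. unfold X, Y, F, H, N. ring.
  - easy.
  - easy.
  - unfold phi; rewrite P2; ring.
  - easy.
  - unfold has_arg. change (phi b - v b / 2) with (psi b). change (modA (B1 b) (B2 b)) with (m b).
    apply rotate_back.
    + apply Rmult_eq_reg_r with (/ m b); [|apply Rinv_neq_0_compat; lra]. rewrite H1.
      * rewrite Hp1, Hp2. transitivity 1; [rewrite <- E|]; field; lra.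
      * intros t. split; apply (Hc t).
      * exact HE.
      * intros t Ht Hn. destruct (Hode t Ht Hn) as [D1 [D2 _]].
        split; [eapply is_derive_eq; [exact D1|unfold F; real_eq; field]|].
        split; [eapply is_derive_eq; [exact D2|unfold H; real_eq; field]|easy].
    + apply Rmult_eq_reg_r with (/ m b); [|apply Rinv_neq_0_compat; lra].
      replace ((A2 b * cos (psi b) - A1 b * sin (psi b)) * / m b)
        with ((A2 b * cos (psi b) + - A1 b * sin (psi b)) * / m b) by ring. rewrite H2.
      * rewrite Hp1, Hp2. field. lra.
      * intros t. destruct (Hc t) as [K1 [K2 _]]. split; [easy|cont].
      * intros t Ht. rewrite <- (HE t Ht). ring.
      * intros t Ht Hn. destruct (Hode t Ht Hn) as [D1 [D2 _]].
        split; [eapply is_derive_eq; [exact D2|unfold H; real_eq; field]|].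
        split; [eapply is_derive_eq; [exact (is_derive_opp A1 t _ D1)|unfold opp, F; simpl; real_eq; field]|].
        unfold X, Y. split; ring.
  - rewrite (is_RInt_unique _ _ _ _ L4). apply sqrt_sumsq_le.
    + intros x y Hx Hxy.
      enough (x * s b + y * v b - ell b <= x * s a + y * v a - ell a) by (rewrite S2, L2 in *; lra).
      apply (nonincreasing_off_list l (fun t => x * s t + y * v t - ell t)); [easy| |].
      * intros t _. specialize (S1 t). specialize (L1 t). destruct (Hc t) as [_ [_ [_ [_ C5]]]]. cont.
      * intros t Ht Hn. destruct (Hode t Ht Hn) as [_ [_ [_ [_ D5]]]].
        exists (x * sqrt (c1 (u t) ^ 2 + c3 (u t) ^ 2) + y * c2 (u t) - frame_norm (u t)). split.
        -- apply (is_derive_minus (fun t => x * s t + y * v t)); [|exact (L3 t Ht Hn)].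
           apply (is_derive_plus (fun t => x * s t)).
           ++ exact (is_derive_scal s t x _ (S3 t Ht Hn)).
           ++ exact (is_derive_scal v t y _ D5).
        -- rewrite frame_norm_c.
           assert (Hq := cauchy_2 x y (sqrt (c1 (u t) ^ 2 + c3 (u t) ^ 2)) (c2 (u t))
             (sqrt (c1 (u t) ^ 2 + c2 (u t) ^ 2 + c3 (u t) ^ 2)) 1 (sqrt_pos _) Rle_0_1).
           rewrite !pow2_sqrt in Hq by nra. specialize (Hq ltac:(lra) ltac:(lra)). lra.
    + rewrite <- S2. apply Ropp_le_cancel.
      apply (nonincreasing_off_list l (fun t => - s t)); [easy| |].
      * intros t _. specialize (S1 t). cont.
      * intros t Ht Hn. exists (- sqrt (c1 (u t) ^ 2 + c3 (u t) ^ 2)). split.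
        -- exact (is_derive_opp s t _ (S3 t Ht Hn)).
        -- assert (G := sqrt_pos (c1 (u t) ^ 2 + c3 (u t) ^ 2)). lra.
Qed.

Lemma continuous_pair3 (x1 x2 x3 : R -> R) t : continuous x1 t -> continuous x2 t -> continuous x3 t ->
  continuous (fun t => (x1 t, x2 t, x3 t) : R * R * R) t.
Proof.
  intros H1 H2 H3.
  assert (Hp : forall (V W : UniformSpace) (f : R -> V) (g : R -> W), continuous f t -> continuous g t ->
     continuous (fun t => (f t, g t) : V * W) t).
  { intros V W f g Hf Hg. apply (continuous_comp_2 f g (fun x y => (x, y)) t Hf Hg).
    apply (continuous_ext (fun z : V * W => z)); [now intros [y z]|]. apply continuous_id. }
  apply Hp; [|easy]. now apply Hp.
Qed.

Record smooth_curve (A1 A2 B1 B2 v x1 x2 x3 : R -> R) : Prop := {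
  sc_ode : forall t, coord_ode A1 A2 B1 B2 v t (x1 t) (x2 t) (x3 t);
  sc_norm : forall t, A1 t ^ 2 + A2 t ^ 2 = 1 + (B1 t ^ 2 + B2 t ^ 2);
  sc_cont : forall t, continuous x1 t /\ continuous x2 t /\ continuous x3 t }.

Definition curve_of (A1 A2 B1 B2 v : R -> R) (t : R) : M3 := elt (A1 t) (A2 t) (B1 t) (B2 t) (v t).

Lemma smooth_curve_in A1 A2 B1 B2 v x1 x2 x3 a b : smooth_curve A1 A2 B1 B2 v x1 x2 x3 -> a <= b ->
  curve_in_SU11R (curve_of A1 A2 B1 B2 v) a b.
Proof.
  intros [Ho Hn Hc] Hab. split; [easy|split].
  - intros t _. apply in_SU11R_elt. exists (A1 t), (A2 t), (B1 t), (B2 t), (v t). split; [easy|apply Hn].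
  - intros i j Hi Hj. apply continuous_on_forall. intros t _.
    apply (ex_derive_continuous (V := C_R_NormedModule) (fun t => entry (curve_of A1 A2 B1 B2 v t) i j)).
    eexists. exact (entries_of_coord_ode A1 A2 B1 B2 v t _ _ _ i j Hi Hj (Ho t)).
Qed.

Lemma smooth_horizontal A1 A2 B1 B2 v x1 x2 x3 a b : smooth_curve A1 A2 B1 B2 v x1 x2 x3 -> a <= b ->
  horizontal_curve (curve_of A1 A2 B1 B2 v) (fun t => (x1 t, x2 t, x3 t)) a b.
Proof.
  intros H Hab. split; [now apply (smooth_curve_in _ _ _ _ _ x1 x2 x3)|].
  destruct H as [Ho Hn Hc].
  destruct (Req_dec a b) as [->|Hne].
  - exists 0%nat, (fun _ => b). split; [easy|split; [easy|intros; lia]].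
  - exists 1%nat, (fun k => match k with O => a | _ => b end). split; [easy|split; [easy|]].
    intros k Hk. assert (k = 0%nat) as -> by lia. split; [lra|].
    exists (fun t => (x1 t, x2 t, x3 t)). split.
    + intros t. apply continuous_pair3; apply Hc.
    + intros t _. split; [easy|]. intros i j Hi Hj. now apply entries_of_coord_ode.
Qed.

(** Left translation by the element with coordinates [p1, p2, q1, q2, v0]. *)
Lemma smooth_translate p1 p2 q1 q2 v0 A1 A2 B1 B2 v x1 x2 x3 :
  p1 ^ 2 + p2 ^ 2 = 1 + (q1 ^ 2 + q2 ^ 2) ->
  smooth_curve A1 A2 B1 B2 v x1 x2 x3 ->
  smooth_curve (fun t => p1 * A1 t - p2 * A2 t + (q1 * B1 t + q2 * B2 t))
    (fun t => p1 * A2 t + p2 * A1 t + (q2 * B1 t - q1 * B2 t))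
    (fun t => p1 * B1 t - p2 * B2 t + (q1 * A1 t + q2 * A2 t))
    (fun t => p1 * B2 t + p2 * B1 t + (q2 * A1 t - q1 * A2 t))
    (fun t => v0 + v t) x1 x2 x3.
Proof.
  intros Hp [Ho Hn Hc]. split; [| |exact Hc].
  - intros t. destruct (Ho t) as [D1 [D2 [D3 [D4 D5]]]].
    assert (E1 : ex_derive A1 t) by (eexists; exact D1). assert (E2 : ex_derive A2 t) by (eexists; exact D2).
    assert (E3 : ex_derive B1 t) by (eexists; exact D3). assert (E4 : ex_derive B2 t) by (eexists; exact D4).
    assert (E5 : ex_derive v t) by (eexists; exact D5).
    split; [|split; [|split; [|split]]]; (auto_derive; [repeat split; assumption|]).
    + rewrite_Derive D1; rewrite_Derive D2; rewrite_Derive D3; rewrite_Derive D4. field.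
    + rewrite_Derive D1; rewrite_Derive D2; rewrite_Derive D3; rewrite_Derive D4. field.
    + rewrite_Derive D1; rewrite_Derive D2; rewrite_Derive D3; rewrite_Derive D4. field.
    + rewrite_Derive D1; rewrite_Derive D2; rewrite_Derive D3; rewrite_Derive D4. field.
    + rewrite_Derive D5. ring.
  - intros t. specialize (Hn t).
    apply Rminus_diag_uniq.
    match goal with |- ?u = 0 => replace u with
      ((p1 ^ 2 + p2 ^ 2 - (q1 ^ 2 + q2 ^ 2)) * (A1 t ^ 2 + A2 t ^ 2 - (B1 t ^ 2 + B2 t ^ 2)) - 1) by ring end.
    rewrite Hp, Hn. ring.
Qed.

(** * The sub-Riemannian geodesics *)

(** The geodesic of momentum [2 kap], where [kap] is [k] or [- k], with initial
    direction [be], speed [xi] in SU(1,1) and speed [eta] in the direction of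
    [v]: [A = (gC - i kap gB) e^(i gchi)], [B = gB e^(i (be - gchi))]. *)
Definition gchi (kap xi eta t : R) : R := (kap * xi - eta) * t / 2.
Definition gA1 k kap xi eta t :=
  gC k (xi * t) * cos (gchi kap xi eta t) + kap * gB k (xi * t) * sin (gchi kap xi eta t).
Definition gA2 k kap xi eta t :=
  gC k (xi * t) * sin (gchi kap xi eta t) - kap * gB k (xi * t) * cos (gchi kap xi eta t).
Definition gB1 k kap be xi eta t := gB k (xi * t) * cos (be - gchi kap xi eta t).
Definition gB2 k kap be xi eta t := gB k (xi * t) * sin (be - gchi kap xi eta t).

(** A control that rotates uniformly: only the second order linear equation of
    [gB] and [gC] is used, so the three types of curves are treated alike. *)
Lemma coord_ode_rotating (b c x v : R -> R) kap be xi eta t :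
  is_derive b t (xi * (c t / 2)) -> is_derive c t (xi * (- (kap ^ 2 - 1) / 2 * b t)) ->
  is_derive x t ((kap * xi - eta) / 2) -> is_derive v t eta ->
  coord_ode (fun t => c t * cos (x t) + kap * b t * sin (x t)) (fun t => c t * sin (x t) - kap * b t * cos (x t))
    (fun t => b t * cos (be - x t)) (fun t => b t * sin (be - x t)) v t
    (xi * cos (be - 2 * x t)) eta (xi * sin (be - 2 * x t)).
Proof.
  intros DB DC DX DV.
  assert (Eb : ex_derive b t) by (eexists; exact DB). assert (Ec : ex_derive c t) by (eexists; exact DC).
  assert (Ex : ex_derive x t) by (eexists; exact DX).
  set (y := be - x t). set (z := be - 2 * x t).
  assert (F1 : cos y * cos z + sin y * sin z = cos (x t)) by (rewrite <- cos_minus; f_equal; unfold y, z; ring).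
  assert (F2 : sin y * cos z - cos y * sin z = sin (x t)) by (rewrite <- sin_minus; f_equal; unfold y, z; ring).
  assert (F3 : cos (x t) * cos z - sin (x t) * sin z = cos y) by (rewrite <- cos_plus; f_equal; unfold y, z; ring).
  assert (F4 : sin (x t) * cos z + cos (x t) * sin z = sin y) by (rewrite <- sin_plus; f_equal; unfold y, z; ring).
  split; [|split; [|split; [|split; [|exact DV]]]];
    (auto_derive; [repeat split; assumption|]); rewrite_Derive DB; rewrite_Derive DC; rewrite_Derive DX;
    try change (be + - x t) with y; try change (be - x t) with y.
  - transitivity ((eta * (c t * sin (x t) - kap * b t * cos (x t)) + b t * xi * cos (x t)) / 2); [field|].
    rewrite <- F1 at 2. field.
  - transitivity ((- (eta * (c t * cos (x t) + kap * b t * sin (x t))) + b t * xi * sin (x t)) / 2); [field|].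
    rewrite <- F2 at 2. field.
  - transitivity ((xi * (c t * cos y + kap * b t * sin y) - eta * b t * sin y) / 2); [field|].
    rewrite <- F3 at 1. rewrite <- F4 at 1. field.
  - transitivity ((xi * (c t * sin y - kap * b t * cos y) + eta * b t * cos y) / 2); [field|].
    rewrite <- F4 at 1. rewrite <- F3 at 1. field.
Qed.

Lemma geodesic_smooth k kap be xi eta : kap ^ 2 = k ^ 2 ->
  smooth_curve (gA1 k kap xi eta) (gA2 k kap xi eta) (gB1 k kap be xi eta) (gB2 k kap be xi eta)
    (fun t => eta * t)
    (fun t => xi * cos (be - 2 * gchi kap xi eta t)) (fun _ => eta)
    (fun t => xi * sin (be - 2 * gchi kap xi eta t)).
Proof.
  intros Hk. split.
  - intros t. apply (coord_ode_rotating (fun t => gB k (xi * t)) (fun t => gC k (xi * t))).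
    + apply is_derive_scaled, gB_derive.
    + rewrite Hk. apply is_derive_scaled, gC_derive.
    + unfold gchi. auto_derive; [easy|field].
    + auto_derive; [easy|ring].
  - intros t. unfold gA1, gA2, gB1, gB2.
    set (x := gchi kap xi eta t). set (y := be - x).
    assert (E1 := sin2_cos2 x). assert (E2 := sin2_cos2 y). unfold Rsqr in E1, E2.
    assert (HC := gC_gB k (xi * t)).
    set (b := gB k (xi * t)) in *. set (c := gC k (xi * t)) in *.
    transitivity ((c ^ 2 + kap ^ 2 * b ^ 2) * (sin x * sin x + cos x * cos x)); [ring|].
    transitivity (1 + b ^ 2 * (sin y * sin y + cos y * cos y)); [|ring].
    rewrite E1, E2, HC, Hk. ring.
  - intros t. assert (Hx : continuous (gchi kap xi eta) t) by (unfold gchi; cont; lra).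
    split; [cont|split; cont].
Qed.

(** The phase [gchi] and the argument [- sg gth] of [gC - i kap gB] add up to
    [sg gphi - v / 2]. *)
Lemma geodesic_arg k sg xi eta t : sg = 1 \/ sg = -1 ->
  gA1 k (sg * k) xi eta t = sqrt (1 + gB k (xi * t) ^ 2) * cos (sg * gphi k (xi * t) - eta * t / 2) /\
  gA2 k (sg * k) xi eta t = sqrt (1 + gB k (xi * t) ^ 2) * sin (sg * gphi k (xi * t) - eta * t / 2).
Proof.
  intros Hsg. destruct (gth_direction k (xi * t)) as [H1 H2].
  unfold gA1, gA2. set (a := sqrt (1 + gB k (xi * t) ^ 2)) in *.
  set (x := gchi (sg * k) xi eta t). set (th := gth k (xi * t)) in *.
  assert (E : sg * gphi k (xi * t) - eta * t / 2 = x - sg * th).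
  { unfold x, gchi, th, gth. field. }
  assert (E3 : sg * k * gB k (xi * t) = sg * (a * sin th)) by (rewrite H2; ring).
  rewrite E, cos_minus, sin_minus, E3, <- H1.
  destruct Hsg as [-> | ->].
  - replace (1 * th) with th by ring. split; ring.
  - replace (-1 * th) with (- th) by ring. rewrite cos_neg, sin_neg. split; ring.
Qed.

(** * The distance as an infimum *)

Definition joined (g h : M3) (L : R) : Prop :=
  exists gam u a b, horizontal_curve gam u a b /\ gam a = g /\ gam b = h /\
    L = RInt (fun t => frame_norm (u t)) a b.

Lemma joined_in g h L : joined g h L -> in_SU11R g /\ in_SU11R h /\ 0 <= L.
Proof.
  intros [gam [u [a [b [H [<- [<- ->]]]]]]].
  assert (Hab : a <= b) by apply H.
  assert (Ha : in_SU11R (gam a)) by (apply (proj1 H); lra).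
  assert (Hb : in_SU11R (gam b)) by (apply (proj1 H); lra).
  split; [easy|split; [easy|]].
  apply in_SU11R_elt in Ha. destruct Ha as [p1 [p2 [q1 [q2 [v [Ea Hn]]]]]].
  apply in_SU11R_elt in Hb. destruct Hb as [p1' [p2' [q1' [q2' [v' [Eb _]]]]]].
  destruct (arg_exists p1 p2 q1 q2 v 0 Hn) as [th [sg [_ [_ Harg]]]].
  destruct (reduction gam u a b _ _ _ _ _ _ _ _ _ _ _ H Ea Eb Harg) as [l [N [phi [s [_ [_ [_ [_ [_ [_ HL]]]]]]]]]].
  apply Rle_trans with (2 := HL), sqrt_pos.
Qed.

Lemma d1_le g h L : joined g h L -> d1 g h <= L.
Proof.
  intros H. unfold d1. fold (joined g h).
  change (real (Glb_Rbar (joined g h)) <= L).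
  destruct (Glb_Rbar_correct (joined g h)) as [H1 H2].
  assert (H3 : Rbar_le 0 (Glb_Rbar (joined g h))).
  { apply H2. intros l Hl. apply (joined_in _ _ _ Hl). }
  specialize (H1 L H). destruct (Glb_Rbar (joined g h)); simpl in *; easy.
Qed.

Lemma d1_ge g h m : (exists L, joined g h L) -> (forall L, joined g h L -> m <= L) -> m <= d1 g h.
Proof.
  intros [L HL] Hm. change (m <= real (Glb_Rbar (joined g h))).
  destruct (Glb_Rbar_correct (joined g h)) as [H1 H2].
  assert (H3 : Rbar_le m (Glb_Rbar (joined g h))) by (apply H2; intros l Hl; now apply Hm).
  specialize (H1 L HL). destruct (Glb_Rbar (joined g h)); simpl in *; easy.
Qed.

Lemma smooth_joined A1 A2 B1 B2 v x1 x2 x3 a b rho : smooth_curve A1 A2 B1 B2 v x1 x2 x3 -> a <= b ->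
  (forall t, x1 t ^ 2 + x2 t ^ 2 + x3 t ^ 2 = rho ^ 2) -> 0 <= rho ->
  joined (curve_of A1 A2 B1 B2 v a) (curve_of A1 A2 B1 B2 v b) (rho * (b - a)).
Proof.
  intros H Hab Hr Hr0. exists (curve_of A1 A2 B1 B2 v), (fun t => (x1 t, x2 t, x3 t)), a, b.
  split; [now apply smooth_horizontal|split; [easy|split; [easy|]]].
  rewrite (RInt_ext _ (fun _ => rho)).
  - rewrite RInt_const. change (scal ?x ?y) with (x * y). unfold scal; simpl; unfold mult; simpl. ring.
  - intros t _. unfold frame_norm. rewrite Hr. now apply sqrt_pow2.
Qed.

(** * Curves between given points *)

Definition rad (B1 B2 : R) : R := sqrt (B1 ^ 2 + B2 ^ 2).
Lemma rad_nonneg B1 B2 : 0 <= rad B1 B2.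
Proof. apply sqrt_pos. Qed.
Lemma rad_sq B1 B2 : rad B1 B2 ^ 2 = B1 ^ 2 + B2 ^ 2.
Proof. apply pow2_sqrt. nra. Qed.
Lemma rad_0 B1 B2 : rad B1 B2 = 0 -> B1 = 0 /\ B2 = 0.
Proof. intros H. assert (E := rad_sq B1 B2). rewrite H in E. split; nra. Qed.

Definition geodesic k sg be xi eta : R -> M3 :=
  curve_of (gA1 k (sg * k) xi eta) (gA2 k (sg * k) xi eta)
    (gB1 k (sg * k) be xi eta) (gB2 k (sg * k) be xi eta) (fun t => eta * t).

Lemma geodesic_sc k sg be xi eta : sg = 1 \/ sg = -1 ->
  smooth_curve (gA1 k (sg * k) xi eta) (gA2 k (sg * k) xi eta)
    (gB1 k (sg * k) be xi eta) (gB2 k (sg * k) be xi eta) (fun t => eta * t)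
    (fun t => xi * cos (be - 2 * gchi (sg * k) xi eta t)) (fun _ => eta)
    (fun t => xi * sin (be - 2 * gchi (sg * k) xi eta t)).
Proof. intros Hsg. apply geodesic_smooth. destruct Hsg as [-> | ->]; ring. Qed.

Lemma geodesic_speed xi eta x : (xi * cos x) ^ 2 + eta ^ 2 + (xi * sin x) ^ 2 = sqrt (xi ^ 2 + eta ^ 2) ^ 2.
Proof.
  rewrite pow2_sqrt by nra. assert (E := sin2_cos2 x). unfold Rsqr in E.
  transitivity (xi ^ 2 * (sin x * sin x + cos x * cos x) + eta ^ 2); [ring|rewrite E; ring].
Qed.

Lemma geodesic_0 k sg be xi eta : geodesic k sg be xi eta 0 = mat_Id.
Proof.
  rewrite <- elt_Id. unfold geodesic, curve_of, gA1, gA2, gB1, gB2, gchi.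
  replace ((sg * k * xi - eta) * 0 / 2) with 0 by field. rewrite !Rmult_0_r, gC_0, gB_0, cos_0, sin_0.
  f_equal; ring.
Qed.

Lemma geodesic_joined k sg be xi eta s t : sg = 1 \/ sg = -1 -> s <= t ->
  joined (geodesic k sg be xi eta s) (geodesic k sg be xi eta t) (sqrt (xi ^ 2 + eta ^ 2) * (t - s)).
Proof.
  intros Hsg Hst. eapply smooth_joined; [now apply geodesic_sc|easy| |apply sqrt_pos].
  intros r. apply geodesic_speed.
Qed.

Lemma geodesic_rad k sg be xi eta t :
  gB1 k (sg * k) be xi eta t ^ 2 + gB2 k (sg * k) be xi eta t ^ 2 = gB k (xi * t) ^ 2.
Proof.
  unfold gB1, gB2. set (y := be - gchi (sg * k) xi eta t). assert (E := sin2_cos2 y). unfold Rsqr in E.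
  transitivity (gB k (xi * t) ^ 2 * (sin y * sin y + cos y * cos y)); [ring|rewrite E; ring].
Qed.

Lemma geodesic_has_arg k sg be xi eta t : sg = 1 \/ sg = -1 ->
  has_arg (gA1 k (sg * k) xi eta t) (gA2 k (sg * k) xi eta t) (gB1 k (sg * k) be xi eta t)
    (gB2 k (sg * k) be xi eta t) (eta * t) (sg * gphi k (xi * t)).
Proof.
  intros Hsg. unfold has_arg, modA. rewrite geodesic_rad. now apply geodesic_arg.
Qed.

Lemma geodesic_through k T sg A1 A2 B1 B2 v : (sg = 1 \/ sg = -1) -> gB k T = rad B1 B2 ->
  has_arg A1 A2 B1 B2 v (sg * gphi k T) ->
  exists be, geodesic k sg be T v 1 = elt A1 A2 B1 B2 v.
Proof.
  intros Hsg HB [H1 H2].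
  destruct (polar B1 B2 (rad B1 B2) (rad_nonneg _ _) ltac:(now rewrite rad_sq)) as [th [s [_ [_ [E1 E2]]]]].
  exists (s * th + gchi (sg * k) T v 1). unfold geodesic, curve_of.
  assert (E3 : gB1 k (sg * k) (s * th + gchi (sg * k) T v 1) T v 1 = B1).
  { unfold gB1. rewrite Rmult_1_r, HB, E1 at 1. rewrite E1 at 2. f_equal; [|f_equal; ring].
    rewrite <- E1. easy. }
  assert (E4 : gB2 k (sg * k) (s * th + gchi (sg * k) T v 1) T v 1 = B2).
  { unfold gB2. rewrite Rmult_1_r, HB. rewrite E2 at 2. f_equal. f_equal; ring. }
  destruct (geodesic_has_arg k sg (s * th + gchi (sg * k) T v 1) T v 1 Hsg) as [G1 G2].
  rewrite E3, E4, !Rmult_1_r in G1, G2.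
  rewrite E3, E4, G1, G2, H1, H2, Rmult_1_r. reflexivity.
Qed.

Lemma geo_total b phi : 0 <= b -> 0 <= phi -> exists T, geo b phi T.
Proof.
  intros Hb Hphi. destruct (Req_dec b 0) as [->|Hb0].
  - destruct (Req_dec phi 0) as [->|Hp0].
    + exists 0, 0. split; [apply adm_open; lra|]. split; [apply gB_0|apply gphi_0].
    + exists (loop_length phi). apply loop_geo. lra.
  - destruct (geo_exists b phi ltac:(lra) Hphi) as [k [T [H1 [_ [H2 [H3 _]]]]]].
    exists T, k. auto.
Qed.

(** A geodesic from the unit to [g^-1 h], translated by [g]. *)
Lemma joined_exists g h : in_SU11R g -> in_SU11R h -> exists L, joined g h L.
Proof.
  intros Hg Hh. apply in_SU11R_elt in Hg. apply in_SU11R_elt in Hh.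
  destruct Hg as [p1 [p2 [q1 [q2 [v0 [-> Hg]]]]]]. destruct Hh as [A1 [A2 [B1 [B2 [v [-> Hh]]]]]].
  (* the group element [g^-1 h] *)
  set (R1 := p1 * A1 + p2 * A2 - (q1 * B1 + q2 * B2)). set (R2 := p1 * A2 - p2 * A1 - (q2 * B1 - q1 * B2)).
  set (S1 := p1 * B1 + p2 * B2 - (q1 * A1 + q2 * A2)). set (S2 := p1 * B2 - p2 * B1 - (q2 * A1 - q1 * A2)).
  assert (HR : R1 ^ 2 + R2 ^ 2 = 1 + (S1 ^ 2 + S2 ^ 2)).
  { apply Rminus_diag_uniq. unfold R1, R2, S1, S2.
    match goal with |- ?u = 0 => replace u with
      ((p1 ^ 2 + p2 ^ 2 - (q1 ^ 2 + q2 ^ 2)) * (A1 ^ 2 + A2 ^ 2 - (B1 ^ 2 + B2 ^ 2)) - 1) by ring end.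
    rewrite Hg, Hh. ring. }
  destruct (arg_exists R1 R2 S1 S2 (v - v0) 0 HR) as [th [sg [Hth [Hsg Harg]]]].
  destruct (geo_total (rad S1 S2) th (rad_nonneg _ _) (proj1 Hth)) as [T [k [Ha [HB HP]]]].
  destruct (geodesic_through k T sg R1 R2 S1 S2 (v - v0) Hsg HB) as [be Hbe].
  { rewrite HP. replace (sg * th) with (0 + sg * th) by ring. exact Harg. }
  assert (Hsc := smooth_translate p1 p2 q1 q2 v0 _ _ _ _ _ _ _ _ Hg (geodesic_sc k sg be T (v - v0) Hsg)).
  assert (HJ := smooth_joined _ _ _ _ _ _ _ _ 0 1 (sqrt (T ^ 2 + (v - v0) ^ 2)) Hsc Rle_0_1
     (fun t => geodesic_speed T (v - v0) _) (sqrt_pos _)).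
  unfold curve_of in HJ. assert (H0 := geodesic_0 k sg be T (v - v0)). rewrite <- elt_Id in H0.
  unfold geodesic, curve_of in H0, Hbe. apply elt_inj in H0. apply elt_inj in Hbe.
  destruct H0 as [-> [-> [-> [-> H0]]]] in HJ. destruct Hbe as [-> [-> [-> [-> Hbe]]]] in HJ.
  eexists. match type of HJ with joined ?x ?y ?L =>
    replace x with (elt p1 p2 q1 q2 v0) in HJ by (f_equal; ring);
    replace y with (elt A1 A2 B1 B2 v) in HJ end.
  - exact HJ.
  - assert (Hgm : forall z, (p1 ^ 2 + p2 ^ 2 - (q1 ^ 2 + q2 ^ 2)) * z = z) by (intros z; rewrite Hg; ring).
    f_equal.
    + rewrite <- (Hgm A1). unfold R1, R2, S1, S2. ring.
    + rewrite <- (Hgm A2). unfold R1, R2, S1, S2. ring.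
    + rewrite <- (Hgm B1). unfold R1, R2, S1, S2. ring.
    + rewrite <- (Hgm B2). unfold R1, R2, S1, S2. ring.
    + ring.
Qed.

(** * Concatenation and the triangle inequality *)

Definition glue {X : Type} (f g : R -> X) (b t : R) : X := if Rle_dec t b then f t else g t.

Lemma glue_l {X} (f g : R -> X) b t : t <= b -> glue f g b t = f t.
Proof. intros H. unfold glue. now destruct (Rle_dec t b). Qed.
Lemma glue_r {X} (f g : R -> X) b t : f b = g b -> b <= t -> glue f g b t = g t.
Proof.
  intros E H. unfold glue. destruct (Rle_dec t b); [|easy]. replace t with b by lra. exact E.
Qed.

Lemma glue_continuous_on {U : UniformSpace} (f g : R -> U) a b c : f b = g b ->
  continuous_on (fun t => a <= t <= b) f -> continuous_on (fun t => b <= t <= c) g ->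
  a <= b -> b <= c -> continuous_on (fun t => a <= t <= c) (glue f g b).
Proof.
  intros E Hf Hg Hab Hbc x Hx P HP. cbv beta in Hx.
  assert (HF : x <= b -> locally x (fun y => a <= y <= b -> P (f y))).
  { intros Hxb. rewrite glue_l in HP by easy. exact (Hf x ltac:(lra) P HP). }
  assert (HG : b <= x -> locally x (fun y => b <= y <= c -> P (g y))).
  { intros Hxb. rewrite (glue_r f g b x E) in HP by easy. exact (Hg x ltac:(lra) P HP). }
  unfold filtermap, within.
  destruct (Rtotal_order x b) as [h|[h|h]].
  - assert (H1 := HF ltac:(lra)).
    assert (H2 : locally x (fun y => y < b)) by (apply (locally_interval (x - 1) b); [lra|intros; lra]).
    generalize (filter_and _ _ H1 H2). apply filter_imp. intros y [K1 K2] Hy.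
    rewrite glue_l by lra. apply K1. lra.
  - generalize (filter_and _ _ (HF (Req_le x b h)) (HG (Req_le b x (eq_sym h)))). apply filter_imp. intros y [K1 K2] Hy.
    destruct (Rle_dec y b).
    + rewrite glue_l by lra. apply K1. lra.
    + rewrite (glue_r f g b y E) by lra. apply K2. lra.
  - assert (H1 := HG ltac:(lra)).
    assert (H2 : locally x (fun y => b < y)) by (apply (locally_interval b (x + 1)); [lra|intros; lra]).
    generalize (filter_and _ _ H1 H2). apply filter_imp. intros y [K1 K2] Hy.
    rewrite (glue_r f g b y E) by lra. apply K1. lra.
Qed.

Lemma continuous_on_shift {U : UniformSpace} (f : R -> U) a b d :
  continuous_on (fun t => a <= t <= b) f -> continuous_on (fun t => a - d <= t <= b - d) (fun t => f (t + d)).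
Proof.
  intros H x Hx P HP. cbv beta in Hx.
  assert (H1 := H (x + d) ltac:(lra) P HP). unfold filtermap, within in *.
  assert (Hc : continuous (fun t => t + d) x) by cont.
  generalize (Hc _ H1). unfold filtermap. apply filter_imp. intros y Hy Hy2. apply Hy. lra.
Qed.

Lemma glue_curve gam del a b c : gam b = del b ->
  curve_in_SU11R gam a b -> curve_in_SU11R del b c -> curve_in_SU11R (glue gam del b) a c.
Proof.
  intros E [Hab [Hi1 Hc1]] [Hbc [Hi2 Hc2]]. split; [lra|split].
  - intros t Ht. unfold glue. destruct (Rle_dec t b); [apply Hi1|apply Hi2]; lra.
  - intros i j Hi Hj.
    apply continuous_on_ext with (glue (fun t => entry (gam t) i j) (fun t => entry (del t) i j) b).
    + intros t _. unfold glue. now destruct (Rle_dec t b).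
    + apply (glue_continuous_on (U := C_UniformSpace)); [now rewrite E|now apply Hc1|now apply Hc2|easy|easy].
Qed.

Lemma horizontal_is_RInt gam u a b : horizontal_curve gam u a b ->
  is_RInt (fun t => frame_norm (u t)) a b (RInt (fun t => frame_norm (u t)) a b).
Proof.
  intros H. destruct (horizontal_coords gam u a b H) as [_ [A1 [A2 [B1 [B2 [v [l [_ [_ [_ Hp]]]]]]]]]].
  destruct (Hp (fun _ w => frame_norm w) frame_norm_cont) as [G [_ [_ [_ HG]]]].
  now rewrite (is_RInt_unique _ _ _ _ HG).
Qed.

Lemma horizontal_shift gam u a b d : horizontal_curve gam u a b ->
  horizontal_curve (fun t => gam (t + d)) (fun t => u (t + d)) (a - d) (b - d).
Proof.
  intros [[Hab [Hin Hc]] [n [p [Hp0 [Hpn Hp]]]]]. split; [split; [lra|split]|].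
  - intros t Ht. apply Hin. lra.
  - intros i j Hi Hj. now apply (continuous_on_shift (U := C_UniformSpace) (fun t => entry (gam t) i j)), Hc.
  - exists n, (fun k => p k - d). split; [now rewrite Hp0|split; [now rewrite Hpn|]].
    intros k Hk. destruct (Hp k Hk) as [Hlt [w [Hw1 Hw2]]]. split; [lra|].
    exists (fun t => w (t + d)). split.
    + intros t. apply (continuous_comp (fun t => t + d) w); [cont|apply Hw1].
    + intros t Ht. destruct (Hw2 (t + d) ltac:(lra)) as [E Hd]. split; [easy|].
      intros i j Hi Hj.
      assert (D := is_derive_comp (V := C_R_NormedModule) (fun s => entry (gam s) i j) (fun s => s + d) t _ 1 (Hd i j Hi Hj)).
      rewrite (scal_one (V := C_R_NormedModule)) in D. apply D. auto_derive; [easy|reflexivity].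
Qed.

Lemma horizontal_glue gam1 u1 gam2 u2 a b c : gam1 b = gam2 b ->
  horizontal_curve gam1 u1 a b -> horizontal_curve gam2 u2 b c ->
  horizontal_curve (glue gam1 gam2 b) (glue u1 u2 b) a c.
Proof.
  intros E H1 H2. split; [apply glue_curve; [easy|apply H1|apply H2]|].
  destruct H1 as [_ [n [p [Hp0 [Hpn Hp]]]]]. destruct H2 as [_ [m [q [Hq0 [Hqm Hq]]]]].
  exists (n + m)%nat, (fun k => if le_lt_dec k n then p k else q (k - n)%nat).
  split; [now destruct (le_lt_dec 0 n)|].
  split. { destruct (le_lt_dec (n + m) n).
    - assert (m = 0%nat) by lia. subst m. rewrite Nat.add_0_r, Hpn, <- Hqm. now rewrite Hq0.
    - replace (n + m - n)%nat with m by lia. easy. }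
  intros k Hk. destruct (le_lt_dec k n) as [hk|hk], (le_lt_dec (S k) n) as [hk'|hk']; try lia.
  - destruct (Hp k ltac:(lia)) as [Hlt [w [Hw1 Hw2]]]. split; [easy|]. exists w. split; [easy|].
    intros t Ht.
    assert (Hpb : p (S k) <= b).
    { rewrite <- Hpn. apply (partition_le p n); [|lia]. intros j Hj; apply Hp; lia. }
    rewrite !glue_l by lra. destruct (Hw2 t Ht) as [Eu Hd]. split; [easy|]. intros i j Hi Hj.
    apply (is_derive_ext_loc (V := C_R_NormedModule) (fun s => entry (gam1 s) i j)); [|now apply Hd].
    apply (locally_interval (p k) (p (S k))); [easy|]. intros s Hs. now rewrite glue_l by lra.
  - assert (k = n) by lia. subst k. replace (S n - n)%nat with 1%nat by lia.
    destruct (Hq 0%nat ltac:(lia)) as [Hlt [w [Hw1 Hw2]]]. replace (p n) with (q 0%nat) by congruence. split; [easy|]. exists w. split; [easy|].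
    intros t Ht. rewrite Hq0 in Ht.
    assert (Eg : forall (X : Type) (f g : R -> X) s, b < s -> glue f g b s = g s).
    { intros X f g s Hs. unfold glue. destruct (Rle_dec s b); [lra|easy]. }
    rewrite !Eg by lra. destruct (Hw2 t ltac:(lra)) as [Eu Hd]. split; [easy|]. intros i j Hi Hj.
    apply (is_derive_ext_loc (V := C_R_NormedModule) (fun s => entry (gam2 s) i j)); [|now apply Hd].
    apply (locally_interval b (q 1%nat)); [lra|]. intros s Hs. now rewrite Eg by lra.
  - replace (S k - n)%nat with (S (k - n)) by lia.
    destruct (Hq (k - n)%nat ltac:(lia)) as [Hlt [w [Hw1 Hw2]]]. split; [easy|]. exists w. split; [easy|].
    intros t Ht.
    assert (Hqb : b <= q (k - n)%nat).
    { rewrite <- Hq0. apply (partition_le q m); [|lia]. intros j Hj; apply Hq; lia. }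
    assert (Eg : forall (X : Type) (f g : R -> X) s, b < s -> glue f g b s = g s).
    { intros X f g s Hs. unfold glue. destruct (Rle_dec s b); [lra|easy]. }
    rewrite !Eg by lra. destruct (Hw2 t Ht) as [Eu Hd]. split; [easy|]. intros i j Hi Hj.
    apply (is_derive_ext_loc (V := C_R_NormedModule) (fun s => entry (gam2 s) i j)); [|now apply Hd].
    apply (locally_interval (q (k - n)%nat) (q (S (k - n)))); [easy|]. intros s Hs. now rewrite Eg by lra.
Qed.

Lemma joined_trans g h k L1 L2 : joined g h L1 -> joined h k L2 -> joined g k (L1 + L2).
Proof.
  intros [gam1 [u1 [a1 [b1 [H1 [Ea1 [Eb1 ->]]]]]]] [gam2 [u2 [a2 [b2 [H2 [Ea2 [Eb2 ->]]]]]]].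
  set (d := a2 - b1).
  assert (H2' := horizontal_shift gam2 u2 a2 b2 d H2).
  replace (a2 - d) with b1 in H2' by (unfold d; ring).
  set (gam2' := fun t => gam2 (t + d)) in *. set (u2' := fun t => u2 (t + d)) in *.
  assert (Eh : gam1 b1 = gam2' b1) by (unfold gam2', d; replace (b1 + (a2 - b1)) with a2 by ring; congruence).
  assert (Hab1 : a1 <= b1) by apply H1. assert (Hab2 : b1 <= b2 - d) by apply H2'.
  exists (glue gam1 gam2' b1), (glue u1 u2' b1), a1, (b2 - d).
  split; [now apply horizontal_glue|]. split; [now rewrite glue_l|]. split.
  - rewrite glue_r by easy. unfold gam2'. replace (b2 - d + d) with b2 by ring. easy.
  - symmetry. apply is_RInt_unique.
    apply (is_RInt_Chasles (V := R_NormedModule)) with b1.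
    + apply (is_RInt_ext (fun t => frame_norm (u1 t))); [|now apply (horizontal_is_RInt gam1)].
      rewrite Rmin_left, Rmax_right by lra. intros t Ht. now rewrite glue_l by lra.
    + replace (RInt (fun t => frame_norm (u2 t)) a2 b2) with (RInt (fun t => frame_norm (u2' t)) b1 (b2 - d)).
      * apply (is_RInt_ext (fun t => frame_norm (u2' t))); [|now apply (horizontal_is_RInt gam2')].
        rewrite Rmin_left, Rmax_right by lra. intros t Ht. unfold glue. destruct (Rle_dec t b1); [lra|easy].
      * apply is_RInt_unique.
        assert (HI := horizontal_is_RInt gam2 u2 a2 b2 H2).
        replace a2 with (1 * b1 + d) in HI at 1 by (unfold d; ring).
        replace b2 with (1 * (b2 - d) + d) in HI at 1 by ring.
        apply is_RInt_comp_lin in HI.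
        apply (is_RInt_ext (V := R_NormedModule)) with (2 := HI).
        intros t _. unfold u2'. change (1 * frame_norm (u2 (1 * t + d)) = frame_norm (u2 (t + d))).
        now rewrite !Rmult_1_l.
Qed.

Lemma d1_triangle g h k : in_SU11R g -> in_SU11R h -> in_SU11R k -> d1 g k <= d1 g h + d1 h k.
Proof.
  intros Hg Hh Hk.
  enough (d1 g k - d1 g h <= d1 h k) by lra.
  apply d1_ge; [now apply joined_exists|]. intros L2 HL2.
  enough (d1 g k - L2 <= d1 g h) by lra.
  apply d1_ge; [now apply joined_exists|]. intros L1 HL1.
  assert (H := d1_le _ _ _ (joined_trans _ _ _ _ _ HL1 HL2)). lra.
Qed.

Lemma d1_nonneg g h : in_SU11R g -> in_SU11R h -> 0 <= d1 g h.
Proof. intros Hg Hh. apply d1_ge; [now apply joined_exists|]. intros L HL. apply (joined_in _ _ _ HL). Qed.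

(** * The distance *)

Lemma minkowski x y z w : sqrt ((x + y) ^ 2 + (z + w) ^ 2) <= sqrt (x ^ 2 + z ^ 2) + sqrt (y ^ 2 + w ^ 2).
Proof.
  assert (H1 := sqrt_pos (x ^ 2 + z ^ 2)). assert (H2 := sqrt_pos (y ^ 2 + w ^ 2)).
  assert (E1 : sqrt (x ^ 2 + z ^ 2) ^ 2 = x ^ 2 + z ^ 2) by (apply pow2_sqrt; nra).
  assert (E2 : sqrt (y ^ 2 + w ^ 2) ^ 2 = y ^ 2 + w ^ 2) by (apply pow2_sqrt; nra).
  set (p := sqrt (x ^ 2 + z ^ 2)) in *. set (q := sqrt (y ^ 2 + w ^ 2)) in *.
  assert (Hc := cauchy_2 x z y w q p H2 H1 ltac:(lra) ltac:(lra)).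
  rewrite <- (sqrt_pow2 (p + q)) by lra. apply sqrt_le_1_alt. nra.
Qed.

Lemma minkowski_strict x z w : 0 < x -> w <> 0 -> sqrt (x ^ 2 + (z + w) ^ 2) < sqrt (x ^ 2 + z ^ 2) + Rabs w.
Proof.
  intros Hx Hw. assert (Hw0 := Rabs_pos_lt w Hw).
  assert (E1 : sqrt (x ^ 2 + z ^ 2) ^ 2 = x ^ 2 + z ^ 2) by (apply pow2_sqrt; nra).
  assert (Ew : Rabs w ^ 2 = w ^ 2) by (rewrite <- !Rsqr_pow2; symmetry; apply Rsqr_abs).
  assert (Hz : Rabs z < sqrt (x ^ 2 + z ^ 2)).
  { rewrite <- sqrt_Rsqr_abs. apply sqrt_lt_1_alt. rewrite Rsqr_pow2. assert (Hz2 := pow2_ge_0 z). assert (Hx2 : 0 < x ^ 2) by nra. lra. }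
  assert (Hzw : z * w <= Rabs z * Rabs w) by (rewrite <- Rabs_mult; apply Rle_abs).
  assert (Hp := Rabs_pos z).
  set (p := sqrt (x ^ 2 + z ^ 2)) in *.
  rewrite <- (sqrt_pow2 (p + Rabs w)) by lra. apply sqrt_lt_1_alt.
  assert (Hzp : Rabs z * Rabs w < p * Rabs w) by (apply Rmult_lt_compat_r; easy).
  split; [assert (G1 := pow2_ge_0 x); assert (G2 := pow2_ge_0 (z + w)); lra|].
  replace ((p + Rabs w) ^ 2) with (p ^ 2 + 2 * (p * Rabs w) + Rabs w ^ 2) by ring.
  rewrite E1, Ew. lra.
Qed.

Lemma in_elt A1 A2 B1 B2 v : A1 ^ 2 + A2 ^ 2 = 1 + (B1 ^ 2 + B2 ^ 2) -> in_SU11R (elt A1 A2 B1 B2 v).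
Proof. intros H. apply in_SU11R_elt. now exists A1, A2, B1, B2, v. Qed.

(** A lower bound on the arclength of the reduced paths is one leg of the right
    triangle of [reduction], and [v' - v] is the other. *)
Lemma d1_lower p1 p2 q1 q2 v p1' p2' q1' q2' v' ph m :
  has_arg p1 p2 q1 q2 v ph -> p1' ^ 2 + p2' ^ 2 = 1 + (q1' ^ 2 + q2' ^ 2) -> 0 <= m ->
  (forall a b l N phi s, redpath a b l N phi s -> N a = q1 ^ 2 + q2 ^ 2 -> N b = q1' ^ 2 + q2' ^ 2 ->
     phi a = ph -> has_arg p1' p2' q1' q2' v' (phi b) -> m <= s b - s a) ->
  sqrt (m ^ 2 + (v' - v) ^ 2) <= d1 (elt p1 p2 q1 q2 v) (elt p1' p2' q1' q2' v').
Proof.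
  intros Harg Hn' Hm H. apply d1_ge.
  - apply joined_exists; apply in_elt; [exact (has_arg_norm _ _ _ _ _ _ Harg)|exact Hn'].
  - intros L [gam [u [a [b [Hh [Ea [Eb ->]]]]]]].
    destruct (reduction gam u a b _ _ _ _ _ _ _ _ _ _ ph Hh Ea Eb Harg)
      as [l [N [phi [s [Hp [HNa [HNb [Hpa [Hsa [H1 HL]]]]]]]]]].
    apply Rle_trans with (2 := HL). apply sqrt_le_1_alt.
    assert (Hs := H a b l N phi s Hp HNa HNb Hpa H1). rewrite Hsa in Hs. nra.
Qed.

(** The geodesic gives the upper bound.  For the lower bound, a competing path
    may end at another argument of the same point, but this is at least [th]
    in absolute value. *)
Theorem d1_Id A1 A2 B1 B2 v th sg T : 0 <= th <= PI -> (sg = 1 \/ sg = -1) ->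
  has_arg A1 A2 B1 B2 v (sg * th) -> geo (rad B1 B2) th T ->
  d1 mat_Id (elt A1 A2 B1 B2 v) = sqrt (T ^ 2 + v ^ 2).
Proof.
  intros Hth Hsg Harg [k [Ha [HB HP]]]. apply Rle_antisym.
  - destruct (geodesic_through k T sg A1 A2 B1 B2 v Hsg HB) as [be Hbe]; [now rewrite HP|].
    rewrite <- (geodesic_0 k sg be T v), <- Hbe.
    replace (sqrt (T ^ 2 + v ^ 2)) with (sqrt (T ^ 2 + v ^ 2) * (1 - 0)) by ring.
    apply d1_le, geodesic_joined; [easy|lra].
  - rewrite <- elt_Id. replace v with (v - 0) at 1 by ring.
    apply d1_lower with (ph := 0).
    + unfold has_arg, modA. replace (0 - 0 / 2) with 0 by field. rewrite cos_0, sin_0.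
      replace (1 + (0 ^ 2 + 0 ^ 2)) with 1 by ring. rewrite sqrt_1. split; ring.
    + exact (has_arg_norm _ _ _ _ _ _ Harg).
    + apply Ha.
    + intros a b l N phi s Hp HNa HNb Hpa Harg'.
      apply (geodesic_minimal k T a b l N phi s); auto.
      * rewrite HNa. ring.
      * now rewrite HNb, HB, rad_sq.
      * rewrite HP. apply angle_min; [easy|].
        rewrite (proj1 (has_arg_cos _ _ _ _ _ _ _ Harg' Harg)). now apply cos_sg.
Qed.

(** * Shortest arcs *)

Lemma curve_length_ge gam a b s t : a <= s -> s <= t -> t <= b ->
  Rbar_le (d1 (gam a) (gam s) + d1 (gam s) (gam t) + d1 (gam t) (gam b)) (curve_length gam a b).
Proof.
  intros Has Hst Htb. apply Lub_Rbar_correct.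
  exists 2%nat, (fun k => match k with 0%nat => a | 1%nat => s | 2%nat => t | _ => b end).
  split; [easy|split; [easy|split; [|easy]]].
  intros k Hk. destruct k as [|[|[|k]]]; [easy|easy|easy|lia].
Qed.

(** Otherwise inserting the points [s] and [t] would give a length above the
    distance of the endpoints. *)
Lemma shortest_additive gam a b s t : shortest_arc gam a b -> a <= s -> s <= t -> t <= b ->
  d1 (gam a) (gam s) + d1 (gam s) (gam t) <= d1 (gam a) (gam t).
Proof.
  intros [[Hab [Hin _]] Hlen] Has Hst Htb.
  assert (H := curve_length_ge gam a b s t Has Hst Htb). rewrite Hlen in H. simpl in H.
  assert (Ht := d1_triangle (gam a) (gam t) (gam b) ltac:(apply Hin; lra) ltac:(apply Hin; lra) ltac:(apply Hin; lra)).
  lra.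
Qed.

(** The function [f] bounds all sums of distances by telescoping. *)
Lemma shortest_intro gam a b (f : R -> R) : curve_in_SU11R gam a b ->
  (forall s t, a <= s -> s <= t -> t <= b -> d1 (gam s) (gam t) <= f t - f s) ->
  f b - f a = d1 (gam a) (gam b) -> shortest_arc gam a b.
Proof.
  intros Hc Hf Hd. split; [easy|]. assert (Hab : a <= b) by apply Hc.
  apply is_lub_Rbar_unique. split.
  - intros l [n [p [Hp0 [Hpn [Hp ->]]]]]. simpl. rewrite <- Hd, <- Hp0, <- Hpn.
    assert (Hr : forall k, (k <= S n)%nat -> a <= p k).
    { intros k Hk. rewrite <- Hp0. induction k as [|k IH]; [lra|]. specialize (IH ltac:(lia)).
      specialize (Hp k ltac:(lia)). lra. }
    assert (Hm : forall m, (m <= n)%nat ->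
      sum_f_R0 (fun k => d1 (gam (p k)) (gam (p (S k)))) m <= f (p (S m)) - f (p 0%nat)).
    { assert (Hb : forall j, (j <= S n)%nat -> p j <= b).
      { intros j Hj. rewrite <- Hpn. replace j with (S n - (S n - j))%nat by lia.
        induction (S n - j)%nat as [|i IH]; [rewrite Nat.sub_0_r; lra|].
        destruct (le_lt_dec (S n) i) as [h|h]; [replace (S n - S i)%nat with (S n - i)%nat by lia; easy|].
        assert (H := Hp (S n - S i)%nat ltac:(lia)). replace (S (S n - S i)) with (S n - i)%nat in H by lia. lra. }
      induction m as [|m IH]; intros Hm.
      - simpl. apply Hf; [apply Hr; lia|apply Hp; lia|apply Hb; lia].
      - simpl sum_f_R0. specialize (IH ltac:(lia)).
        assert (H := Hf (p (S m)) (p (S (S m))) (Hr (S m) ltac:(lia)) (Hp (S m) ltac:(lia)) (Hb (S (S m)) ltac:(lia))). lra. }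
    apply Hm. lia.
  - intros l Hl. apply Hl. exists 0%nat, (fun k => match k with O => a | _ => b end).
    split; [easy|split; [easy|split; [|easy]]]. intros k Hk. assert (k = 0%nat) as -> by lia. easy.
Qed.

(** The arc [del] that prolongs [gam] is in general not a continuation of the
    same geodesic: all that matters is that distances add up at the junction. *)
Lemma continuable_intro gam a b del b' c' rho : shortest_arc gam a b ->
  b' < c' -> 0 < rho -> curve_in_SU11R del b' c' -> del b' = gam b ->
  (forall s t, b' <= s -> s <= t -> t <= c' -> d1 (del s) (del t) <= rho * (t - s)) ->
  d1 (gam a) (del c') = d1 (gam a) (gam b) + rho * (c' - b') ->
  continuable gam a b.
Proof.
  intros Hs Hbc Hrho Hdel Eb Hd Hadd.
  assert (Hcur : curve_in_SU11R gam a b) by apply Hs. assert (Hab : a <= b) by apply Hcur.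
  set (d := b' - b). set (c := c' - d). set (del' := fun t => del (t + d)).
  assert (Edel : gam b = del' b) by (unfold del', d; replace (b + (b' - b)) with b' by ring; easy).
  assert (Hdel' : curve_in_SU11R del' b c).
  { destruct Hdel as [H1 [H2 H3]]. split; [unfold c, d; lra|split].
    - intros t Ht. apply H2. unfold c, d in *. lra.
    - intros i j Hi Hj.
      assert (H := continuous_on_shift (U := C_UniformSpace) (fun t => entry (del t) i j) b' c' d (H3 i j Hi Hj)).
      replace (b' - d) with b in H by (unfold d; ring). exact H. }
  assert (Hin : forall t, a <= t <= b -> in_SU11R (gam t)) by apply Hcur.
  assert (Hin' : forall t, b <= t <= c -> in_SU11R (del' t)) by apply Hdel'.
  assert (Hbc' : b < c) by (unfold c, d; lra).
  set (eta := glue gam del' b).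
  assert (Er : forall t, b <= t -> eta t = del' t) by (intros t Ht; now apply glue_r).
  assert (El : forall t, t <= b -> eta t = gam t) by (intros t Ht; now apply glue_l).
  set (f := fun t => d1 (gam a) (gam (Rmin t b)) + rho * (Rmax t b - b)).
  assert (Hf1 : forall s t, a <= s -> s <= t -> t <= b -> d1 (gam s) (gam t) <= f t - f s).
  { intros s t H1 H2 H3. unfold f. rewrite !Rmin_left, !Rmax_right by lra.
    assert (H := shortest_additive gam a b s t Hs H1 H2 H3). lra. }
  assert (Hf2 : forall s t, b <= s -> s <= t -> t <= c -> d1 (del' s) (del' t) <= f t - f s).
  { intros s t H1 H2 H3. unfold f. rewrite !(Rmin_right _ b), !(Rmax_left _ b) by lra.
    assert (H := Hd (s + d) (t + d) ltac:(unfold d; lra) ltac:(lra) ltac:(unfold c in H3; lra)).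
    unfold del'. lra. }
  assert (Hsh : shortest_arc eta a c).
  { apply shortest_intro with f.
    - now apply glue_curve.
    - intros s t H1 H2 H3. destruct (Rle_dec t b) as [h|h].
      + rewrite !El by lra. apply Hf1; lra.
      + destruct (Rle_dec b s) as [h'|h'].
        * rewrite !Er by lra. apply Hf2; lra.
        * rewrite El, Er by lra.
          assert (G1 := Hf1 s b ltac:(lra) ltac:(lra) ltac:(lra)).
          assert (G2 := Hf2 b t ltac:(lra) ltac:(lra) ltac:(lra)). rewrite <- Edel in G2.
          assert (G3 := d1_triangle (gam s) (gam b) (del' t) ltac:(apply Hin; lra) ltac:(apply Hin; lra) ltac:(apply Hin'; lra)).
          lra.
    - assert (G := Hf1 a a ltac:(lra) ltac:(lra) ltac:(lra)).
      assert (G0 := shortest_additive gam a b a a Hs ltac:(lra) ltac:(lra) ltac:(lra)).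
      assert (G1 := d1_nonneg (gam a) (gam a) ltac:(apply Hin; lra) ltac:(apply Hin; lra)).
      rewrite El, Er by lra. unfold f. rewrite (Rmin_right c b), (Rmax_left c b), (Rmin_left a b), (Rmax_right a b) by lra.
      replace (del' c) with (del c') by (unfold del', c; f_equal; ring). rewrite Hadd. unfold c, d. lra. }
  exists eta, c. split; [easy|split; [intros t Ht; apply El; lra|split; [easy|]]].
  rewrite (proj2 Hs), (proj2 Hsh). rewrite (El a), (Er c) by lra. simpl.
  replace (del' c) with (del c') by (unfold del', c; f_equal; ring). rewrite Hadd. nra.
Qed.

(** Strictness of the triangle inequality through [g] for points near [g].
    Nearness is measured by a continuous function [Q] of the coordinates, which
    takes the place of the topology of the group: on a prolongation, [Q] is
    small near [g] by continuity, and [0 < Q] certifies that the arc has left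
    [g]. *)
Definition branching (p1 p2 q1 q2 v : R) (Q : R -> R -> R -> R -> R -> R) : Prop :=
  (forall A1 A2 B1 B2 w : R -> R, (forall t, continuous A1 t) -> (forall t, continuous A2 t) ->
     (forall t, continuous B1 t) -> (forall t, continuous B2 t) -> (forall t, continuous w t) ->
     forall t, continuous (fun t => Q (A1 t) (A2 t) (B1 t) (B2 t) (w t)) t) /\
  Q p1 p2 q1 q2 v = 0 /\
  exists e, 0 < e /\ forall A1 A2 B1 B2 w, A1 ^ 2 + A2 ^ 2 = 1 + (B1 ^ 2 + B2 ^ 2) -> Q A1 A2 B1 B2 w < e ->
    let g := elt p1 p2 q1 q2 v in let h := elt A1 A2 B1 B2 w in
    (0 < Q A1 A2 B1 B2 w -> 0 < d1 g h) /\
    (d1 mat_Id g < d1 mat_Id h -> d1 mat_Id h < d1 mat_Id g + d1 g h).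

(** A prolongation has a point near [g] that is farther from the unit: its end,
    if [Q] is small there, and otherwise any point with [0 < Q < e]. *)
Lemma branching_not_continuable p1 p2 q1 q2 v Q gam a b : branching p1 p2 q1 q2 v Q ->
  shortest_arc gam a b -> gam a = mat_Id -> gam b = elt p1 p2 q1 q2 v -> ~ continuable gam a b.
Proof.
  intros [HQc [HQg [e [He HQ]]]] Hs Ea Eb [eta [c [Hbc [Eeta [Hsh Hlt]]]]].
  rewrite (proj2 Hs), (proj2 Hsh) in Hlt. simpl in Hlt.
  assert (Hab : a <= b) by apply Hs.
  destruct (curve_coords eta a c (proj1 Hsh)) as [Hc Hrep].
  set (cl := fun t => Rmax a (Rmin c t)) in *.
  set (A1 := fun t => fst (entry (eta (cl t)) 0 0)). set (A2 := fun t => snd (entry (eta (cl t)) 0 0)).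
  set (B1 := fun t => fst (entry (eta (cl t)) 0 1)). set (B2 := fun t => snd (entry (eta (cl t)) 0 1)).
  set (w := fun t => ln (fst (entry (eta (cl t)) 2 2))).
  assert (Hrep' : forall t, a <= t <= c -> eta t = elt (A1 t) (A2 t) (B1 t) (B2 t) (w t) /\
     A1 t ^ 2 + A2 t ^ 2 = 1 + (B1 t ^ 2 + B2 t ^ 2)).
  { intros t Ht. unfold A1, A2, B1, B2, w, cl. rewrite clamp_id by easy. now apply Hrep. }
  assert (Ebt : eta b = elt p1 p2 q1 q2 v) by (rewrite Eeta by lra; exact Eb).
  assert (Eat : eta a = mat_Id) by (rewrite Eeta by lra; exact Ea).
  rewrite Ea, Eb, Eat in Hlt.
  set (q := fun t => Q (A1 t) (A2 t) (B1 t) (B2 t) (w t)).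
  assert (Hqc : forall t, continuous q t) by (apply HQc; intros s; apply (Hc s)).
  assert (Hadd : forall t, b <= t <= c -> d1 mat_Id (eta b) + d1 (eta b) (eta t) <= d1 mat_Id (eta t)).
  { intros t Ht. rewrite <- Eat. apply (shortest_additive eta a c); auto; lra. }
  assert (Hex : exists t, b <= t <= c /\ q t < e /\ d1 mat_Id (eta b) < d1 mat_Id (eta t)).
  { destruct (Rlt_dec (q c) e) as [h|h].
    - exists c. rewrite Ebt. split; [lra|easy].
    - destruct (Hrep' b ltac:(lra)) as [Hb1 _]. rewrite Ebt in Hb1. apply elt_inj in Hb1.
      assert (Hqb : q b = 0) by (destruct Hb1 as [Z1 [Z2 [Z3 [Z4 Z5]]]]; unfold q; now rewrite <- Z1, <- Z2, <- Z3, <- Z4, <- Z5).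
      destruct (IVT_gen q b c (e / 2)) as [t [Ht1 Ht2]].
      + intros t. apply continuity_pt_filterlim, Hqc.
      + rewrite Hqb, Rmin_left, Rmax_right by lra. lra.
      + rewrite Rmin_left, Rmax_right in Ht1 by lra. exists t. split; [easy|split; [lra|]].
        destruct (Hrep' t ltac:(lra)) as [Et Hn].
        assert (Hq : q t < e) by lra. destruct (HQ _ _ _ _ _ Hn Hq) as [Hpos _]. rewrite <- Et, <- Ebt in Hpos.
        assert (Hq0 : 0 < q t) by lra. specialize (Hpos Hq0). specialize (Hadd t Ht1). lra. }
  destruct Hex as [t [Ht [Hqt Hft]]]. destruct (Hrep' t ltac:(lra)) as [Et Hn].
  destruct (HQ _ _ _ _ _ Hn Hqt) as [_ Hstrict]. rewrite <- Et, <- Ebt in Hstrict.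
  specialize (Hstrict Hft). specialize (Hadd t Ht). lra.
Qed.

(** * The cut points *)

Lemma hyp_le x y w : 0 <= x -> x <= y -> sqrt (x ^ 2 + w ^ 2) <= sqrt (y ^ 2 + w ^ 2).
Proof. intros Hx Hy. apply sqrt_le_1_alt. nra. Qed.

Lemma hyp_lt x y w : 0 <= x -> x < y -> sqrt (x ^ 2 + w ^ 2) < sqrt (y ^ 2 + w ^ 2).
Proof. intros Hx Hy. apply sqrt_lt_1_alt. assert (G := pow2_ge_0 w). split; nra. Qed.

Lemma d1_abs_v p1 p2 q1 q2 v p1' p2' q1' q2' v' : p1 ^ 2 + p2 ^ 2 = 1 + (q1 ^ 2 + q2 ^ 2) ->
  p1' ^ 2 + p2' ^ 2 = 1 + (q1' ^ 2 + q2' ^ 2) ->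
  Rabs (v' - v) <= d1 (elt p1 p2 q1 q2 v) (elt p1' p2' q1' q2' v').
Proof.
  intros Hn Hn'. destruct (arg_exists p1 p2 q1 q2 v 0 Hn) as [th [sg [_ [_ Harg]]]].
  rewrite <- sqrt_Rsqr_abs, Rsqr_pow2. replace ((v' - v) ^ 2) with (0 ^ 2 + (v' - v) ^ 2) by ring.
  apply d1_lower with (1 := Harg); [easy|lra|].
  intros a b l N phi s Hp _ _ _ _. assert (H := redpath_s_mono _ _ _ _ _ _ Hp). lra.
Qed.

Lemma rad_cont (f g : R -> R) t : continuous f t -> continuous g t -> continuous (fun t => rad (f t) (g t)) t.
Proof. intros Hf Hg. unfold rad. cont. Qed.

Lemma has_arg_rotate A1 A2 B1 B2 w x y : has_arg A1 A2 B1 B2 w (x + y) ->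
  A1 * cos (x - w / 2) + A2 * sin (x - w / 2) = modA B1 B2 * cos y.
Proof.
  intros [-> ->]. replace (x + y - w / 2) with (x - w / 2 + y) by ring.
  set (z := x - w / 2). rewrite cos_plus, sin_plus.
  assert (E := sin2_cos2 z). unfold Rsqr in E.
  transitivity (modA B1 B2 * cos y * (sin z * sin z + cos z * cos z)); [ring|rewrite E; ring].
Qed.

Lemma sg_abs sg x : sg = 1 \/ sg = -1 -> 0 <= x -> Rabs (sg * x) = x.
Proof.
  intros [-> | ->] Hx; [rewrite Rmult_1_l; now apply Rabs_pos_eq|].
  replace (-1 * x) with (- x) by ring. rewrite Rabs_Ropp. now apply Rabs_pos_eq.
Qed.

(** The points of the axis outside the one-parameter group of [E4 - E3], where
    all rotated circles of the same holonomy end.  A step of length [s] to a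
    nearby point changes [phi] by at most [s^2] and moves it to a radius of at
    most [sinh (s/2)], so [strict_axis] applies; if the step leaves SU(1,1)
    fixed, the triangle formed with [v] is not degenerate. *)
Lemma branching_axis p1 p2 v th sg : 0 < th <= PI -> (sg = 1 \/ sg = -1) -> has_arg p1 p2 0 0 v (sg * th) ->
  branching p1 p2 0 0 v (fun A1 A2 B1 B2 w =>
    rad B1 B2 + (1 - (A1 * cos (sg * th - w / 2) + A2 * sin (sg * th - w / 2)) / modA B1 B2)).
Proof.
  intros Hth Hsg Harg. assert (HP := PI_RGT_0).
  assert (HF : forall A1 A2 B1 B2 w, A1 ^ 2 + A2 ^ 2 = 1 + (B1 ^ 2 + B2 ^ 2) ->
    exists ph s1, 0 <= ph <= PI /\ (s1 = 1 \/ s1 = -1) /\ has_arg A1 A2 B1 B2 w (sg * th + s1 * ph) /\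
      (A1 * cos (sg * th - w / 2) + A2 * sin (sg * th - w / 2)) / modA B1 B2 = cos ph).
  { intros A1 A2 B1 B2 w Hn. destruct (arg_exists A1 A2 B1 B2 w (sg * th) Hn) as [ph [s1 [Hph [Hs1 Ha]]]].
    exists ph, s1. split; [easy|split; [easy|split; [easy|]]].
    rewrite (has_arg_rotate _ _ _ _ _ _ _ Ha), cos_sg by easy. field. apply Rgt_not_eq, modA_pos. }
  split; [|split].
  - intros A1 A2 B1 B2 w C1 C2 C3 C4 C5 t.
    specialize (C1 t). specialize (C2 t). specialize (C3 t). specialize (C4 t). specialize (C5 t).
    assert (C6 := rad_cont B1 B2 t C3 C4). assert (Hm := modA_pos (B1 t) (B2 t)). unfold modA in *. cont; lra.
  - replace (sg * th) with (sg * th + 0) in Harg by ring.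
    rewrite (has_arg_rotate _ _ _ _ _ _ _ Harg), cos_0.
    unfold rad. replace (0 ^ 2 + 0 ^ 2) with 0 by ring. rewrite sqrt_0. field. apply Rgt_not_eq, modA_pos.
  - destruct (strict_axis th (proj1 Hth)) as [s0 [Hs0 Hstrict]].
    assert (HD0 : d1 mat_Id (elt p1 p2 0 0 v) = sqrt (loop_length th ^ 2 + v ^ 2)).
    { apply (d1_Id p1 p2 0 0 v th sg); [lra|easy|easy|].
      unfold rad. replace (0 ^ 2 + 0 ^ 2) with 0 by ring. rewrite sqrt_0. now apply loop_geo. }
    assert (HD := loop_length_pos th (proj1 Hth)). set (D := loop_length th) in *.
    assert (Hc0 : cos (s0 ^ 2) < 1).
    { rewrite <- cos_0. apply cos_decreasing_1; try nra. assert (3 < PI * 2) by (assert (H := PI2_3_2); lra). nra. }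
    exists (Rmin (sinh (s0 / 2)) (1 - cos (s0 ^ 2))).
    assert (Hsh : 0 < sinh (s0 / 2)) by (rewrite <- sinh_0; apply sinh_lt; lra).
    split; [apply Rmin_glb_lt; lra|].
    intros A1 A2 B1 B2 w Hn HQ g h.
    destruct (HF A1 A2 B1 B2 w Hn) as [ph [s1 [Hph [Hs1 [Ha HFe]]]]]. rewrite HFe in *.
    assert (M1 := Rmin_l (sinh (s0 / 2)) (1 - cos (s0 ^ 2))). assert (M2 := Rmin_r (sinh (s0 / 2)) (1 - cos (s0 ^ 2))).
    assert (Hb0 := rad_nonneg B1 B2). assert (Hcb := COS_bound ph).
    set (b := rad B1 B2) in *.
    assert (Hph1 : ph < s0 ^ 2).
    { apply Rnot_le_lt. intros Hle. assert (cos ph <= cos (s0 ^ 2)); [|lra].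
      destruct (Req_dec ph (s0 ^ 2)) as [->|Hne1]; [lra|]. left. apply cos_decreasing_1; nra. }
    assert (Hb1 : arcsinh b < s0 / 2).
    { rewrite <- (arcsinh_sinh (s0 / 2)). apply arcsinh_lt. lra. }
    assert (Hb2 : 0 <= arcsinh b) by (rewrite <- arcsinh_0; now apply arcsinh_le).
    set (s := Rmax (2 * arcsinh b) (sqrt ph)).
    assert (Hsq : sqrt ph ^ 2 = ph) by (apply pow2_sqrt; lra). assert (Hsq0 := sqrt_pos ph).
    assert (S1 := Rmax_l (2 * arcsinh b) (sqrt ph)). assert (S2 := Rmax_r (2 * arcsinh b) (sqrt ph)). fold s in S1, S2.
    assert (Hss0 : s < s0) by (apply Rmax_lub_lt; [lra|]; apply Rsqr_incrst_0; [rewrite !Rsqr_pow2; lra|easy|lra]).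
    (* every curve from the cut point to the nearby point has length at least [s] *)
    assert (Hlow : sqrt (s ^ 2 + (w - v) ^ 2) <= d1 (elt p1 p2 0 0 v) (elt A1 A2 B1 B2 w)).
    { apply d1_lower with (1 := Harg); [easy|lra|].
      intros a1 b1 l N phi sl Hp HNa HNb Hpa Hpb.
      assert (HN0 : N a1 = 0) by (rewrite HNa; ring).
      assert (Hbb : sqrt (N b1) = b) by (rewrite HNb; easy).
      assert (R1 := redpath_radius _ _ _ _ _ _ Hp). rewrite HN0, sqrt_0, arcsinh_0, Hbb, Rminus_0_r in R1.
      rewrite Rabs_pos_eq in R1 by easy.
      apply Rmax_lub; [easy|].
      destruct (Rle_dec (sl b1 - sl a1) 1) as [Hs|Hs].
      - assert (R2 := redpath_axis_phi _ _ _ _ _ _ Hp HN0 Hs).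
        assert (R3 : ph <= Rabs (phi b1 - phi a1)).
        { rewrite Hpa. apply angle_min; [easy|].
          rewrite (proj2 (has_arg_cos _ _ _ _ _ _ _ Hpb Ha) (sg * th)).
          replace (sg * th + s1 * ph - sg * th) with (s1 * ph) by ring. now apply cos_sg. }
        assert (R4 := redpath_s_mono _ _ _ _ _ _ Hp). nra.
      - nra. }
    split.
    { intros HQ0. assert (Hs : 0 < s).
      { destruct (Req_dec ph 0) as [Eph|]; [|assert (0 < sqrt ph) by (apply sqrt_lt_R0; lra); lra].
        rewrite Eph, cos_0 in HQ0. assert (0 < arcsinh b) by (rewrite <- arcsinh_0; apply arcsinh_lt; lra). lra. }
      apply Rlt_le_trans with (2 := Hlow), sqrt_lt_R0. assert (G := pow2_ge_0 (w - v)). nra. }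
    unfold g, h.
    destruct (arg_exists A1 A2 B1 B2 w 0 Hn) as [th' [sg' [Hth' [Hsg' Ha']]]]. rewrite Rplus_0_l in Ha'.
    destruct (geo_total b th' Hb0 (proj1 Hth')) as [T' HT'].
    rewrite (d1_Id A1 A2 B1 B2 w th' sg' T' Hth' Hsg' Ha' HT'), HD0.
    assert (Hle : th' <= th + ph).
    { assert (H1 : th' <= Rabs (sg * th + s1 * ph)).
      { apply angle_min; [easy|]. rewrite (proj1 (has_arg_cos _ _ _ _ _ _ _ Ha Ha')). now apply cos_sg. }
      assert (H2 := Rabs_triang (sg * th) (s1 * ph)). rewrite !sg_abs in H2 by (auto; lra). lra. }
    assert (HT0 : 0 <= T') by (destruct HT' as [k' [Hk' _]]; apply Hk').
    intros Hfar. destruct (Req_dec s 0) as [Es|Es].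
    + assert (Esq : sqrt ph = 0) by lra. assert (Eph : ph = 0) by (rewrite <- Hsq, Esq; ring). assert (Eb : b = 0).
      { rewrite <- (sinh_arcsinh b). replace (arcsinh b) with 0 by lra. apply sinh_0. }
      assert (HTD : T' <= D).
      { apply (geo_le 0 th' th); [now rewrite <- Eb|now apply loop_geo|lra]. }
      assert (Hwv : w - v <> 0).
      { intros E. assert (w = v) by lra. subst w. assert (G := hyp_le T' D v HT0 HTD). lra. }
      assert (Hms := minkowski_strict D v (w - v) HD Hwv). replace (v + (w - v)) with w in Hms by ring.
      assert (Hvv := d1_abs_v _ _ _ _ v _ _ _ _ w (has_arg_norm _ _ _ _ _ _ Harg) Hn).
      assert (sqrt (T' ^ 2 + w ^ 2) <= sqrt (D ^ 2 + w ^ 2)) by (now apply hyp_le).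
      lra.
    + assert (Hs : 0 < s) by lra.
      destruct (geo_total b (th + ph) Hb0 ltac:(lra)) as [T2 HT2].
      assert (HTT := geo_le _ _ _ _ _ HT' HT2 Hle).
      assert (HT2s : T2 < D + s).
      { apply (Hstrict s ph b T2); [lra|split; [lra|rewrite <- Hsq; apply pow_incr; lra]| |exact HT2]. split; [easy|].
        rewrite <- (sinh_arcsinh b). destruct (Req_dec (arcsinh b) (s / 2)) as [->|]; [lra|]. left. apply sinh_lt. lra. }
      assert (Hmk := minkowski D s v (w - v)). replace (v + (w - v)) with w in Hmk by ring.
      assert (sqrt (T' ^ 2 + w ^ 2) < sqrt ((D + s) ^ 2 + w ^ 2)).
      { apply hyp_lt; lra. }
      lra.
Qed.

(** The points with [A e^(i v / 2)] negative, where two geodesics that are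
    mirror images of each other end.  The argument [th'] of a nearby point is
    at most [PI], so its distance is bounded by that of the point with the same
    radius and argument [PI], to which [strict_radial] applies. *)
Lemma branching_opposite p1 p2 q1 q2 v : 0 < rad q1 q2 -> has_arg p1 p2 q1 q2 v PI ->
  branching p1 p2 q1 q2 v (fun _ _ B1 B2 _ => Rabs (rad B1 B2 - rad q1 q2)).
Proof.
  intros Hb Harg. assert (HP := PI_RGT_0).
  destruct (geo_exists (rad q1 q2) PI Hb ltac:(lra)) as [k [D [Hk1 [_ [Hk2 [Hk3 HD]]]]]].
  assert (HgD : geo (rad q1 q2) PI D) by (exists k; auto).
  set (b0 := rad q1 q2) in *.
  assert (HD0 : d1 mat_Id (elt p1 p2 q1 q2 v) = sqrt (D ^ 2 + v ^ 2)).
  { apply (d1_Id p1 p2 q1 q2 v PI 1); [lra|now left|now rewrite Rmult_1_l|exact HgD]. }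
  split; [|split].
  - intros A1 A2 B1 B2 w _ _ C3 C4 _ t. assert (C := rad_cont B1 B2 t (C3 t) (C4 t)). cont.
  - unfold Rminus. rewrite Rplus_opp_r. apply Rabs_R0.
  - destruct (strict_radial b0 PI D Hb HP HgD) as [e [He Hstrict]].
    exists e. split; [easy|]. intros A1 A2 B1 B2 w Hn HQ g h.
    assert (Hn0 := has_arg_norm _ _ _ _ _ _ Harg).
    destruct (arg_exists A1 A2 B1 B2 w 0 Hn) as [th' [sg' [Hth' [Hsg' Ha']]]]. rewrite Rplus_0_l in Ha'.
    set (b := rad B1 B2) in *.
    assert (Hb' : 0 < b) by (apply Rabs_def2 in HQ; lra).
    set (s := 2 * Rabs (arcsinh b - arcsinh b0)) in *.
    assert (Hs : 0 <= s) by (unfold s; assert (H := Rabs_pos (arcsinh b - arcsinh b0)); lra).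
    assert (Hlow : sqrt (s ^ 2 + (w - v) ^ 2) <= d1 g h).
    { apply d1_lower with (1 := Harg); [easy|easy|].
      intros a1 b1 l N phi sl Hp HNa HNb _ _.
      assert (R1 := redpath_radius _ _ _ _ _ _ Hp). rewrite HNa, HNb in R1. exact R1. }
    split.
    { intros HQ0. apply Rlt_le_trans with (2 := Hlow), sqrt_lt_R0. assert (G := pow2_ge_0 (w - v)).
      assert (0 < s); [|nra]. unfold s. assert (Hne : b <> b0) by (intros E; rewrite E, Rminus_diag_eq, Rabs_R0 in HQ0; lra).
      assert (Hne2 : arcsinh b - arcsinh b0 <> 0).
      { intros E. apply Hne. rewrite <- (sinh_arcsinh b), <- (sinh_arcsinh b0). f_equal. lra. }
      assert (H := Rabs_pos_lt _ Hne2). lra. }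
    unfold g, h in *.
    destruct (geo_total b th' ltac:(lra) (proj1 Hth')) as [T' HT'].
    destruct (geo_total b PI ltac:(lra) ltac:(lra)) as [T2 HT2].
    assert (HTT := geo_le _ _ _ _ _ HT' HT2 (proj2 Hth')).
    assert (HT0 : 0 <= T') by (destruct HT' as [k' [Hk' _]]; apply Hk').
    rewrite (d1_Id A1 A2 B1 B2 w th' sg' T' Hth' Hsg' Ha' HT'), HD0. intros Hfar.
    destruct (Req_dec b b0) as [Eb|Eb].
    + assert (HTD : T' <= D).
      { apply Rle_trans with (1 := HTT). right. apply (geo_unique b0 PI); [now rewrite <- Eb|easy]. }
      assert (Ew : w - v <> 0).
      { intros E. assert (w = v) by lra. subst w. assert (G := hyp_le T' D v HT0 HTD). lra. }
      assert (Hle := hyp_le T' D w HT0 HTD).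
      assert (Hms := minkowski_strict D v (w - v) HD Ew). replace (v + (w - v)) with w in Hms by ring.
      assert (Hvv := d1_abs_v _ _ _ _ v _ _ _ _ w Hn0 Hn). lra.
    + assert (Hst := Hstrict b HQ Eb T2 HT2). fold s in Hst.
      assert (Hmk := minkowski D s v (w - v)). replace (v + (w - v)) with w in Hmk by ring.
      assert (Hlt := hyp_lt T' (D + s) w HT0 ltac:(lra)). lra.
Qed.

(** It has constant speed, and its length is the distance of its endpoints
    because [gphi] has not passed [PI]. *)
Lemma geodesic_shortest k T sg be v : (sg = 1 \/ sg = -1) -> adm k T -> gphi k T <= PI ->
  shortest_arc (geodesic k sg be T v) 0 1 /\
  d1 mat_Id (geodesic k sg be T v 1) = sqrt (T ^ 2 + v ^ 2).
Proof.
  intros Hsg Ha HP.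
  assert (Hd : d1 mat_Id (geodesic k sg be T v 1) = sqrt (T ^ 2 + v ^ 2)).
  { assert (Harg := geodesic_has_arg k sg be T v 1 Hsg). rewrite (Rmult_1_r T) in Harg.
    unfold geodesic, curve_of. rewrite (d1_Id _ _ _ _ _ (gphi k T) sg T).
    - now rewrite Rmult_1_r.
    - split; [|easy]. apply gphi_nonneg; apply Ha.
    - easy.
    - exact Harg.
    - exists k. split; [easy|split; [|easy]]. unfold rad. rewrite geodesic_rad, Rmult_1_r.
      symmetry. now apply sqrt_pow2, gB_nonneg. }
  split; [|easy].
  apply shortest_intro with (fun t => sqrt (T ^ 2 + v ^ 2) * t).
  - eapply smooth_curve_in; [now apply geodesic_sc|lra].
  - intros s t _ Hst _. replace (sqrt (T ^ 2 + v ^ 2) * t - sqrt (T ^ 2 + v ^ 2) * s) with (sqrt (T ^ 2 + v ^ 2) * (t - s)) by ring.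
    now apply d1_le, geodesic_joined.
  - rewrite geodesic_0, Hd. ring.
Qed.

Lemma geodesic_to A1 A2 B1 B2 v th sg : 0 <= th <= PI -> (sg = 1 \/ sg = -1) -> has_arg A1 A2 B1 B2 v (sg * th) ->
  exists gam, shortest_arc gam 0 1 /\ gam 0 = mat_Id /\ gam 1 = elt A1 A2 B1 B2 v.
Proof.
  intros Hth Hsg Harg.
  destruct (geo_total (rad B1 B2) th (rad_nonneg _ _) (proj1 Hth)) as [T [k [Ha [HB HP]]]].
  destruct (geodesic_through k T sg A1 A2 B1 B2 v Hsg HB) as [be Hbe]; [now rewrite HP|].
  exists (geodesic k sg be T v). split; [apply geodesic_shortest; auto; lra|]. split; [apply geodesic_0|easy].
Qed.

Lemma geodesic_speed_scaled xi eta l : 0 <= l -> sqrt ((xi * l) ^ 2 + (eta * l) ^ 2) = sqrt (xi ^ 2 + eta ^ 2) * l.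
Proof.
  intros Hl. replace ((xi * l) ^ 2 + (eta * l) ^ 2) with ((xi ^ 2 + eta ^ 2) * l ^ 2) by ring.
  rewrite sqrt_mult by nra. now rewrite sqrt_pow2.
Qed.

(** As long as its argument is below [PI] and its circle is not closed, the
    geodesic satisfies the hypotheses of [geodesic_shortest] beyond the point. *)
Lemma continuable_off_axis A1 A2 B1 B2 v th sg gam a b : 0 <= th < PI -> (sg = 1 \/ sg = -1) ->
  has_arg A1 A2 B1 B2 v (sg * th) -> 0 < rad B1 B2 ->
  shortest_arc gam a b -> gam a = mat_Id -> gam b = elt A1 A2 B1 B2 v -> continuable gam a b.
Proof.
  intros Hth Hsg Harg Hb Hs Ea Eb.
  destruct (geo_exists (rad B1 B2) th Hb (proj1 Hth)) as [k [T [Ha [Hstr [HB [HP HT]]]]]].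
  destruct (geodesic_through k T sg A1 A2 B1 B2 v Hsg HB) as [be Hbe]; [now rewrite HP|].
  (* how far the geodesic can be followed *)
  assert (Hext : exists l, 1 < l /\ adm k (T * l) /\ gphi k (T * l) <= PI).
  { assert (Hk : 0 <= k) by apply Ha. assert (Hpos : 0 < PI - gphi k T) by (rewrite HP; lra).
    destruct (continuous_near _ T (gphi_cont k T) _ Hpos) as [d [Hd0 Hd]].
    set (r := sqrt (k ^ 2 - 1) / 2).
    assert (Hr : 0 <= r) by (unfold r; assert (H := sqrt_pos (k ^ 2 - 1)); lra).
    assert (Hm : exists m, 0 < m /\ (1 < k -> r * (T + m) <= PI)).
    { destruct (Rlt_dec 1 k) as [h|h].
      - exists ((PI - r * T) / (r + 1)). specialize (Hstr h). fold r in Hstr. split.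
        + apply Rdiv_lt_0_compat; lra.
        + intros _. replace (r * (T + (PI - r * T) / (r + 1))) with (r * T + (PI - r * T) * (r / (r + 1))) by (field; lra).
          assert (r / (r + 1) <= 1) by (apply Rle_div_l; lra). nra.
      - exists 1. split; [lra|intros; lra]. }
    destruct Hm as [m [Hm Hmk]].
    set (de := Rmin (d / 2) m).
    assert (M1 := Rmin_l (d / 2) m). assert (M2 := Rmin_r (d / 2) m). fold de in M1, M2.
    assert (Hde : 0 < de) by (apply Rmin_glb_lt; lra).
    exists (1 + de / T).
    assert (E : T * (1 + de / T) = T + de) by (field; lra). rewrite E.
    split; [assert (0 < de / T) by (apply Rdiv_lt_0_compat; lra); lra|].
    split; [split; [easy|split; [lra|]]|].
    - intros h. specialize (Hmk h). fold r. nra.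
    - specialize (Hd (T + de)). replace (T + de - T) with de in Hd by ring.
      rewrite Rabs_pos_eq in Hd by lra. specialize (Hd ltac:(lra)).
      apply Rabs_def2 in Hd. lra. }
  destruct Hext as [l [Hl [Hal HPl]]].
  assert (Hrho : 0 < sqrt (T ^ 2 + v ^ 2)) by (apply sqrt_lt_R0; assert (G := pow2_ge_0 v); nra).
  apply (continuable_intro gam a b (geodesic k sg be T v) 1 l (sqrt (T ^ 2 + v ^ 2))); auto.
  - eapply smooth_curve_in; [now apply geodesic_sc|lra].
  - congruence.
  - intros s t _ Hst _. now apply d1_le, geodesic_joined.
  - rewrite Ea, Eb, <- Hbe.
    rewrite (proj2 (geodesic_shortest k T sg be v Hsg Ha ltac:(lra))).
    replace (geodesic k sg be T v l) with (geodesic k sg be (T * l) (v * l) 1).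
    + rewrite (proj2 (geodesic_shortest k (T * l) sg be (v * l) Hsg Hal HPl)), geodesic_speed_scaled by lra. ring.
    + unfold geodesic, curve_of, gA1, gA2, gB1, gB2, gchi. rewrite !Rmult_1_r.
      replace ((sg * k * (T * l) - v * l) / 2) with ((sg * k * T - v) * l / 2) by field. easy.
Qed.

(** The one-parameter group of [E4 - E3] is a metric line, the geodesic of
    momentum and speed 0 in SU(1,1). *)
Lemma continuable_line A1 A2 v gam a b : has_arg A1 A2 0 0 v 0 ->
  shortest_arc gam a b -> gam a = mat_Id -> gam b = elt A1 A2 0 0 v -> continuable gam a b.
Proof.
  intros Harg Hs Ea Eb. assert (HP := PI_RGT_0).
  assert (Hsg : 1 = 1 \/ 1 = -1) by now left.
  set (eta := if Req_dec_T v 0 then 1 else v). set (b' := if Req_dec_T v 0 then 0 else 1).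
  assert (He : eta <> 0 /\ v = eta * b' /\ 0 <= b').
  { unfold eta, b'. destruct (Req_dec_T v 0); lra. }
  destruct He as [He0 [Hv Hb']].
  assert (Hadm : adm 0 0) by (apply adm_open; lra).
  assert (Hpt : forall t, geodesic 0 1 0 0 eta t = geodesic 0 1 0 0 (eta * t) 1).
  { intros t. unfold geodesic, curve_of, gA1, gA2, gB1, gB2, gchi. rewrite !Rmult_0_l, !Rmult_1_r.
    replace ((0 * 1 * 0 - eta) * t / 2) with ((0 * 1 * 0 - eta * t) / 2) by field.
    f_equal; f_equal; f_equal; f_equal; f_equal; ring. }
  assert (Hdist : forall t, 0 <= t -> d1 mat_Id (geodesic 0 1 0 0 eta t) = Rabs eta * t).
  { intros t Ht. rewrite Hpt, (proj2 (geodesic_shortest 0 0 1 0 (eta * t) Hsg Hadm ltac:(rewrite gphi_0; lra))).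
    replace (0 ^ 2 + (eta * t) ^ 2) with (Rsqr (eta * t)) by (unfold Rsqr; ring).
    rewrite sqrt_Rsqr_abs, Rabs_mult, (Rabs_pos_eq t) by easy. easy. }
  assert (Hgb : geodesic 0 1 0 0 eta b' = gam b).
  { rewrite Eb. destruct Harg as [-> ->].
    assert (Hra := geodesic_has_arg 0 1 0 0 eta b' Hsg).
    assert (Hgb0 : gB 0 (0 * b') = 0) by (rewrite Rmult_0_l; apply gB_0).
    unfold geodesic, curve_of. unfold has_arg in Hra.
    assert (E1 : gB1 0 (1 * 0) 0 0 eta b' = 0) by (unfold gB1; rewrite Hgb0; ring).
    assert (E2 : gB2 0 (1 * 0) 0 0 eta b' = 0) by (unfold gB2; rewrite Hgb0; ring).
    rewrite E1, E2 in *. rewrite Rmult_0_l, gphi_0 in Hra. destruct Hra as [-> ->].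
    rewrite <- Hv. f_equal; f_equal; f_equal; ring. }
  assert (Hrho : 0 < Rabs eta) by now apply Rabs_pos_lt.
  apply (continuable_intro gam a b (geodesic 0 1 0 0 eta) b' (b' + 1) (Rabs eta)); auto; try lra.
  - eapply smooth_curve_in; [now apply geodesic_sc|lra].
  - intros s t _ Hst _. rewrite <- sqrt_Rsqr_abs.
    replace (Rsqr eta) with (0 ^ 2 + eta ^ 2) by (unfold Rsqr; ring). now apply d1_le, geodesic_joined.
  - rewrite Ea, <- Hgb, !Hdist by lra. ring.
Qed.

Lemma C_pair_dec (x1 x2 y1 y2 : R) : {(x1, x2) = (y1, y2) :> C} + {(x1, x2) <> (y1, y2) :> C}.
Proof.
  destruct (Req_dec_T x1 y1) as [->|]; [destruct (Req_dec_T x2 y2) as [->|]|].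
  - now left.
  - right. now intros [= E].
  - right. now intros [= E _].
Qed.

Lemma Cmod_pair A1 A2 B1 B2 : A1 ^ 2 + A2 ^ 2 = 1 + (B1 ^ 2 + B2 ^ 2) -> Cmod (A1, A2) = modA B1 B2.
Proof. intros H. unfold Cmod, modA. simpl fst; simpl snd. now rewrite H. Qed.

Lemma SU11_pair A1 A2 B1 B2 : SU11 (A1, A2) (B1, B2) <-> A1 ^ 2 + A2 ^ 2 = 1 + (B1 ^ 2 + B2 ^ 2).
Proof.
  unfold SU11, Cmod. simpl fst; simpl snd. rewrite !pow2_sqrt by nra. split; intros; lra.
Qed.

Theorem proposition12 :
  forall g : M3, cut_locus mat_Id g <-> (Cut1_loc g \/ Cut1_glob g).
Proof.
  intros g. assert (HP := PI_RGT_0). split.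
  - intros [gam [a [b [Hs [Ea [Eb Hnc]]]]]].
    assert (Hin : in_SU11R g) by (rewrite <- Eb; apply (proj1 Hs); split; [apply Hs|lra]).
    apply in_SU11R_elt in Hin. destruct Hin as [A1 [A2 [B1 [B2 [v [Eg Hn]]]]]].
    destruct (arg_exists A1 A2 B1 B2 v 0 Hn) as [th [sg [Hth [Hsg Harg]]]]. rewrite Rplus_0_l in Harg.
    rewrite Eg in Eb.
    destruct (C_pair_dec B1 B2 0 0) as [EB|EB].
    + left. exists (A1, A2), (B1, B2), v. split; [now apply SU11_pair|split; [easy|split; [|easy]]].
      injection EB as -> ->. intros EA. apply Hnc.
      unfold Cexp_i in EA. injection EA as E1 E2.
      apply (continuable_line A1 A2 v gam a b); auto.
      unfold has_arg, modA. replace (1 + (0 ^ 2 + 0 ^ 2)) with 1 by ring. rewrite sqrt_1, !Rmult_1_l, E1, E2.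
      split; f_equal; field.
    + right. exists (A1, A2), (B1, B2), v. split; [now apply SU11_pair|split; [easy|split; [easy|]]].
      destruct (Req_dec th PI) as [->|Hne].
      * split.
        { intros EA. injection EA as E1 E2. rewrite E1, E2 in Hn. nra. }
        rewrite (Cmod_pair _ _ _ _ Hn). destruct Harg as [E1 E2].
        assert (EC : cos (sg * PI - v / 2) = cos (PI - v / 2) /\ sin (sg * PI - v / 2) = sin (PI - v / 2)).
        { destruct Hsg as [-> | ->]; [now rewrite Rmult_1_l|].
          replace (-1 * PI - v / 2) with (PI - v / 2 - 2 * PI) by ring.
          rewrite (cos_minus (PI - v / 2)), (sin_minus (PI - v / 2)), cos_2PI, sin_2PI. split; ring. }
        destruct EC as [EC1 EC2]. rewrite EC1 in E1. rewrite EC2 in E2. rewrite E1, E2.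
        unfold Cexp_i, RtoC, Cmult. simpl. f_equal; ring.
      * exfalso. apply Hnc. apply (continuable_off_axis A1 A2 B1 B2 v th sg gam a b); auto; [lra|].
        assert (H := rad_nonneg B1 B2). destruct (Req_dec (rad B1 B2) 0) as [E|]; [|lra].
        apply rad_0 in E. destruct E as [-> ->]. now exfalso.
  - intros [[[A1 A2] [B [v [Hn [-> [HA HB]]]]]]|[[A1 A2] [[B1 B2] [v [Hn [-> [HB [HA0 HA]]]]]]]].
    + subst B. unfold RtoC in *. apply SU11_pair in Hn.
      destruct (arg_exists A1 A2 0 0 v 0 Hn) as [th [sg [Hth [Hsg Harg]]]]. rewrite Rplus_0_l in Harg.
      assert (Hth0 : 0 < th).
      { destruct (Req_dec th 0) as [->|]; [|lra]. exfalso. apply HA. destruct Harg as [E1 E2].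
        unfold modA in E1, E2. replace (1 + (0 ^ 2 + 0 ^ 2)) with 1 in E1, E2 by ring.
        rewrite sqrt_1, Rmult_1_l in E1, E2. unfold Cexp_i.
        rewrite E1, E2. f_equal; f_equal; field. }
      destruct (geodesic_to A1 A2 0 0 v th sg Hth Hsg Harg) as [gam [Hs [E0 E1]]].
      exists gam, 0, 1. split; [easy|split; [easy|split; [easy|]]].
      exact (branching_not_continuable A1 A2 0 0 v _ gam 0 1
        (branching_axis A1 A2 v th sg (conj Hth0 (proj2 Hth)) Hsg Harg) Hs E0 E1).
    + apply SU11_pair in Hn.
      assert (Hb : 0 < rad B1 B2).
      { assert (H := rad_nonneg B1 B2). destruct (Req_dec (rad B1 B2) 0) as [E|]; [|lra].
        apply rad_0 in E. destruct E as [-> ->]. now exfalso. }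
      assert (Harg : has_arg A1 A2 B1 B2 v PI).
      { rewrite (Cmod_pair _ _ _ _ Hn) in HA. unfold Cexp_i, RtoC, Cmult in HA. simpl in HA.
        injection HA as E1 E2. split; lra. }
      destruct (geodesic_to A1 A2 B1 B2 v PI 1 ltac:(lra) ltac:(now left) ltac:(now rewrite Rmult_1_l)) as [gam [Hs [E0 E1]]].
      exists gam, 0, 1. split; [easy|split; [easy|split; [easy|]]].
      exact (branching_not_continuable A1 A2 B1 B2 v _ gam 0 1
        (branching_opposite A1 A2 B1 B2 v Hb Harg) Hs E0 E1).
Qed.
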